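(* For every constant $\varepsilon>0$ there is a parallel (static) algorithm that, given an undirected graph $G=(V,E)$ with $n=|V|$ vertices and $m=|E|$ edges, computes a $(2+\varepsilon)$-approximate $k$-core decomposition of $G$ in $O(n+m)$ expected work and $O(\log^3 n)$ depth with high probability, using $O(n+m)$ space.
   Context: The $k$-core of a graph $G$ (for a positive integer $k$) is the maximal subgraph of $G$ with minimum induced degree $k$. The coreness $k(v)$ of a vertex $v$ is the largest $k$ such that $v$ belongs to the $k$-core. A $c$-approximate $k$-core decomposition is a partition of the vertices into layers such that a vertex $v$ is in layer $k'$ only if $k(v)/c\le k'\le c\,k(v)$. Complexity is measured in the work-depth model: work is the total number of operations, depth is the length of the longest chain of sequential dependencies, and concurrent reads and writes cost $O(1)$. ''With high probability'' means with probability at least $1-1/n^c$ for any constant $c\ge1$. *)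

(* Defs.v *)
From HB Require Import structures.
From mathcomp Require Import all_boot all_order all_algebra.
From mathcomp Require Import all_classical all_reals all_analysis.

Set Implicit Arguments.
Unset Strict Implicit.
Unset Printing Implicit Defensive.

Import Order.TTheory GRing.Theory Num.Theory.
Import numFieldNormedType.Exports.

Local Open Scope classical_set_scope.
Local Open Scope ring_scope.

Definition min_degree_geq (V : finType) (e : rel V) (k : nat) (S : {set V}) :=
  [forall v in S, k <= #|[set u in S | e v u]|]%N.

(* The k-core, given by its vertex set: a maximal subgraph with all degrees at
   least k is induced.  Such a set always exists and is unique; it may be
   empty. *)
Definition kcore (V : finType) (e : rel V) (k : nat) (S : {set V}) :=
  maxset (min_degree_geq e k) S.

(* A k-core with k > #|V| is empty, so the bound on k is harmless.  Vertices in
   no k-core with k > 0 have coreness 0. *)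
Definition coreness (V : finType) (e : rel V) (v : V) : nat :=
  \max_(k < #|V|.+1 | [exists S, kcore e k S && (v \in S)]) k.

(* The partition is given by the index of the layer of each vertex. *)
Definition approx_core_decomposition (R : realType) (V : finType) (e : rel V)
    (c : R) (layer : V -> nat) : Prop :=
  forall v, (coreness e v)%:R / c <= (layer v)%:R <= c * (coreness e v)%:R.

Definition nb_edges (n : nat) (e : rel 'I_n) : nat :=
  #|[set uv : 'I_n * 'I_n | e uv.1 uv.2 & (uv.1 < uv.2)%N]|.

Definition adjacency_lists (n : nat) (e : rel 'I_n)
    (adj : 'I_n -> seq 'I_n) : Prop :=
  (forall v, uniq (adj v)) /\ (forall u v, (v \in adj u) = e u v).

(* Adjacency arrays: n, then n.+1 offsets, then the neighbours; the neighbours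
   of v are stored at the addresses n.+2 + j for off_v <= j < off_(v+1). *)
Definition graph_words (n : nat) (adj : 'I_n -> seq 'I_n) : seq nat :=
  n :: [seq (\sum_(u < n | u < k) size (adj u))%N | k <- iota 0 n.+1]
    ++ flatten [seq [seq val v | v <- adj u] | u <- enum 'I_n].

(* The work-depth model is a synchronous CRCW machine in work-time presentation.
   The control flow is sequential; [Pardo p g a v] lets the processors i < p act
   concurrently, each performing: if g then mem[a] := v.  All reads of a Pardo
   precede its writes.  Work charges every operator to every processor executing
   it; depth charges it once per parallel step.  Words have w bits, and
   arithmetic is modulo 2 ^ w. *)

Inductive binop := OAdd | OSub | OMul | ODiv | OMod | OLt | OEq.

Inductive expr :=
| Const of nat
| Pid                          (* index of the processor *)
| Rand                         (* random word of the processor *)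
| Read of expr
| Bin of binop & expr & expr
| Cond of expr & expr & expr.

Inductive cmd :=
| Skip
| Pardo of expr & expr & expr & expr
| Seq of cmd & cmd
| If of expr & cmd & cmd
| While of expr & cmd.

Definition memory := nat -> nat.

Record state := State {
  st_mem : memory;
  st_depth : nat;
  st_work : nat;
  st_space : nat
}.

Definition binop_sem (o : binop) (x y : nat) : nat :=
  match o with
  | OAdd => x + y
  | OSub => x - y
  | OMul => x * y
  | ODiv => x %/ y
  | OMod => x %% y
  | OLt => x < y
  | OEq => x == y
  end%N.

Fixpoint value (w : nat) (M : memory) (i r : nat) (e : expr) : nat :=
  match e with
  | Const k => k %% 2 ^ w
  | Pid => i
  | Rand => r
  | Read a => M (value w M i r a)
  | Bin o a b => binop_sem o (value w M i r a) (value w M i r b) %% 2 ^ w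
  | Cond g a b =>
      if value w M i r g != 0 then value w M i r a else value w M i r b
  end%N.

(* One more than the largest address read (0 if none). *)
Fixpoint extent (w : nat) (M : memory) (i r : nat) (e : expr) : nat :=
  match e with
  | Const _ | Pid | Rand => 0
  | Read a => maxn (extent w M i r a) (value w M i r a).+1
  | Bin _ a b => maxn (extent w M i r a) (extent w M i r b)
  | Cond g a b =>
      maxn (extent w M i r g)
        (if value w M i r g != 0 then extent w M i r a else extent w M i r b)
  end%N.

Fixpoint ops (e : expr) : nat :=
  match e with
  | Const _ | Pid | Rand => 1
  | Read a => (ops a).+1
  | Bin _ a b => (ops a + ops b).+1
  | Cond g a b => (ops g + ops a + ops b).+1
  end%N.

(* Resolution of concurrent writes: from the time, the memory, the address and
   the nonempty list [s] of competing processors, a number that modulo [size s]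
   is the position in [s] of the processor that succeeds. *)
Definition arbiter := nat -> memory -> nat -> seq nat -> nat.

Section Semantics.
Variables (w : nat) (arb : arbiter).
(* [rnd t i]: random word available to processor i at time t *)
Variable rnd : nat -> nat -> nat.

(* The control flow runs on processor 0. *)
Definition ctl_value (s : state) (e : expr) : nat :=
  value w (st_mem s) 0 (rnd (st_depth s) 0) e.

Definition ctl_charge (s : state) (e : expr) : state :=
  State (st_mem s) (st_depth s + ops e) (st_work s + ops e)
    (maxn (st_space s) (extent w (st_mem s) 0 (rnd (st_depth s) 0) e)).

Definition pardo_mem (t : nat) (M : memory) (p : nat) (g a v : expr) : memory :=
  fun x =>
    let val i := value w M i (rnd t i) in
    let s := [seq i <- iota 0 p | (val i g != 0%N) && (val i a == x)] in
    if s is [::] then M x else val (nth 0 s (arb t M x s %% size s))%N v.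

Definition pardo_extent (t : nat) (M : memory) (p : nat) (g a v : expr) : nat :=
  let val i := value w M i (rnd t i) in
  let ext i := extent w M i (rnd t i) in
  (\max_(i < p) maxn (ext i g)
     (if val i g != 0 then maxn (val i a).+1 (maxn (ext i a) (ext i v))
      else 0))%N.

(* The processors of a Pardo count as space: each one has registers. *)
Definition pardo (s : state) (p g a v : expr) : state :=
  let N := ctl_value s p in
  let s' := ctl_charge s p in
  let k := (ops g + ops a + ops v).+1 in
  State (pardo_mem (st_depth s') (st_mem s) N g a v)
    (st_depth s' + k) (st_work s' + N * k)
    (maxn (st_space s') (maxn N (pardo_extent (st_depth s') (st_mem s) N g a v))).

Inductive exec : cmd -> state -> state -> Prop :=
| exec_skip s : exec Skip s s
| exec_pardo p g a v s : exec (Pardo p g a v) s (pardo s p g a v)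
| exec_seq c1 c2 s1 s2 s3 :
    exec c1 s1 s2 -> exec c2 s2 s3 -> exec (Seq c1 c2) s1 s3
| exec_if b c1 c2 s s' :
    exec (if ctl_value s b != 0%N then c1 else c2) (ctl_charge s b) s' ->
    exec (If b c1 c2) s s'
| exec_while_end b c s :
    ctl_value s b = 0%N -> exec (While b c) s (ctl_charge s b)
| exec_while_loop b c s1 s2 s3 :
    ctl_value s1 b != 0%N -> exec c (ctl_charge s1 b) s2 ->
    exec (While b c) s2 s3 -> exec (While b c) s1 s3.

End Semantics.

(* Joint law of a family of mutually independent fair bits. *)
Definition fair_coins (R : realType) (d : measure_display)
    (Omega : measurableType d) (P : probability Omega R)
    (coin : nat * nat * nat -> Omega -> bool) : Prop :=
  (forall i, measurable [set x | coin i x]) /\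
  (forall (s : seq (nat * nat * nat)) (b : nat * nat * nat -> bool), uniq s ->
     P [set x | forall i, i \in s -> coin i x = b i] =
     ((2^-1 : R) ^+ size s)%:E).

(* Words of [kappa] times the bit length of n. *)
Definition word_size (kappa n : nat) : nat := (kappa * (trunc_log 2 n).+1)%N.

Definition random_word (Omega : Type) (coin : nat * nat * nat -> Omega -> bool)
    (w : nat) (x : Omega) (t i : nat) : nat :=
  (\sum_(j < w) coin (t, i, val j) x * 2 ^ j)%N.

(* The final states (at most one) of [prog] on the given graph; the set is
   empty if the run does not halt. *)
Definition final (kappa : nat) (prog : cmd) (arb : arbiter) (Omega : Type)
    (coin : nat * nat * nat -> Omega -> bool) (n : nat)
    (adj : 'I_n -> seq 'I_n) (x : Omega) : set state :=
  let w := word_size kappa n in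
  [set s | exec w arb (random_word coin w x) prog
             (State (nth 0%N (graph_words adj)) 0 0 0) s].

(* +oo on the runs that do not halt *)
Definition total_work (R : realType) (S : set state) : \bar R :=
  ereal_inf [set ((st_work s)%:R)%:E | s in S].

(* Main.v *)
(* Layer t = 1, 2, 4, ... is formed by repeatedly and simultaneously removing all
   the remaining vertices of remaining degree at most (2 + 1/q) t.
   Vertices of larger coreness are never removed, and edge counting shows that
   each round removes a fixed fraction of the remaining vertices of coreness at
   most t, so that after O(q log n) rounds only vertices of coreness more than t
   remain; hence a vertex of layer t has coreness at least t / 2 and at most
   (2 + 1/q) t.

   A removed vertex must decrement the degrees of its neighbours, and concurrent
   writes do not add up.  Two passes of counting sort in base log n merge the
   decrements of a vertex at neighbouring positions of its adjacency list, until
   the survivors can be subtracted one at a time, or, for large degrees, summed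
   by a scan.  This is deterministic and needs, for each arc, the position of the
   reverse arc.

   These positions are found by hashing both arcs of an edge to the same bucket:
   an arc and its twin recognise each other when no other edge shares the bucket.
   For a random multiplier modulo 2 ^ w and buckets of width about
   2 ^ w / 8m, an arc fails with probability at most 1/2, and independently in
   each round.  The depth of a round does not depend on the coins, so only the
   number of rounds is random: it exceeds (c + 2) log n with probability at most
   1 / n ^ c, and the expected number of unresolved arcs decreases geometrically. *)

Require Import Defs.
From HB Require Import structures.
From mathcomp Require Import all_boot all_order all_algebra.
From mathcomp Require Import all_classical all_reals all_analysis.
From mathcomp Require Import measurable_realfun zify ring lra.

Set Implicit Arguments.
Unset Strict Implicit.
Unset Printing Implicit Defensive.

Import Order.TTheory GRing.Theory Num.Theory.
Import numFieldNormedType.Exports.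

Local Open Scope nat_scope.


(** Write b for the bit length of n and M for the number of arcs. The peeling has 2 b levels of 2 q
    b rounds, so each of the O(b^2) rounds may spend only O(M / b^2 + b) beyond the degrees that it
    removes. A sorting pass is linear in its items, has depth O(b) and merges b neighbouring
    positions; two passes leave at most one item per block of b^2 positions. This is a single item
    for a vertex of degree at most b^2, and the blocks of larger vertices number O(M / b^2), few
    enough to be scanned in every round. The depth is that of O(b^2) rounds of depth O(b). The coins
    require care with time: the random words of different hash rounds are independent only if they
    are drawn at times fixed in advance. Hence the program logic computes exact running times, which
    depend on b alone, and the number of unresolved arcs is bounded by events about the words drawn
    at these times, whether or not the rounds take place. Correctness and space are shown for every
    halting run, whatever the coins and the arbiter; the coins decide only on halting, work and
    depth. *)

Inductive hexpr :=
| HC of nat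
| HP
| HI of hexpr
| HA of nat & hexpr
| HB of binop & hexpr & hexpr
| HM of binop & hexpr & hexpr
| HIf of hexpr & hexpr & hexpr.

(* [HFor cst r c] runs [c] for [r] = 0, ..., [cst * b - 1] with b the content of
   register 0, so that the depth of a command is a function of b. *)
Inductive hcmd :=
| HPar of hexpr & hexpr & nat & hexpr & hexpr
| HSeq of hcmd & hcmd
| HFor of nat & nat & hcmd
| HSeed of nat.

(* The working memory after the input holds [NA] interleaved arrays; a register
   is entry 0 of an array.  Arrays 0-6 serve scans and compaction (0: the bit
   length of n), 7-8 the vertices of positive degree, 9-13 and 31-32 the arcs
   leaving a list of vertices, 14-19 and 45 the hashing (14: sources, 15: arcs
   not yet resolved, 17: multiplier, 18: buckets, 19: one plus the reverse arc,
   45: bucket width), 20-22 degrees, removal flags and layers, 23 and 44 the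
   level and its threshold, 26-30 the candidates and then the decrements, 33-39
   the counting sort, 42-43 the scan of large degrees, the others loop counters
   and temporaries. *)
Definition NA := 48.

(** The first address after the input: word 0 holds n, word n + 1 holds the last offset, which is
    the number M of arcs, and the input takes n + M + 2 words. *)
Definition base_expr : expr :=
  Bin OAdd (Bin OAdd (Read (Const 0)) (Read (Bin OAdd (Read (Const 0)) (Const 1))))
    (Const 2).

Definition address (a : nat) (e : expr) : expr :=
  Bin OAdd (Bin OAdd base_expr (Bin OMul e (Const NA))) (Const a).

Arguments base_expr : simpl never.
Arguments address : simpl never.

Fixpoint compile (h : hexpr) : expr :=
  match h with
  | HC k => Const k
  | HP => Pid
  | HI e => Read (compile e)
  | HA a e => Read (address a (compile e))
  | HB o x y | HM o x y => Bin o (compile x) (compile y)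
  | HIf g x y => Cond (compile g) (compile x) (compile y)
  end.

Notation "'$' a" := (HA a (HC 0)) (at level 2, format "'$' a").

Definition HSet (a : nat) (v : hexpr) := HPar (HC 1) (HC 1) a (HC 0) v.

Definition par_cmd (p g : hexpr) (a : nat) (e v : hexpr) : cmd :=
  Pardo (compile p) (compile g) (address a (compile e)) (compile v).

Definition set_cmd (a : nat) (v : hexpr) : cmd :=
  par_cmd (HC 1) (HC 1) a (HC 0) v.

Definition for_guard (cst r : nat) : hexpr :=
  HB OLt ($ r) (HB OMul (HC cst) ($ 0)).

Fixpoint compile_cmd (c : hcmd) : cmd :=
  match c with
  | HPar p g a e v => par_cmd p g a e v
  | HSeq c1 c2 => Seq (compile_cmd c1) (compile_cmd c2)
  | HFor cst r c =>
      Seq (set_cmd r (HC 0))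
        (While (compile (for_guard cst r))
          (Seq (compile_cmd c) (set_cmd r (HB OAdd ($ r) (HC 1)))))
  | HSeed a => Pardo (Const 1) (Const 1) (address a (Const 0)) Rand
  end.

Definition par_ops (p g : hexpr) (a : nat) (e v : hexpr) : nat :=
  ops (compile p) +
  (ops (compile g) + ops (address a (compile e)) + ops (compile v)).+1.

Fixpoint hdepth (b : nat) (c : hcmd) : nat :=
  match c with
  | HPar p g a e v => par_ops p g a e v
  | HSeq c1 c2 => hdepth b c1 + hdepth b c2
  | HFor cst r c =>
      par_ops (HC 1) (HC 1) r (HC 0) (HC 0) +
      cst * b * (ops (compile (for_guard cst r)) +
        (hdepth b c + par_ops (HC 1) (HC 1) r (HC 0) (HB OAdd ($ r) (HC 1)))) +
      ops (compile (for_guard cst r))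
  | HSeed a => 1 + (ops (Const 1) + ops (address a (Const 0)) + ops Rand).+1
  end.

Fixpoint nest (c : hcmd) : nat :=
  match c with
  | HSeq c1 c2 => maxn (nest c1) (nest c2)
  | HFor _ _ c => (nest c).+1
  | _ => 0
  end.

(** Since b is positive, the additive costs of a loop are absorbed by a factor b. The bound log^3 n
    is read off the syntax in this way: the peeling has loop nesting 3. *)
Lemma hdepth_bound (c : hcmd) :
  exists C, forall b, 0 < b -> hdepth b c <= C * b ^ nest c.
Proof.
elim: c => [p g a e v|c1 [C1 H1] c2 [C2 H2]|cst r c [C H]|a].
- by exists (par_ops p g a e v) => b _ /=; rewrite muln1.
- exists (C1 + C2) => b b0 /=; rewrite mulnDl leq_add //.
    apply: (leq_trans (H1 b b0)); rewrite leq_mul2l leq_pexp2l ?leq_maxl ?orbT //.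
  apply: (leq_trans (H2 b b0)); rewrite leq_mul2l leq_pexp2l ?leq_maxr ?orbT //.
- pose A := par_ops (HC 1) (HC 1) r (HC 0) (HC 0).
  pose G := ops (compile (for_guard cst r)).
  pose D := par_ops (HC 1) (HC 1) r (HC 0) (HB OAdd ($ r) (HC 1)).
  have E0 b : hdepth b (HFor cst r c) = A + cst * b * (G + (hdepth b c + D)) + G by [].
  have E1 : nest (HFor cst r c) = (nest c).+1 by [].
  move: A G D E0 => A G D E0; rewrite E1.
  exists (A + cst * (G + (C + D)) + G) => b b0; rewrite E0.
  have b1 : 0 < b ^ nest c by rewrite expn_gt0 b0.
  have := H b b0; set X := b ^ nest c in b1 *; rewrite expnS -/X => HX.
  have Hb : 1 <= b * X by rewrite muln_gt0 b0.
  have E : G + (hdepth b c + D) <= (G + (C + D)) * X by nia.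
  rewrite !mulnDl; apply: leq_add; last by rewrite leq_pmulr.
  apply: leq_add; first by rewrite leq_pmulr.
  rewrite -!mulnA leq_mul2l; apply/orP; right.
  by rewrite mulnCA leq_mul2l E orbT.
- by exists (1 + (1 + ops (address a (Const 0)) + 1).+1) => b _; rewrite muln1.
Qed.

(** The only fact about concurrent writes that the program logic uses; as it holds for every
    arbiter, so do all triples derived from it. *)
Lemma pardo_memP w arb rnd t M p g a v x :
  let val i := value w M i (rnd t i) in
  (pardo_mem w arb rnd t M p g a v x = M x /\
     forall i, i < p -> val i g != 0 -> val i a <> x) \/
  (exists i, [/\ i < p, val i g != 0, val i a = x &
     pardo_mem w arb rnd t M p g a v x = val i v]).
Proof.
move=> val; rewrite /pardo_mem.
set s := [seq i <- iota 0 p | _].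
have sE i : (i \in s) = [&& i < p, val i g != 0 & val i a == x].
  by rewrite mem_filter mem_iota add0n leq0n /= andbC.
case Es : s => [|y s'].
  left; split=> // i ip gi ax; have := sE i; rewrite Es in_nil ip gi.
  by move/eqP: ax => ->.
right; rewrite -Es; set i := nth _ _ _; exists i.
have : i \in s by rewrite mem_nth // ltn_mod Es.
by rewrite sE => /and3P[? ? /eqP ?].
Qed.

Lemma pardo_mem_lt w arb rnd t M p g a v :
  (forall x, M x < 2 ^ w) -> (forall t i, rnd t i < 2 ^ w) ->
  p <= 2 ^ w -> forall x, pardo_mem w arb rnd t M p g a v x < 2 ^ w.
Proof.
move=> HM Hr Hp x.
have V e i : i < 2 ^ w -> value w M i (rnd t i) e < 2 ^ w.
  move=> Hi; elim: e => //= [k|o e1 _ e2 _|g' _ e1 ? e2 ?].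
  - by rewrite ltn_mod expn_gt0.
  - by rewrite ltn_mod expn_gt0.
  - by case: ifP.
case: (pardo_memP w arb rnd t M p g a v x) => [[-> _]//|[i [ip _ _ ->]]].
by apply: V; apply: leq_trans Hp.
Qed.

(** * Machine configurations and a Hoare logic with exact running times *)

Definition store := nat -> nat -> nat.

Definition upd (s : store) (a : nat) (f : nat -> nat) : store :=
  fun a' => if a' == a then f else s a'.

Definition upd0 (f : nat -> nat) (v : nat) : nat -> nat :=
  fun j => if j == 0 then v else f j.

(* Every parallel step is charged at most [op_bound] operations per processor,
   so that work is counted in units of [op_bound]. *)
Definition op_bound := 3000.

(** [c_len] is the length of the arrays, [c_ext] the space bound, and [c_b] stands for the bit
    length of n. By [c_len_pow], [20 * b] doublings exceed every array length, which is what [scan]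
    iterates; [c_powW] keeps its stride within a word, and [c_lenW] makes room for products of two
    indices, such as edge keys. *)
Record config := Config {
  c_w : nat;
  c_arb : arbiter;
  c_rnd : nat -> nat -> nat;
  c_inp : memory;
  c_len : nat;
  c_ext : nat;
  c_b : nat;
  c_inpW : forall x, c_inp x < 2 ^ c_w;
  c_rndW : forall t i, c_rnd t i < 2 ^ c_w;
  c_ext_ge : c_inp 0 + c_inp (c_inp 0).+1 + 2 + c_len * NA <= c_ext;
  c_extW : c_ext < 2 ^ c_w;
  c_len_ge : 1000 <= c_len;
  c_lenW : 4 * (c_len * c_len) < 2 ^ c_w;
  c_b_gt0 : 0 < c_b;
  c_b_len : 10 * c_b <= c_len;
  c_len_pow : c_len <= 2 ^ (20 * c_b);
  c_powW : 4 * 2 ^ (20 * c_b) < 2 ^ c_w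
}.

Section Machine.
Variable mc : config.
Local Notation w := (c_w mc).
Local Notation arb := (c_arb mc).
Local Notation rnd := (c_rnd mc).
Local Notation inp := (c_inp mc).
Local Notation len := (c_len mc).
Local Notation ext := (c_ext mc).
Local Notation b := (c_b mc).
Local Notation W := (2 ^ w).

Definition base := inp 0 + inp (inp 0).+1 + 2.

Let inpW := c_inpW mc.
Let rndW := c_rndW mc.
Let ext_ge : base + len * NA <= ext := c_ext_ge mc.
Let extW := c_extW mc.
Let len_gt0 : 0 < len. Proof. by have := c_len_ge mc; lia. Qed.

Fixpoint den (s : store) (i : nat) (h : hexpr) : nat :=
  match h with
  | HC k => k
  | HP => i
  | HI e => inp (den s i e)
  | HA a e => s a (den s i e)
  | HB o x y => binop_sem o (den s i x) (den s i y)
  | HM o x y => binop_sem o (den s i x) (den s i y) %% W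
  | HIf g x y => if den s i g != 0 then den s i x else den s i y
  end.

(** [HB] and [HM] compile to the same instruction. For [HB] the absence of overflow is a proof
    obligation, so that [den] can compute in the natural numbers; [HM] keeps the reduction modulo
    [2 ^ w], on which the hash function and the overflow test of [prepare_cmd] rely. *)
Fixpoint safe (s : store) (i : nat) (h : hexpr) : Prop :=
  match h with
  | HC k => k < W
  | HP => True
  | HI e => safe s i e /\ den s i e < base
  | HA a e => [/\ safe s i e, den s i e < len & a < NA]
  | HB o x y => [/\ safe s i x, safe s i y &
      match o with
      | OAdd => den s i x + den s i y < W
      | OMul => den s i x * den s i y < W
      | _ => True
      end]
  | HM o x y => safe s i x /\ safe s i y
  | HIf g x y => [/\ safe s i g, den s i g != 0 -> safe s i x &
                    den s i g = 0 -> safe s i y]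
  end.

Definition represents (M : memory) (s : store) :=
  [/\ forall x, x < base -> M x = inp x,
      forall a i, a < NA -> M (base + i * NA + a) = s a i &
      forall x, M x < W].

Lemma W_gt0 : 0 < W. Proof. by rewrite expn_gt0. Qed.

Lemma base_W : base + NA < W.
Proof. by have : 1 * NA <= len * NA by [rewrite leq_mul]; lia. Qed.

Lemma value_base M s i r :
  represents M s -> value w M i r base_expr = base /\
  extent w M i r base_expr <= ext.
Proof.
case=> Hi _ _.
have := base_W; have := ext_ge; rewrite /base /NA => Ge HbW.
have n0 : M 0 = inp 0 by apply: Hi; rewrite /base; lia.
have n1 : M (inp 0).+1 = inp (inp 0).+1 by apply: Hi; rewrite /base; lia.
rewrite /= (modn_small W_gt0) n0 (@modn_small 1) ?(@modn_small 2); try lia.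
rewrite addn1 (@modn_small (inp 0).+1); last by lia.
rewrite n1 (@modn_small (inp 0 + _)); last by lia.
rewrite modn_small; last by lia.
by split=> //; rewrite !geq_max; lia.
Qed.

Lemma value_address M s i r a e x :
  represents M s -> a < NA -> value w M i r e = x -> x < len ->
  extent w M i r e <= ext ->
  value w M i r (address a e) = base + x * NA + a /\
  extent w M i r (address a e) <= ext /\ base + x * NA + a < ext.
Proof.
move=> HM Ha Hv Hx He; have [Vb Eb] := value_base i r HM.
have HbW := base_W; have Ge := ext_ge; have HW := extW.
have L : base + x * NA + a < ext.
  apply: leq_trans Ge; rewrite -addnA ltn_add2l.
  apply: (@leq_trans (x.+1 * NA)); first by rewrite mulSn; lia.
  by rewrite leq_mul2r Hx orbT.
split; last split=> //.
  have -> : value w M i r (address a e) = (((value w M i r base_expr +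
      (value w M i r e * (NA %% W)) %% W) %% W) + a %% W) %% W by [].
  rewrite Vb Hv.
  rewrite (@modn_small NA) ?(@modn_small a) ?(@modn_small (x * NA)); try lia.
  by rewrite (@modn_small (base + _)) ?modn_small; lia.
have -> : extent w M i r (address a e) = maxn (maxn (extent w M i r base_expr)
    (maxn (extent w M i r e) 0)) 0 by [].
by move: Eb He; move: (extent w M i r base_expr) (extent w M i r e); lia.
Qed.

Lemma compileP M s i r h :
  represents M s -> i < W -> safe s i h ->
  [/\ value w M i r (compile h) = den s i h,
      extent w M i r (compile h) <= ext & den s i h < W].
Proof.
move=> HM Hi; have [H1 H2 H3] := HM; have Ge := ext_ge; have HW := extW.
elim: h => [k|//|e IH|a e IH|o x IHx y IHy|o x IHx y IHy|g IHg x IHx y IHy].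
- by move=> Hk; split; rewrite /= ?modn_small.
- move=> [/IH[V X D] B]; split=> /=.
  + by rewrite V H1.
  + by rewrite V geq_max X; lia.
  + exact: inpW.
- case=> /IH[V X D] B Ha.
  have [AV [AX AL]] := value_address HM Ha V B X.
  have EV : value w M i r (compile (HA a e)) =
    M (value w M i r (address a (compile e))) by [].
  have EX : extent w M i r (compile (HA a e)) =
    maxn (extent w M i r (address a (compile e)))
      (value w M i r (address a (compile e))).+1 by [].
  split; first by rewrite EV AV H2.
    by rewrite EX AV; move: AX AL; move: (extent w M i r (address a (compile e))); lia.
  by rewrite /= -H2 // H3.
- case=> /IHx[Vx Xx Dx] /IHy[Vy Xy Dy] Hs.
  have L : binop_sem o (den s i x) (den s i y) < W.
    have := base_W; rewrite /NA => HB.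
    case: o Hs => //= _; first [lia | exact: leq_ltn_trans (leq_div _ _) Dx
      | exact: leq_ltn_trans (leq_mod _ _) Dx].
  by split=> //=; rewrite ?Vx ?Vy ?modn_small // geq_max Xx Xy.
- case=> /IHx[Vx Xx Dx] /IHy[Vy Xy Dy].
  by split=> //=; rewrite ?Vx ?Vy ?geq_max ?Xx ?Xy // ltn_mod W_gt0.
- case=> /IHg[Vg Xg Dg] Hx Hy.
  rewrite /= Vg geq_max Xg /=; case: (eqVneq (den s i g) 0) => Eg /=.
    by have [? ? ?] := IHy (Hy Eg); split.
  by have [? ? ?] := IHx (Hx Eg); split.
Qed.

(* [hoare c s t Q]: started at time [t] in a memory representing [s], [c]
   terminates after exactly [hdepth b c] steps, within space [ext], in a memory
   representing some [s'] such that [Q s' u], having done at most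
   [op_bound * u] work. *)
Definition hoare (c : hcmd) (s : store) (t : nat) (Q : store -> nat -> Prop) :=
  forall M wk sp, represents M s -> sp <= ext ->
  exists M' s' k u sp', [/\
    exec w arb rnd (compile_cmd c) (State M t wk sp)
      (State M' (t + hdepth b c) (wk + k) sp'),
    represents M' s', sp' <= ext, k <= op_bound * u & Q s' u].

Lemma hoare_conseq c s t (Q Q' : store -> nat -> Prop) :
  hoare c s t Q -> (forall s' u, Q s' u -> Q' s' u) -> hoare c s t Q'.
Proof.
move=> H QQ M wk sp HM Hsp; have [M' [s' [k [u [sp' [? ? ? ? ?]]]]]] := H M wk sp HM Hsp.
by exists M', s', k, u, sp'; split=> //; apply: QQ.
Qed.

Lemma hoare_seq c1 c2 s t (Q : store -> nat -> Prop) :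
  hoare c1 s t (fun s1 u1 =>
    hoare c2 s1 (t + hdepth b c1) (fun s2 u2 => Q s2 (u1 + u2))) ->
  hoare (HSeq c1 c2) s t Q.
Proof.
move=> H M wk sp HM Hsp.
have [M1 [s1 [k1 [u1 [sp1 [X1 R1 S1 K1 H2]]]]]] := H M wk sp HM Hsp.
have [M2 [s2 [k2 [u2 [sp2 [X2 R2 S2 K2 H3]]]]]] := H2 M1 (wk + k1) sp1 R1 S1.
exists M2, s2, (k1 + k2), (u1 + u2), sp2; split=> //.
  by apply: (exec_seq X1); rewrite /= !addnA in X2 *.
by rewrite mulnDr leq_add.
Qed.

(** A relation, since the content after concurrent writes depends on the arbiter. *)
Definition par_content (s : store) N g a e v (f : nat -> nat) :=
  forall j,
  (f j = s a j /\ forall i, i < N -> den s i g != 0 -> den s i e <> j) \/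
  (exists i, [/\ i < N, den s i g != 0, den s i e = j & f j = den s i v]).

(** Processors count as space, hence the bound of their number by [ext]. One unit of work per
    processor and one for the evaluation of their number suffice, because [par_ops] is at most
    [op_bound]. *)
Lemma hoare_par p g a e v s t (Q : store -> nat -> Prop) :
  a < NA -> par_ops p g a e v <= op_bound ->
  safe s 0 p -> den s 0 p <= ext ->
  (forall i, i < den s 0 p -> safe s i g /\ (den s i g != 0 ->
     [/\ safe s i e, den s i e < len & safe s i v])) ->
  (forall f, par_content s (den s 0 p) g a e v f -> Q (upd s a f) (den s 0 p).+1) ->
  hoare (HPar p g a e v) s t Q.
Proof.
move=> Ha Hops Hp HN Hs HQ M wk sp HM Hsp.
have HW := extW.
have [Vp Xp Dp] := compileP (rnd t 0) HM W_gt0 Hp.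
set N := den s 0 p in HN Hs HQ Vp Dp.
set st0 := State M t wk sp.
pose st1 := pardo w arb rnd st0 (compile p) (compile g) (address a (compile e)) (compile v).
pose M' := st_mem st1.
pose T := t + ops (compile p).
have cN : ctl_value w rnd st0 (compile p) = N by rewrite /ctl_value /= Vp.
have G i (iN : i < N) : safe s i g by case: (Hs i iN).
have iW i : i < N -> i < W by lia.
have gV i (iN : i < N) : value w M i (rnd T i) (compile g) = den s i g.
  by have [] := compileP (rnd T i) HM (iW i iN) (G i iN).
have aV i (iN : i < N) : den s i g != 0 ->
  [/\ value w M i (rnd T i) (address a (compile e)) = base + den s i e * NA + a,
      extent w M i (rnd T i) (address a (compile e)) <= ext &
      base + den s i e * NA + a < ext].
  move=> gi; have [_ /(_ gi)[Se Le _]] := Hs i iN.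
  have [Ve Xe De] := compileP (rnd T i) HM (iW i iN) Se.
  by have [? [? ?]] := value_address HM Ha Ve Le Xe.
have vV i (iN : i < N) : den s i g != 0 ->
  value w M i (rnd T i) (compile v) = den s i v /\
  extent w M i (rnd T i) (compile v) <= ext.
  move=> gi; have [_ /(_ gi)[_ _ Sv]] := Hs i iN.
  by have [] := compileP (rnd T i) HM (iW i iN) Sv.
have M'E : M' = pardo_mem w arb rnd T M N (compile g) (address a (compile e)) (compile v).
  by rewrite /M' /st1 /pardo cN.
have M'P x : (M' x = M x /\ forall i, i < N -> den s i g != 0 ->
    base + den s i e * NA + a <> x) \/
  (exists i, [/\ i < N, den s i g != 0, base + den s i e * NA + a = x & M' x = den s i v]).
  rewrite M'E.
  case: (pardo_memP w arb rnd T M N (compile g) (address a (compile e)) (compile v) x).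
    case=> -> H; left; split=> // i iN gi.
    by have [<- _ _] := aV i iN gi; apply: H; rewrite ?gV.
  case=> i [iN gi ai ->]; right; rewrite gV // in gi; exists i; split=> //.
    by have [<- _ _] := aV i iN gi.
  by have [-> _] := vV i iN gi.
pose f j := M' (base + j * NA + a).
have [HM1 HM2 HM3] := HM.
have naddr a1 i1 a2 i2 : a1 < NA -> a2 < NA ->
  base + i1 * NA + a1 = base + i2 * NA + a2 -> a1 = a2 /\ i1 = i2.
  by rewrite /NA; lia.
have RM' : represents M' (upd s a f).
  split.
  - move=> x Hx; case: (M'P x) => [[-> _]|[i [_ _ E _]]]; first exact: HM1.
    by move: Hx; rewrite -E; lia.
  - move=> a' j Ha'; rewrite /upd; case: eqP => [->//|na].
    case: (M'P (base + j * NA + a')) => [[-> _]|[i [_ _ E _]]]; first exact: HM2.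
    by have [] := naddr _ _ _ _ Ha Ha' E; move=> /esym.
  - by rewrite M'E; apply: pardo_mem_lt => //; lia.
have Hf : par_content s N g a e v f.
  move=> j; case: (M'P (base + j * NA + a)) => [[E H]|[i [iN gi E V]]].
    left; split; first by rewrite /f E HM2.
    by move=> i iN gi ej; apply: (H i iN gi); rewrite ej.
  by right; exists i; split=> //; have [] := naddr _ _ _ _ Ha Ha E.
exists M', (upd s a f), (ops (compile p) + N * (ops (compile g) +
  ops (address a (compile e)) + ops (compile v)).+1), N.+1, (st_space st1).
split=> //.
- have -> : State M' (t + hdepth b (HPar p g a e v)) (wk + (ops (compile p) + N * (ops (compile g) +
    ops (address a (compile e)) + ops (compile v)).+1)) (st_space st1) = st1.
    by rewrite /hdepth /par_ops /M' /st1 /pardo cN addnA addnA.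
  exact: exec_pardo.
- rewrite /st1 /pardo cN; cbv beta iota zeta delta [st_space ctl_charge st_depth st_mem].
  rewrite 2!geq_max Hsp Xp geq_max HN andTb /pardo_extent.
  apply/bigmax_leqP => -[i iN] _; cbn [nat_of_ord].
  have [_ Xg _] := compileP (rnd T i) HM (iW i iN) (G i iN).
  rewrite geq_max -/T Xg andTb gV //; case: ifP => // gi.
  have [Va Xa La] := aV i iN gi; have [_ Xv] := vV i iN gi.
  by rewrite Va geq_max La geq_max Xa Xv.
- move: Hops; rewrite /par_ops; set x := ops _; set y := _.+1 => Hops.
  by nia.
- exact: HQ.
Qed.

(** The word is drawn at time [t + 1], after the one step that evaluates the number of processors;
    [seed_time] accounts for it. *)
Lemma hoare_seed a s t (Q : store -> nat -> Prop) :
  a < NA -> 1 <= ext -> (Q (upd s a (upd0 (s a) (rnd (t + 1) 0))) 2) ->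
  hoare (HSeed a) s t Q.
Proof.
move=> Ha ext1 HQ M wk sp HM Hsp.
have [Va [Xa La]] := @value_address M s 0 (rnd (t + 1) 0) a (Const 0) 0 HM Ha
  (modn_small W_gt0) len_gt0 (leq0n _).
have HW := extW.
set st0 := State M t wk sp.
pose st1 := pardo w arb rnd st0 (Const 1) (Const 1) (address a (Const 0)) Rand.
have cN : ctl_value w rnd st0 (Const 1) = 1 by rewrite /ctl_value /= modn_small; lia.
have M'P x : st_mem st1 x = if x == base + a then rnd (t + 1) 0 else M x.
  have -> : st_mem st1 = pardo_mem w arb rnd (t + 1) M 1 (Const 1)
    (address a (Const 0)) Rand by rewrite /st1 /pardo cN.
  case: (pardo_memP w arb rnd (t + 1) M 1 (Const 1) (address a (Const 0)) Rand x).
    case=> -> H; case: eqP => // E.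
    case: (H 0 isT); first by rewrite /= modn_small; lia.
    by rewrite Va E; lia.
  case=> i [i1 _]; have -> : i = 0 by lia.
  by rewrite Va => E ->; rewrite ifT //; apply/eqP; lia.
have [HM1 HM2 HM3] := HM.
exists (st_mem st1), (upd s a (upd0 (s a) (rnd (t + 1) 0))),
  (1 + (ops (Const 1) + ops (address a (Const 0)) + ops Rand).+1), 2, (st_space st1).
split=> //.
- have -> : State (st_mem st1) (t + hdepth b (HSeed a)) (wk + (1 + (ops (Const 1) + ops (address a (Const 0)) + ops Rand).+1)) (st_space st1) = st1.
    by rewrite /st1 /pardo cN /hdepth mul1n addnA addnA.
  exact: exec_pardo.
- split.
  + move=> x Hx; rewrite M'P ifF ?HM1 //; apply/eqP; lia.
  + move=> a' j Ha'; rewrite M'P /upd /upd0; case: (eqVneq a' a) => [->|na].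
      by rewrite HM2 //; do 2 case: eqP => //; rewrite /NA in Ha *; nia.
    by rewrite ifF ?HM2 //; apply/eqP; rewrite /NA in Ha Ha' *; lia.
  + by move=> x; rewrite M'P; case: ifP.
- rewrite /st1 /pardo cN; cbv beta iota zeta delta [st_space ctl_charge st_depth st_mem].
  rewrite 2!geq_max Hsp leq0n geq_max ext1 !andTb /pardo_extent.
  apply/bigmax_leqP => -[i i1] _; cbn [nat_of_ord].
  have -> : i = 0 by lia.
  rewrite geq_max leq0n andTb ifT; last by rewrite /= modn_small; lia.
  by rewrite Va geq_max La geq_max Xa.
Qed.

(** Exclusive writes: [inv] recovers the processor from the address that it writes, so the new
    content is a function and the arbiter disappears. *)
Lemma hoare_parI (inv : nat -> nat) p g a e v s t (Q : store -> nat -> Prop) :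
  a < NA -> par_ops p g a e v <= op_bound ->
  safe s 0 p -> den s 0 p <= len ->
  (forall i, i < den s 0 p -> safe s i g /\ (den s i g != 0 ->
     [/\ safe s i e, den s i e < len, safe s i v & inv (den s i e) = i])) ->
  (forall f, (forall j, f j = if [&& inv j < den s 0 p, den s (inv j) g != 0 &
       den s (inv j) e == j] then den s (inv j) v else s a j) ->
     Q (upd s a f) (den s 0 p).+1) ->
  hoare (HPar p g a e v) s t Q.
Proof.
move=> Ha Hops Hp HN Hs HQ; apply: hoare_par => //.
- by have := ext_ge; rewrite /NA; lia.
- by move=> i iN; have [? H] := Hs i iN; split=> // /H[].
move=> f Hf; apply: HQ => j.
case: (Hf j) => [[E H]|[i [iN gi ei ->]]].
  case: ifP => // /and3P[H1 H2 /eqP H3]; by case: (H _ H1 H2).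
have [_ /(_ gi)[_ _ _ Hi]] := Hs i iN; rewrite ei in Hi.
by rewrite Hi iN gi ei eqxx.
Qed.

Lemma hoare_map p g a v s t (Q : store -> nat -> Prop) :
  a < NA -> par_ops p g a HP v <= op_bound ->
  safe s 0 p -> den s 0 p <= len ->
  (forall i, i < den s 0 p -> safe s i g /\ (den s i g != 0 -> safe s i v)) ->
  (forall f, (forall j, f j = if (j < den s 0 p) && (den s j g != 0)
       then den s j v else s a j) -> Q (upd s a f) (den s 0 p).+1) ->
  hoare (HPar p g a HP v) s t Q.
Proof.
move=> Ha Hops Hp HN Hs HQ; apply: (@hoare_parI id) => //.
  move=> i iN; have [? H] := Hs i iN; split=> // /H ?; split=> //=; lia.
move=> f Hf; apply: HQ => j; rewrite Hf /=.
by rewrite eqxx andbT.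
Qed.

Lemma hoare_set a v s t (Q : store -> nat -> Prop) :
  a < NA -> par_ops (HC 1) (HC 1) a (HC 0) v <= op_bound -> safe s 0 v ->
  Q (upd s a (upd0 (s a) (den s 0 v))) 2 ->
  hoare (HSet a v) s t Q.
Proof.
have := c_len_ge mc; have := c_lenW mc => HW Hl Ha Hops Hs HQ.
apply: (@hoare_parI (fun=> 0)) => //=.
- by nia.
- move=> i i1; have -> : i = 0 by lia.
  by split; [nia | split=> //; nia].
move=> f Hf; congr (Q (upd s a _) _): HQ; apply/funext => j; rewrite /upd0 Hf.
by rewrite eq_sym.
Qed.

(** Units of work: 2 to reset the counter, 3 per iteration for the guard and the increment, 1 for
    the last guard. The body has to preserve the counter and register 0, so that the number of
    iterations, and with it the running time, depends on b only. *)
Lemma hoare_for (I : nat -> store -> nat -> Prop) cst r c s t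
    (Q : store -> nat -> Prop) :
  r < NA -> r != 0 ->
  par_ops (HC 1) (HC 1) r (HC 0) (HB OAdd ($ r) (HC 1)) <= op_bound ->
  ops (compile (for_guard cst r)) <= op_bound ->
  cst < W -> cst * b + 1 < W -> s 0 0 = b ->
  I 0 (upd s r (upd0 (s r) 0)) 2 ->
  (forall i s1 t1 u1, i < cst * b -> s1 r 0 = i -> s1 0 0 = b -> I i s1 u1 ->
     hoare c s1 t1 (fun s2 u2 => [/\ s2 r 0 = i, s2 0 0 = b &
       I i.+1 (upd s2 r (upd0 (s2 r) i.+1)) (u1 + u2 + 3)])) ->
  (forall s' u, s' r 0 = cst * b -> s' 0 0 = b -> I (cst * b) s' u -> Q s' u.+1) ->
  hoare (HFor cst r c) s t Q.
Proof.
move=> Ha r0 Hops Hg Hc HcW Hb I0 IS IQ M wk sp HM Hsp.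
have lenW := c_lenW mc; have lenge := c_len_ge mc.
have Hops0 : par_ops (HC 1) (HC 1) r (HC 0) (HC 0) <= op_bound.
  by apply: leq_trans Hops; rewrite /par_ops !leq_add2l ltnS leq_add2l.
have [M1 [s1 [k1 [u1 [sp1 [X1 R1 S1 K1 H1]]]]]] :
  exists M' s' k u sp', [/\
    exec w arb rnd (set_cmd r (HC 0)) (State M t wk sp)
      (State M' (t + par_ops (HC 1) (HC 1) r (HC 0) (HC 0)) (wk + k) sp'),
    represents M' s', sp' <= ext, k <= op_bound * u &
    s' = upd s r (upd0 (s r) 0) /\ u = 2].
  by apply: (@hoare_set r (HC 0) s t (fun s' u => s' = upd s r (upd0 (s r) 0) /\ u = 2) Ha Hops0 _ _ M wk sp) => //; exact: W_gt0.
case: H1 => s1E u1E; subst u1; rewrite -s1E in I0.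
have s1b : s1 0 0 = b by rewrite s1E /upd eq_sym (negbTE r0).
have s1r : s1 r 0 = 0 by rewrite s1E /upd eqxx /upd0.
set G := compile (for_guard cst r) in Hg *.
set gd := ops G in Hg *.
pose bd := hdepth b c + par_ops (HC 1) (HC 1) r (HC 0) (HB OAdd ($ r) (HC 1)).
have guardP M2 s2 t2 wk2 sp2 i : represents M2 s2 -> s2 0 0 = b -> s2 r 0 = i ->
    i <= cst * b -> sp2 <= ext ->
    let st := State M2 t2 wk2 sp2 in
    ctl_value w rnd st G = (i < cst * b) :> nat /\
    exists sp3, sp3 <= ext /\
      ctl_charge w rnd st G = State M2 (t2 + gd) (wk2 + gd) sp3.
  move=> HM2 b2 r2 Hi Hsp2 st.
  have Sg : safe s2 0 (for_guard cst r) by rewrite /= b2; repeat split=> //; lia.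
  have [V X _] := compileP (rnd t2 0) HM2 W_gt0 Sg.
  split; first by rewrite /ctl_value V /for_guard /= r2 b2.
  by eexists; split; last by []; rewrite geq_max Hsp2 X.
have loop :
  forall j i M2 s2 t2 wk2 sp2 u2, i + j = cst * b -> represents M2 s2 ->
   s2 0 0 = b -> s2 r 0 = i -> sp2 <= ext -> I i s2 u2 ->
   exists M' s' k u sp', [/\
    exec w arb rnd (While G (Seq (compile_cmd c) (set_cmd r (HB OAdd ($ r) (HC 1)))))
      (State M2 t2 wk2 sp2)
      (State M' (t2 + (j * (gd + bd) + gd)) (wk2 + k) sp'),
    represents M' s', sp' <= ext, k <= op_bound * u & Q s' (u2 + u)].
  elim=> [|j IH] i M2 s2 t2 wk2 sp2 u2 Eij R2 b2 r2 S2 I2.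
    have [V [sp3 [S3 E3]]] := guardP M2 s2 t2 wk2 sp2 i R2 b2 r2 ltac:(lia) S2.
    exists M2, s2, gd, 1, sp3; split; [| exact: R2 | exact: S3 | by rewrite muln1 |]; last first.
    + by rewrite addn1; apply: IQ => //; [lia | have <- : i = cst * b by lia].
    rewrite mul0n add0n -E3; apply: exec_while_end.
    by rewrite V; case: (ltnP i (cst * b)) => //; lia.
  have [V [sp3 [S3 E3]]] := guardP M2 s2 t2 wk2 sp2 i R2 b2 r2 ltac:(lia) S2.
  have iL : i < cst * b by lia.
  have := IS i s2 (t2 + gd) u2 iL r2 b2 I2 => /(_ M2 (wk2 + gd) sp3 R2 S3).
  case=> [M4 [s4 [k4 [u4 [sp4 [X4 R4 S4 K4 [r4 b4 I4]]]]]]].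
  have [M5 [s5 [k5 [u5 [sp5 [X5 R5 S5 K5 [E5 Eu5]]]]]]] :
    exists M' s' k u sp', [/\
      exec w arb rnd (set_cmd r (HB OAdd ($ r) (HC 1)))
        (State M4 (t2 + gd + hdepth b c) (wk2 + gd + k4) sp4)
        (State M' (t2 + gd + hdepth b c + par_ops (HC 1) (HC 1) r (HC 0) (HB OAdd ($ r) (HC 1)))
           (wk2 + gd + k4 + k) sp'),
      represents M' s', sp' <= ext, k <= op_bound * u &
      s' = upd s4 r (upd0 (s4 r) i.+1) /\ u = 2].
    apply: (@hoare_set r (HB OAdd ($ r) (HC 1)) s4 (t2 + gd + hdepth b c)
      (fun s' u => s' = upd s4 r (upd0 (s4 r) i.+1) /\ u = 2) Ha Hops _ _ M4
      (wk2 + gd + k4) sp4) => //=.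
      rewrite r4; split; [split=> //; lia | nia | lia].
    by rewrite r4 addn1.
  subst u5; rewrite -E5 in I4.
  have b5 : s5 0 0 = b by rewrite E5 /upd eq_sym (negbTE r0).
  have r5 : s5 r 0 = i.+1 by rewrite E5 /upd eqxx /upd0.
  have [M6 [s6 [k6 [u6 [sp6 [X6 R6 S6 K6 Q6]]]]]] := IH i.+1 M5 s5 (t2 + gd + bd)
    (wk2 + gd + k4 + k5) sp5 (u2 + u4 + 3) ltac:(lia) R5 b5 r5 S5 I4.
  exists M6, s6, (gd + k4 + k5 + k6), (u4 + 3 + u6), sp6.
  split; [| exact: R6 | exact: S6 | |]; last 2 first.
  - by move: K4 K5 K6 Hg; rewrite !mulnDr; lia.
  - by rewrite !addnA in Q6 *.
  apply: (@exec_while_loop _ _ _ _ _ _ (State M5 (t2 + gd + bd) (wk2 + gd + k4 + k5) sp5)).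
  - by rewrite V iL.
  - rewrite E3; apply: (exec_seq X4); rewrite /bd addnA; exact: X5.
  - have -> : t2 + (j.+1 * (gd + bd) + gd) = t2 + gd + bd + (j * (gd + bd) + gd) by lia.
    have -> : wk2 + (gd + k4 + k5 + k6) = wk2 + gd + k4 + k5 + k6 by lia.
    exact: X6.
have [M2 [s2 [k2 [u2 [sp2 [X2 R2 S2 K2 H2]]]]]] := loop (cst * b) 0 M1 s1
  (t + par_ops (HC 1) (HC 1) r (HC 0) (HC 0)) (wk + k1) sp1 2 (add0n _) R1 s1b s1r S1 I0.
exists M2, s2, (k1 + k2), (2 + u2), sp2; split=> //; last by nia.
apply: (exec_seq X1).
move: X2; rewrite -(addnA wk) -(addnA t).
have -> : par_ops (HC 1) (HC 1) r (HC 0) (HC 0) + (cst * b * (gd + bd) + gd) =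
  hdepth b (HFor cst r c) by rewrite addnA.
exact.
Qed.

End Machine.

(* Notations, frames and parallel prefix sums *)
Declare Scope hexpr_scope.
Delimit Scope hexpr_scope with H.
Bind Scope hexpr_scope with hexpr.
Notation "# k" := (HC k) (at level 2, k at level 1, format "# k") : hexpr_scope.
Notation "a @[ e ]" := (HA a e%H) (at level 2, format "a @[ e ]") : hexpr_scope.
Notation "x + y" := (HB OAdd x y) : hexpr_scope.
Notation "x - y" := (HB OSub x y) : hexpr_scope.
Notation "x * y" := (HB OMul x y) : hexpr_scope.
Notation "x %/ y" := (HB ODiv x y) : hexpr_scope.
Notation "x %% y" := (HB OMod x y) : hexpr_scope.
Notation "x < y" := (HB OLt x y) : hexpr_scope.
Notation "x == y" := (HB OEq x y) : hexpr_scope.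
Notation "x != y" := (HB OEq (HB OEq x y) (HC 0)) : hexpr_scope.
Notation "x <= y" := (HB OEq (HB OLt y x) (HC 0)) : hexpr_scope.
Notation "x && y" := (HIf x y (HC 0)) : hexpr_scope.

Lemma nat_of_bool_neq0 (c : bool) : ((c : nat) != 0) = c. Proof. by case: c. Qed.
Lemma nat_of_bool_eq0 (c : bool) : ((c : nat) == 0) = ~~ c. Proof. by case: c. Qed.
Lemma if_neq0 (c : bool) x : ((if c then x else 0) != 0) = c && (x != 0).
Proof. by case: c. Qed.
Lemma if_eq0 (c : bool) x : ((if c then x else 0) == 0) = ~~ c || (x == 0).
Proof. by case: c. Qed.

Definition guardE := (nat_of_bool_neq0, nat_of_bool_eq0, if_neq0, if_eq0, negbK).

Definition frame (L : seq nat) (s s' : store) := forall a, a \notin L -> s' a = s a.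

Lemma frame_trans L1 L2 L s1 s2 s3 :
  {subset L1 <= L} -> {subset L2 <= L} ->
  frame L1 s1 s2 -> frame L2 s2 s3 -> frame L s1 s3.
Proof.
move=> S1 S2 F1 F2 a Ha; rewrite F2; last by apply: contraNN Ha; apply: S2.
by rewrite F1 //; apply: contraNN Ha; apply: S1.
Qed.

Lemma frame_transb L1 L2 L s1 s2 s3 :
  all [in L] L1 -> all [in L] L2 ->
  frame L1 s1 s2 -> frame L2 s2 s3 -> frame L s1 s3.
Proof. by move=> /allP S1 /allP S2; apply: frame_trans. Qed.

Lemma frame_upd L a f s s1 : a \in L -> frame L s s1 -> frame L s (upd s1 a f).
Proof.
move=> Ha F a' Ha'; rewrite /upd; case: eqP => [E|_]; last exact: F.
by rewrite E Ha in Ha'.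
Qed.

Lemma upd_same s a f : upd s a f a = f. Proof. by rewrite /upd eqxx. Qed.

Definition ceil_div k d := (k + d - 1) %/ d.

Lemma ltn_ceil_div k d g : 0 < d -> (g < ceil_div k d) = (g * d < k).
Proof. by rewrite /ceil_div => d0; apply/idP/idP; nia. Qed.

Lemma ceil_div_le k d : 0 < d -> ceil_div k d * d <= k + d.
Proof. by rewrite /ceil_div; lia. Qed.

Lemma div_eucl_ex d j : 0 < d -> exists g u, u < d /\ j = g * d + u.
Proof. by move=> d0; exists (j %/ d), (j %% d); rewrite ltn_mod -divn_eq. Qed.

Lemma div_eucl d g u : u < d -> (g * d + u) %/ d = g.
Proof. by move=> ud; rewrite divnMDl ?divn_small ?addn0 //; lia. Qed.

Lemma mod_eucl d g u : u < d -> (g * d + u) %% d = u.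
Proof. by move=> ud; rewrite modnMDl modn_small. Qed.

Lemma modnS_eq0 d j : 0 < d -> (j.+1 %% d == 0) = (j %% d + 1 == d).
Proof.
move=> d0; have [g [v [vd ->]]] := div_eucl_ex j d0.
rewrite mod_eucl // -addnS modnMDl addn1.
by case: (ltngtP v.+1 d) => [H|H|->]; [rewrite modn_small | lia | rewrite modnn].
Qed.

Definition psum (x : nat -> nat) (n : nat) := \sum_(j < n) x j.

Lemma psum0 x : psum x 0 = 0. Proof. by rewrite /psum big_ord0. Qed.

Lemma psumS x n : psum x n.+1 = psum x n + x n.
Proof. by rewrite /psum big_ord_recr. Qed.

Lemma leq_psum x n m : n <= m -> psum x n <= psum x m.
Proof. by move=> /subnK <-; elim: (m - n) => [|d IH] //; rewrite addSn psumS; lia. Qed.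

(** Inclusive prefix sums in place. Doubling on all k entries would cost k log k, so it is applied
    only to the last entries of groups of b consecutive entries, after each group has been summed
    sequentially; the other entries then add the total of the preceding groups. Doubling runs
    [20 * b] times whatever k is, which fixes the depth. *)
Definition scan (X K : nat) : hcmd :=
  HSeq (HSet 1 (($K + $0 - #1) %/ $0)) (
  HSeq (HFor 1 2 (HPar ($1) ((#1 <= $2) && (HP * $0 + $2 < $K)) X (HP * $0 + $2)
    (X@[HP * $0 + $2] + X@[HP * $0 + $2 - #1]))) (
  HSeq (HSet 3 (#1)) (
  HSeq (HFor 20 2 (HSeq
    (HPar ($1) (($3 <= HP) && (HP * $0 + $0 - #1 < $K)) X (HP * $0 + $0 - #1)
      (X@[HP * $0 + $0 - #1] + X@[(HP - $3) * $0 + $0 - #1]))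
    (HSet 3 ($3 + $3))))
  (HPar ($K) (($0 <= HP) && (HP %% $0 + #1 != $0)) X HP
    (X@[HP] + X@[HP %/ $0 * $0 - #1])))))%H.

Section Scan.
Variable mc : config.
Local Notation b := (c_b mc).
Local Notation len := (c_len mc).
Local Notation W := (2 ^ c_w mc).

Lemma hoare_scan X K s t k x :
  3 < X < NA -> 3 < K < NA -> K != X ->
  s 0 0 = b -> s K 0 = k -> s X = x -> k + b <= len -> psum x k < W ->
  hoare mc (scan X K) s t (fun s' u => [/\ frame [:: 1; 2; 3; X] s s',
    forall i, s' X i = if i < k then psum x i.+1 else x i &
    u <= 200 * (k + b)]).
Proof.
move=> /andP[X3 XN] /andP[K3 KN] KX sb sK sX kl HW.
have b0 := c_b_gt0 mc; have lenW := c_lenW mc; have lenge := c_len_ge mc.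
have blen := c_b_len mc; have lpow := c_len_pow mc; have powW := c_powW mc.
have lW : len * 4 < W by nia.
clear lenW.
set q := ceil_div k b.
have qb : q * b <= k + b by apply: ceil_div_le.
have gq g : g < q -> g * b < k by rewrite ltn_ceil_div.
have [X0 X1 X2 X3'] : [/\ (0 == X) = false, (1 == X) = false, (2 == X) = false & (3 == X) = false].
  by split; apply/eqP; lia.
have KX' : (K == X) = false by apply/negbTE.
have [K0 K1 K2 K3'] : [/\ (K == 0) = false, (K == 1) = false, (K == 2) = false & (K == 3) = false].
  by split; apply/eqP; lia.
have [X0' X1' X2' X3''] : [/\ (X == 0) = false, (X == 1) = false, (X == 2) = false & (X == 3) = false].
  by split; apply/eqP; lia.
have KL : K \notin [:: 1; 2; 3; X] by rewrite !inE KX' K1 K2 K3'.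
have zL : 0 \notin [:: 1; 2; 3; X] by rewrite !inE X0.
pose L := [:: 1; 2; 3; X].
apply: hoare_seq; apply: hoare_set => //.
  by rewrite /= sK sb; repeat split; lia.
rewrite /= sK sb -/(ceil_div k b) -/q.
set s1 := upd _ _ _.
have F1 : frame L s s1 by apply: frame_upd.
apply: hoare_seq.
pose I1 i (s' : store) u := [/\ frame L s s', s' 1 0 = q,
  forall j, s' X j = if (j < k) && (j %% b < i) then psum x j.+1 - psum x (j %/ b * b) else x j &
  u <= 2 + i * (q + 4)].
apply: (@hoare_for mc I1) => //=; try lia.
- split=> //=.
  + by apply: frame_upd.
  + by move=> j; rewrite ltn0 andbF /s1 /upd /= X2' X1' sX.
- move=> i s2 t2 u2; rewrite mul1n => ib s2r s2b [F2 s2q s2X Hu].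
  have s2K : s2 K 0 = k by rewrite F2.
  apply: (@hoare_parI _ (fun j => j %/ b)) => //=.
  + by repeat split; lia.
  + by rewrite s2q; clear -qb b0 kl; nia.
  + move=> g; rewrite s2q s2r s2b s2K => /gq gk.
    rewrite !guardE -leqNgt; split.
      by repeat split; lia.
    move=> /andP[i1 gi]; split; first by repeat split; lia.
    * by lia.
    * repeat split; try lia.
      rewrite !s2X.
      have Hm : (g * b + i) %% b = i by rewrite modnMDl modn_small.
      rewrite Hm ltnn andbF.
      have A : psum x (g * b + i).+1 <= psum x k by apply: leq_psum; lia.
      rewrite psumS in A.
      have B : psum x (g * b + i - 1).+1 <= psum x (g * b + i) by apply: leq_psum; lia.
      apply: leq_ltn_trans HW; apply: leq_trans A; rewrite addnC leq_add2r.
      case: ifP => _; first exact: leq_trans (leq_subr _ _) B.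
      by rewrite psumS in B; exact: leq_trans (leq_addl _ _) B.
    * by rewrite divnMDl // divn_small // addn0.
  move=> f Hf; split=> //=.
  + by rewrite /upd X2.
  + by rewrite /upd X0.
  + split=> /=.
    * by do 2 apply: frame_upd => //; rewrite !inE eqxx ?orbT.
    * by rewrite /upd /= X1.
    * move=> j; rewrite /upd X2' eqxx /= Hf s2q s2r s2b s2K !guardE -leqNgt.
      have [g [v [vb ->]]] := div_eucl_ex j b0.
      rewrite div_eucl // mod_eucl // (s2X (g * b + v)) div_eucl // mod_eucl // ltnS.
      case: ifP => [/and3P[Hq /andP[i1 H1] /eqP E]|N].
        have E' : v = i by lia.
        rewrite E' H1 leqnn (s2X (g * b + i)) mod_eucl // ltnn andbF /= s2X.
        have -> : g * b + i - 1 = g * b + (i - 1) by lia.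
        rewrite div_eucl ?mod_eucl ?ifT; try lia.
        have -> : (g * b + (i - 1)).+1 = g * b + i by lia.
        rewrite psumS; have : psum x (g * b) <= psum x (g * b + i) by apply: leq_psum; lia.
        by lia.
      case: ltnP => //= jk.
      case: (ltngtP v i) => // mi.
      have i0 : i = 0 by move: N; rewrite ltn_ceil_div //; lia.
      by rewrite mi i0 addn0 psumS addKn.
    * by rewrite s2q; lia.
move=> s2 u2; rewrite mul1n => s2r s2b [F2 s2q s2X Hu2].
have s2X' j : j < k -> s2 X j = psum x j.+1 - psum x (j %/ b * b).
  by move=> jk; rewrite s2X jk ltn_mod b0.
have s2X'' j : k <= j -> s2 X j = x j by move=> jk; rewrite s2X ltnNge jk.
have s2K : s2 K 0 = k by rewrite F2.
apply: hoare_seq; apply: hoare_set => //=; first by lia.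
apply: hoare_seq.
have pow_gt0 m : 0 < 2 ^ m by rewrite expn_gt0.
(* The last entry of a complete group sums the [2 ^ i] groups ending there; the truncated
   subtraction lets the window start at 0 when there are fewer. *)
pose I2 i (s' : store) u := [/\ frame L s s', s' 1 0 = q, s' 3 0 = 2 ^ i,
  forall j, s' X j = if (j < k) && (j.+1 %% b == 0) then psum x j.+1 - psum x ((j %/ b).+1 * b - 2 ^ i * b) else s2 X j &
  u <= 2 + i * (q + 6)].
apply: (@hoare_for mc I2) => //=; try lia.
- split=> //=.
  + by do 2 apply: frame_upd => //.
  + move=> j; rewrite /upd /= X2' X3''; case: ifP => // /andP[jk _].
    by rewrite s2X' // expn0 mul1n mulSn addKn.
- move=> i s3 t3 u3 ib s3r s3b [F3 s3q s3d s3X Hu].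
  have s3K : s3 K 0 = k by rewrite F3.
  have i2 : 2 ^ i <= 2 ^ (20 * b) by rewrite leq_exp2l //; lia.
  apply: hoare_seq; apply: (@hoare_parI _ (fun j => j %/ b)) => //=.
  + by repeat split; lia.
  + by rewrite s3q; clear -qb b0 kl; nia.
  + move=> g; rewrite s3q s3d s3b s3K => /gq gk.
    rewrite !guardE -leqNgt; split.
      by repeat split; try lia.
    move=> /andP[dg gi].
    have dgb : (g - 2 ^ i) * b <= g * b by rewrite leq_mul2r leq_subr orbT.
    split; first by repeat split; lia.
    * by lia.
    * repeat split; try lia.
      rewrite !s3X.
      have H1 : (g * b + b - 1).+1 %% b = 0.
        have -> : (g * b + b - 1).+1 = g.+1 * b by clear -b0; lia.
        by rewrite modnMl.
      have H2 : ((g - 2 ^ i) * b + b - 1).+1 %% b = 0.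
        have -> : ((g - 2 ^ i) * b + b - 1).+1 = (g - 2 ^ i).+1 * b by clear -b0; move: (g - 2 ^ i) => d; lia.
        by rewrite modnMl.
      have D1 : (g * b + b - 1) %/ b = g by rewrite -addnBA // div_eucl //; clear -b0; lia.
      have D2 : ((g - 2 ^ i) * b + b - 1) %/ b = g - 2 ^ i by rewrite -addnBA // div_eucl //; clear -b0; lia.
      rewrite H1 H2 gi D1 D2 eqxx [X in X + _]/= ifT; last by rewrite andbT; clear -gi dgb; lia.
      have -> : (g * b + b - 1).+1 = g.+1 * b by clear -b0; lia.
      have -> : ((g - 2 ^ i) * b + b - 1).+1 = g.+1 * b - 2 ^ i * b by rewrite -mulnBl subSn //; clear -b0; move: (g - 2 ^ i) => d; lia.
      have P1 : psum x (g.+1 * b) <= psum x k by apply: leq_psum; clear -gi b0; lia.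
      have P2 : psum x (g.+1 * b - 2 ^ i * b) <= psum x (g.+1 * b) by apply/leq_psum/leq_subr.
      apply: leq_ltn_trans HW; apply: leq_trans P1.
      by apply: leq_trans (leq_add (leqnn _) (leq_subr _ _)) _; rewrite subnK.
    * by rewrite -addnBA // div_eucl //; clear -b0; lia.
  move=> f Hf; apply: hoare_set => //=.
    by rewrite /upd X3' s3d; repeat split=> //; lia.
  split=> //=.
  + by rewrite /upd /= X2.
  + by rewrite /upd /= X0.
  + split=> //=.
    * by do 3 (apply: frame_upd => //; rewrite ?inE ?eqxx ?orbT //).
    * by rewrite /upd /= X1.
    * by rewrite /upd /upd0 /= X3' s3d expnS; clear; lia.
    * move=> j; rewrite /upd X2' X3'' eqxx /= Hf s3q s3d s3b s3K !guardE -leqNgt.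
      have [g [v [vb ->]]] := div_eucl_ex j b0.
      rewrite div_eucl //.
      have HE m : m < b -> ((g * b + m).+1 %% b == 0) = (m.+1 == b).
        by move=> mb; rewrite modnS_eq0 // mod_eucl // addn1.
      rewrite (s3X (g * b + v)) div_eucl // HE //.
      case: ifP => [/and3P[Hq /andP[i1 H1] /eqP E]|N].
        have Ev : v = b - 1 by lia.
        have gE : (g - 2 ^ i) * b + b - 1 = (g - 2 ^ i) * b + (b - 1) by clear -b0; move: (g - 2 ^ i) => d; lia.
        have HE' : ((g - 2 ^ i) * b + (b - 1)).+1 = (g - 2 ^ i).+1 * b by clear -b0; move: (g - 2 ^ i) => d; lia.
        have dgb : (g - 2 ^ i) * b <= g * b by rewrite leq_mul2r leq_subr orbT.
        rewrite E (s3X (g * b + v)) HE // div_eucl // gE s3X HE' modnMl eqxx div_eucl; last by lia.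
        have -> : (v.+1 == b) by lia.
        rewrite !ifT; try lia.
        have -> : (g - 2 ^ i).+1 * b = g.+1 * b - 2 ^ i * b by rewrite -mulnBl; congr (_ * _); lia.
        have -> : (g.+1 * b - 2 ^ i * b) - 2 ^ i * b = g.+1 * b - 2 ^ i.+1 * b.
          by rewrite expnS -!mulnBl; congr (_ * _); lia.
        have -> : (g * b + v).+1 = g.+1 * b by lia.
        have P1 : psum x (g.+1 * b - 2 ^ i * b) <= psum x (g.+1 * b) by apply: leq_psum; lia.
        have P2 : psum x (g.+1 * b - 2 ^ i.+1 * b) <= psum x (g.+1 * b - 2 ^ i * b).
          by apply: leq_psum; rewrite expnS -!mulnBl leq_mul2r; lia.
        by rewrite addnBA // subnK.
      case: ifP => // /andP[jk /eqP H].
      have gi : g < 2 ^ i.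
        move: N; rewrite ltn_ceil_div //; nia.
      by congr (_ - psum x _); rewrite expnS -!mulnBl; congr (_ * _); lia.
    * by rewrite s3q; lia.
move=> s3 u3 s3r s3b [F3 s3q s3d s3X Hu3].
have s3K : s3 K 0 = k by rewrite F3.
(* After [20 * b] doublings the window covers all groups, since their number is at most [len]. *)
have q20 : q <= 2 ^ (20 * b) by nia.
have s3e j : j < k -> j.+1 %% b == 0 -> s3 X j = psum x j.+1.
  move=> jk H; rewrite s3X jk H.
  have -> : (j %/ b).+1 * b - 2 ^ (20 * b) * b = 0.
    apply/eqP; rewrite subn_eq0 leq_mul2r; apply/orP; right.
    by apply: leq_trans q20; rewrite ltn_ceil_div //; have := divn_eq j b; lia.
  by rewrite psum0 subn0.
have s3n j : j < k -> j.+1 %% b != 0 -> s3 X j = psum x j.+1 - psum x (j %/ b * b).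
  by move=> jk H; rewrite s3X (negbTE H) andbF s2X'.
have lastP j : (j %% b + 1 == b) = (j.+1 %% b == 0) by rewrite modnS_eq0.
have fin j : j < k -> b <= j -> j.+1 %% b != 0 ->
    s3 X j + s3 X (j %/ b * b - 1) = psum x j.+1.
  move=> jk bj H.
  have j1 : 1 <= j %/ b by rewrite divn_gt0.
  have E := divn_eq j b.
  have Ej : (j %/ b * b - 1).+1 = j %/ b * b by nia.
  rewrite s3n // s3e ?Ej ?modnMl //; last by lia.
  by rewrite subnK //; apply: leq_psum; lia.
apply: hoare_map => //=.
- by repeat split; lia.
- by lia.
- move=> i; rewrite s3K s3b => ik; rewrite !guardE -leqNgt.
  have := divn_eq i b; have Hm : i %% b < b by rewrite ltn_mod.
  move=> Ei; split; first by repeat split; lia.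
  rewrite lastP => /andP[bi Hi].
  repeat split; try lia.
  rewrite fin //; apply: leq_ltn_trans HW; exact: leq_psum.
move=> f Hf; split.
- by apply: frame_upd => //; rewrite !inE eqxx !orbT.
- move=> i; rewrite upd_same Hf s3K s3b !guardE -leqNgt lastP.
  case: (ltnP i k) => [ik|ik]; last first.
    by rewrite s3X ltnNge ik s2X''.
  rewrite /=; case: ifP => [/andP[bi Hi]|]; first exact: fin.
  case: (boolP (i.+1 %% b == 0)) => [H _|H]; first exact: s3e.
  rewrite andbT => /negbT; rewrite -ltnNge => ib.
  by rewrite s3n // divn_small // mul0n psum0 subn0.
- by rewrite s3K; nia.
Qed.

End Scan.

(** The inclusive prefix sum of the flags at a selected index exceeds its place in the output by
    one. *)
Definition compaction (K : nat) (flag val : hexpr) (OUT CNT : nat) : hcmd :=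
  HSeq (HPar ($K) (#1) 6 HP flag) (
  HSeq (scan 6 K) (
  HSeq (HPar ($K) flag OUT (6@[HP] - #1) val)
  (HSet CNT (HIf ($K == #0) (#0) (6@[$K - #1])))))%H.

Section Compact.
Variables (phi : nat -> bool) (nu : nat -> nat).

Definition selected k := [seq nu i | i <- iota 0 k & phi i].

Lemma psum_count (n : nat) : psum (fun i => phi i) n = count phi (iota 0 n).
Proof.
elim: n => [|n IH]; first by rewrite psum0.
by rewrite psumS IH -addn1 iotaD count_cat /= addn0.
Qed.

Lemma size_selected k : size (selected k) = count phi (iota 0 k).
Proof. by rewrite size_map size_filter. Qed.

Lemma count_iota_lt i k : i < k -> phi i -> count phi (iota 0 i) < count phi (iota 0 k).
Proof.
move=> ik pi; have -> : k = i + (1 + (k - i - 1)) by lia.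
by rewrite !iotaD !count_cat /= pi; lia.
Qed.

Lemma nth_filter_iota (g : nat -> nat) i k : i < k -> phi i ->
  nth 0 [seq g i | i <- iota 0 k & phi i] (count phi (iota 0 i)) = g i.
Proof.
move=> ik pi; have -> : k = i + (1 + (k - i - 1)) by lia.
by rewrite !iotaD !filter_cat map_cat nth_cat size_map size_filter ltnn subnn /= pi.
Qed.

Lemma selected_pos k j : j < count phi (iota 0 k) ->
  exists i, [/\ i < k, phi i & count phi (iota 0 i) = j].
Proof.
move=> jk; set l := [seq i <- iota 0 k | phi i].
have sl : size l = count phi (iota 0 k) by rewrite size_filter.
have : nth 0 l j \in l by rewrite mem_nth // sl.
set i := nth 0 l j; rewrite mem_filter mem_iota => /andP[pi /= ik].
exists i; split=> //; apply/eqP; rewrite add0n in ik.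
have ul : uniq l by rewrite filter_uniq // iota_uniq.
rewrite -(@nth_uniq _ 0 l) //; last 2 first.
- by rewrite sl count_iota_lt.
- by rewrite sl.
by have := nth_filter_iota id ik pi; rewrite map_id -/l => ->.
Qed.

End Compact.

(** [flag] is evaluated before and after the scan, so the hypotheses range over all stores that
    differ from [s] in the scratch arrays only. [OUT] may be an array that [val] reads, and [CNT]
    may be [K]: all reads of a parallel step precede its writes. *)
Lemma hoare_compaction (mc : config) phi nu K flag val OUT CNT s t k :
  6 < OUT < NA -> 6 < K < NA -> 6 < CNT < NA -> OUT != K -> OUT != CNT ->
  par_ops ($K) (#1)%H 6 HP flag <= op_bound ->
  par_ops ($K) flag OUT (6@[HP] - #1)%H val <= op_bound ->
  s 0 0 = c_b mc -> s K 0 = k -> k + c_b mc <= c_len mc ->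
  (forall s' i, frame [:: 1; 2; 3; 6] s s' -> i < k ->
     safe mc s' i flag /\ (den mc s' i flag != 0) = phi i /\ den mc s' i flag <= 1) ->
  (forall s' i, frame [:: 1; 2; 3; 6] s s' -> i < k -> phi i ->
     safe mc s' i val /\ den mc s' i val = nu i) ->
  hoare mc (compaction K flag val OUT CNT) s t (fun s' u =>
    [/\ frame [:: 1; 2; 3; 6; OUT; CNT] s s',
        s' CNT 0 = size (selected phi nu k),
        forall j, j < size (selected phi nu k) -> s' OUT j = nth 0 (selected phi nu k) j &
        u <= 210 * (k + c_b mc)]).
Proof.
move=> /andP[OUT6 OUTN] /andP[K6 KN] /andP[C6 CN] OK OC op1 op2 sb sK kl Hf Hv.
have b0 := c_b_gt0 mc; have lenW := c_lenW mc; have lenge := c_len_ge mc.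
have lW : c_len mc * 4 < 2 ^ c_w mc by nia.
clear lenW.
apply: hoare_seq; apply: hoare_map => //=.
- by repeat split; lia.
- by rewrite sK; lia.
- move=> i; rewrite sK => ik; have [? _] := Hf s i (fun a _ => erefl) ik.
  by split=> //; lia.
move=> z Hz; rewrite /= sK.
have zE i : i < k -> z i = phi i.
  move=> ik; rewrite Hz sK ik /=.
  have [_ []] := Hf s i (fun a _ => erefl) ik.
  by case: (phi i) => E L; lia.
have Kne a : a <= 6 -> (K == a) = false by move=> ?; apply/eqP; lia.
have Cne a : a <= 6 -> (CNT == a) = false by move=> ?; apply/eqP; lia.
have Ps n : n <= k -> psum z n = count phi (iota 0 n).
  rewrite -psum_count /psum => nk; apply: eq_bigr => i _; apply: zE.
  by apply: leq_trans nk.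
have cle n : count phi (iota 0 n) <= n by rewrite -{2}(size_iota 0 n) count_size.
apply: hoare_seq.
apply: hoare_conseq.
  apply: (@hoare_scan mc 6 K (upd s 6 z) _ k z) => //.
  - by apply/andP; split=> //; lia.
  - by apply/eqP; lia.
  - by rewrite /upd Kne.
  - by rewrite Ps //; have := cle k; lia.
move=> s2 u2 [F2 Z2 Hu2].
have F2' : frame [:: 1; 2; 3; 6] s s2.
  by apply: (frame_trans _ _ _ F2) => [a|a|]; first exact: id; [exact: id | apply: frame_upd].
have s2K : s2 K 0 = k by rewrite F2' // !inE !Kne.
have Z2' i : i < k -> s2 6 i = count phi (iota 0 i.+1).
  by move=> ik; rewrite Z2 ik Ps.
have cS i : phi i -> count phi (iota 0 i.+1) = (count phi (iota 0 i)).+1.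
  by move=> pi; rewrite -addn1 iotaD count_cat /= pi; lia.
apply: hoare_seq; apply: hoare_par => //=.
- by repeat split; lia.
- by rewrite s2K; have := c_ext_ge mc; rewrite /NA; lia.
- move=> i; rewrite s2K => ik; have [Sf [Ef _]] := Hf s2 i F2' ik.
  split=> //; rewrite Ef => pi; have [Sv _] := Hv s2 i F2' ik pi.
  have := cle i => ci.
  by rewrite Z2' // cS //; repeat split=> //; lia.
move=> f Hpar.
have fE j : j < size (selected phi nu k) -> f j = nth 0 (selected phi nu k) j.
  rewrite size_selected => jk.
  case: (Hpar j) => [[_ H]|[i []]].
    have [i [ik pi ci]] := selected_pos jk.
    case: (H i); rewrite /= ?s2K //.
      by have [_ [-> _]] := Hf s2 i F2' ik.
    by rewrite Z2' // cS // ci; lia.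
  rewrite /= s2K => ik; have [_ [-> _]] := Hf s2 i F2' ik => pi.
  rewrite Z2' // cS // subn1 /= => <- ->.
  have [_ ->] := Hv s2 i F2' ik pi.
  by rewrite nth_filter_iota.
have uK : upd s2 OUT f K 0 = k by rewrite /upd (eq_sym K) (negbTE OK).
apply: hoare_set => //=; rewrite uK; first by repeat split; lia.
have -> : upd s2 OUT f 6 = s2 6 by rewrite /upd (_ : (6 == OUT) = false) //; apply/eqP; lia.
split.
- apply: frame_upd; first by rewrite !inE eqxx !orbT.
  apply: frame_upd; first by rewrite !inE eqxx !orbT.
  move=> a; rewrite !inE !negb_or => /and5P[? ? ? ? _]; apply: F2'.
  by rewrite !inE !negb_or; apply/and4P.
- rewrite upd_same /upd0 /= size_selected.
  case: (posnP k) => [->//|k0].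
  rewrite /= Z2'; last by lia.
  by congr (count _ (iota _ _)); lia.
- by move=> j jl; rewrite /upd (negbTE OC) eqxx fE.
- by lia.
Qed.

(** * Adjacency arrays, and the arcs leaving a list of vertices *)

Record csr (mc : config) (n : nat) (off dst : nat -> nat) : Prop := Csr {
  csr_n : c_inp mc 0 = n;
  csr_off : forall v, v <= n -> c_inp mc v.+1 = off v;
  csr_dst : forall a, a < off n -> c_inp mc (n + 2 + a) = dst a;
  csr_off0 : off 0 = 0;
  csr_mono : forall u v, u <= v -> v <= n -> off u <= off v;
  csr_dst_lt : forall a, a < off n -> dst a < n;
  csr_len : 1000 * (n + off n + 1) <= c_len mc
}.

Definition odeg (off : nat -> nat) (v : nat) := off v.+1 - off v.

(** Offsets are shifted by one, because word 0 holds n. *)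
Definition hoff (e : hexpr) : hexpr := HI (e + #1)%H.
Definition hdeg (e : hexpr) : hexpr := (HI (e + #2) - HI (e + #1))%H.
Definition hdst (e : hexpr) : hexpr := HI (HI #0 + #2 + e)%H.

Lemma psum_locate d f p : p < psum d f ->
  exists i r, [/\ i < f, r < d i & p = psum d i + r].
Proof.
elim: f => [|f IH]; first by rewrite psum0.
rewrite psumS => H; case: (ltnP p (psum d f)) => [/IH[i [r [? ? ?]]]|pf].
  by exists i, r; split=> //; lia.
by exists f, (p - psum d f); split=> //; lia.
Qed.

Lemma psum_split x n m : psum x (n + m) = psum x n + \sum_(r < m) x (n + r).
Proof.
elim: m => [|m IH]; first by rewrite addn0 big_ord0 addn0.
by rewrite addnS psumS IH big_ord_recr /= addnA.
Qed.

Lemma psum_psum d x f : psum x (psum d f) = \sum_(i < f) \sum_(r < d i) x (psum d i + r).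
Proof.
elim: f => [|f IH]; first by rewrite psum0 big_ord0 psum0.
by rewrite psumS psum_split IH big_ord_recr.
Qed.

Lemma psum_bound d f i r : i < f -> r < d i -> psum d i + r < psum d f.
Proof.
move=> ik rd; apply: (@leq_trans (psum d i.+1)); first by rewrite psumS; lia.
exact: leq_psum.
Qed.

Lemma psum_inj d i j r q : r < d i -> q < d j ->
  psum d i + r = psum d j + q -> i = j /\ r = q.
Proof.
move=> ri qj E; suff ij : i = j by split=> //; rewrite ij in E; lia.
case: (ltngtP i j) => // H.
- by have := @psum_bound d j i r H ri; lia.
- by have := @psum_bound d i j q H qj; lia.
Qed.

(** The vertices are in array 31, their number in register 32. Prefix sums of the degrees place the
    arcs, a mark is set at the first arc of every vertex, and a second scan turns the marks into the
    rank of the vertex that owns each position. The work is linear in the arcs, however unequal the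
    degrees are. *)
Definition flatten_cmd : hcmd :=
  HSeq (HPar ($32) (#1) 9 HP (hdeg (31@[HP]))) (
  HSeq (scan 9 32) (
  HSeq (HSet 13 (HIf ($32 == #0) (#0) (9@[$32 - #1]))) (
  HSeq (HPar ($13) (#1) 10 HP (#0)) (
  HSeq (HPar ($32) (#1) 10 (9@[HP] - hdeg (31@[HP])) (#1)) (
  HSeq (scan 10 13) (
  HSeq (HPar ($13) (#1) 12 HP (31@[10@[HP] - #1]))
  (HPar ($13) (#1) 11 HP
     (hoff (12@[HP]) + (HP - (9@[10@[HP] - #1] - hdeg (12@[HP])))))))))))%H.

Section Flatten.
Variables (mc : config) (n : nat) (off dst : nat -> nat).
Hypothesis G : csr mc n off dst.
Local Notation b := (c_b mc).
Local Notation deg := (odeg off).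
Local Notation M := (off n).
Local Notation W := (2 ^ c_w mc).

Lemma csr_base : base mc = n + M + 2.
Proof. by rewrite /base (csr_n G) (csr_off G (leqnn _)). Qed.

Lemma csr_offS v : v <= n -> c_inp mc (v + 1) = off v.
Proof. by rewrite addn1; exact: (csr_off G). Qed.

Lemma csr_offSS v : v < n -> c_inp mc (v + 2) = off v.+1.
Proof. by move=> vn; rewrite addn2 (csr_off G). Qed.

Lemma off_le v : v <= n -> off v <= M.
Proof. by move=> vn; apply: (csr_mono G). Qed.

Lemma offS v : v < n -> off v.+1 = off v + deg v.
Proof. by move=> vn; rewrite /odeg subnKC //; apply: (csr_mono G). Qed.

Lemma csr_bounds : [/\ n + M + 1 < c_len mc, c_len mc * 4 < W & M + 4 * b + n <= c_len mc].
Proof.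
have := csr_len G; have := c_lenW mc; have := c_len_ge mc; have := c_b_len mc.
by split; nia.
Qed.

(** As degrees are positive, the marks of different vertices fall on different positions, and the
    number of vertices is at most the number k of arcs. *)
Lemma hoare_flatten s t fl f k :
  s 0 0 = b -> s 32 0 = f -> s 31 = fl ->
  (forall i, i < f -> fl i < n /\ 0 < deg (fl i)) ->
  psum (fun i => deg (fl i)) f = k -> k <= M ->
  hoare mc flatten_cmd s t (fun s' u =>
    [/\ frame [:: 1; 2; 3; 9; 10; 11; 12; 13] s s', s' 13 0 = k,
        forall i r, i < f -> r < deg (fl i) ->
          s' 12 (psum (fun i => deg (fl i)) i + r) = fl i /\
          s' 11 (psum (fun i => deg (fl i)) i + r) = off (fl i) + r &
        u <= 1000 * (k + b)]).
Proof.
move=> sb s32 s31 Hfl Ek kM.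
set d := fun i => deg (fl i) in Ek *.
have b0 := c_b_gt0 mc; have [lM lW lb] := csr_bounds; have HB := csr_base.
have xge : c_len mc <= c_ext mc by have := c_ext_ge mc; rewrite /NA; lia.
have fn i : i < f -> fl i < n by move=> /Hfl[].
have d0 i : i < f -> 0 < d i by move=> /Hfl[].
have degE i : fl i < n -> c_inp mc (fl i + 2) - c_inp mc (fl i + 1) = d i.
  by move=> H; rewrite csr_offSS // csr_offS ?(ltnW H).
have fp g : g <= f -> g <= psum d g.
  elim: g => [|g IH] gf //; rewrite psumS.
  by have := d0 g gf; have := IH (ltnW gf); lia.
have fk : f <= k by rewrite -Ek fp.
have offW v : v <= n -> off v < W by move=> /off_le; lia.
apply: hoare_seq; apply: hoare_map => //=.
- by repeat split; lia.
- by lia.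
- move=> i; rewrite s32 => i_f; have fi := fn i i_f.
  by split; [lia | move=> _; rewrite s31; repeat split; lia].
move=> y Hy; rewrite /= s32.
have yE i : i < f -> y i = d i by move=> i_f; rewrite Hy s32 i_f /= s31 degE ?fn.
have yP m : m <= f -> psum y m = psum d m.
  by move=> mf; apply: eq_bigr => i _; apply: yE; apply: leq_trans mf.
apply: hoare_seq; apply: hoare_conseq.
  apply: (@hoare_scan mc 9 32 (upd s 9 y) _ f y) => //; first by lia.
  by rewrite yP //; lia.
move=> s2 u2 [F2 Y2 Hu2].
have s2b : s2 0 0 = b by rewrite F2.
have s2_32 : s2 32 0 = f by rewrite F2.
have s2_31 : s2 31 = fl by rewrite F2.
have s2Y i : i < f -> s2 9 i = psum d i.+1 by move=> i_f; rewrite Y2 i_f yP.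
have F2' : frame [:: 1; 2; 3; 9] s s2.
  by apply: (frame_trans _ _ _ F2) => [a|a|]; first exact: id; [exact: id | apply: frame_upd].
apply: hoare_seq; apply: hoare_set => //=.
  by rewrite s2_32; repeat split=> //; lia.
rewrite s2_32.
set c := if _ then _ else _.
have cE : c = k.
  rewrite /c -Ek; case: (posnP f) => [->|f0] /=; first by rewrite psum0.
  by rewrite s2Y ?prednK; [congr psum; lia | lia].
rewrite cE.
apply: hoare_seq; apply: hoare_map => //=.
- by repeat split; lia.
- by rewrite /upd /upd0 /=; lia.
- by move=> i _; split; lia.
move=> h0 Hh0.
have h0E j : j < k -> h0 j = 0 by move=> jk; rewrite Hh0 /upd /upd0 /= jk.
apply: hoare_seq; apply: hoare_par => //=.
- by repeat split; lia.
- by rewrite /upd /= s2_32; lia.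
- rewrite /upd /= s2_32 s2_31 => i i_f; have fi := fn i i_f; split; first by lia.
  move=> _; split; last by lia.
    by repeat split; lia.
  rewrite degE // s2Y // psumS addnK.
  by have := @psum_bound d f i 0 i_f (d0 i i_f); lia.
move=> h Hh.
have startE i : i < f -> den mc (upd (upd s2 13 (upd0 (s2 13) k)) 10 h0) i
    (9@[HP] - hdeg (31@[HP]))%H = psum d i.
  by move=> i_f; rewrite /= /upd /= s2_31 degE ?fn // s2Y // psumS addnK.
have hE i r : i < f -> r < d i -> h (psum d i + r) = (r == 0).
  move=> i_f rd; case: (Hh (psum d i + r)) => [[-> H]|[j [+ _ + ->]]].
    rewrite /upd /= h0E; last by have := @psum_bound d f i r i_f rd; lia.
    case: eqP => // r0; case: (H i) => //; first by rewrite /upd /= s2_32.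
    by rewrite startE // r0 addn0.
  move=> jf; have {}jf : j < f by move: jf; rewrite /= /upd /= s2_32.
  rewrite startE // => E; have [|_ <-//] := @psum_inj d j i 0 r (d0 j jf) rd.
  by rewrite addn0.
(* Before the r-th arc of vertex i lie the marks of the preceding vertices, and its own as soon as
   [0 < r]. *)
have hP i r : i < f -> r <= d i -> psum h (psum d i + r) = i + (0 < r).
  elim: i r => [|i IH] r.
    rewrite psum0 => f0; elim: r => [|r IHr]; first by rewrite psum0.
    move=> rd; have := hE 0 r f0 rd; have := IHr (ltnW rd).
    by rewrite psum0 !add0n psumS => -> ->; case: r {IHr rd}.
  move=> i_f; elim: r => [|r IHr].
    by move=> _; rewrite addn0 psumS IH ?leqnn ?(ltnW i_f) // d0 ?(ltnW i_f) //=; lia.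
  move=> rd; rewrite addnS psumS hE // IHr; last by lia.
  by case: r rd {IHr} => //=; lia.
have hk : psum h k <= f.
  rewrite -Ek; case: (posnP f) => [->|f0]; first by rewrite !psum0.
  have f1 : f = f.-1.+1 by lia.
  by rewrite {1}f1 psumS hP //; lia.
apply: hoare_seq; apply: hoare_conseq.
  apply: (@hoare_scan mc 10 13 _ _ k h) => //.
  - by lia.
  - by lia.
move=> s3 u3 [F3 H3 Hu3].
have s3b : s3 0 0 = b by rewrite F3.
have s3_13 : s3 13 0 = k by rewrite F3.
have s3_32 : s3 32 0 = f by rewrite F3.
have s3_31 : s3 31 = fl by rewrite F3.
have s3Y i : i < f -> s3 9 i = psum d i.+1 by move=> i_f; rewrite F3 // -s2Y.
have s3H i r : i < f -> r < d i -> s3 10 (psum d i + r) = i.+1.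
  move=> i_f rd; rewrite H3 -Ek psum_bound // -addnS hP //; lia.
apply: hoare_seq; apply: hoare_map => //=.
- by repeat split; lia.
- by lia.
- rewrite s3_13 -Ek => p /psum_locate[i [r [i_f rd ->]]].
  have B1 := @psum_bound d f i r i_f rd; rewrite Ek in B1.
  by rewrite s3H //; repeat split; lia.
move=> o Ho.
have oE i r : i < f -> r < d i -> o (psum d i + r) = fl i.
  move=> i_f rd; rewrite Ho /= s3_13 -{1}Ek psum_bound //= s3H //.
  by rewrite s3_31 subn1.
apply: hoare_map => //=.
- by repeat split; lia.
- by rewrite /upd /=; lia.
- rewrite /upd /= s3_13 -Ek => p /psum_locate[i [r [i_f rd ->]]].
  have fi := fn i i_f; have := offS fi; have := off_le (ltnW fi).
  have B1 := @psum_bound d f i r i_f rd; rewrite Ek in B1.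
  have := off_le fi; rewrite -/(deg (fl i)) => o1 o2 o3.
  rewrite oE // s3H // subn1 /= s3Y // degE // csr_offS ?(ltnW fi) //.
  rewrite psumS addnK addKn; rewrite /d in rd.
  by repeat split; lia.
move=> ar Har; split.
- move=> a; rewrite !inE !negb_or => /and5P[a1 a2 a3 a9 /and4P[a10 a11 a12 a13]].
  rewrite /upd (negbTE a11) (negbTE a12) F3; last by rewrite !inE !negb_or a1 a2 a3 a10.
  rewrite /upd (negbTE a10) (negbTE a13) F2' // !inE !negb_or a1 a2 a3 a9 //.
- by rewrite /upd /=.
- move=> i r i_f rd; split; first by rewrite /upd /= oE.
  rewrite upd_same Har /upd /= s3_13 -{1}Ek psum_bound //= oE // s3H // subn1 /= s3Y //.
  have fi := fn i i_f.
  by rewrite degE // csr_offS ?(ltnW fi) // psumS addnK addKn.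
- by rewrite /upd /upd0 /= s3_13 ?s2_32; clear -Hu2 Hu3 fk b0; lia.
Qed.

End Flatten.

(** * Counting sort and the merging of neighbouring positions *)

Lemma psum_ext x y k : (forall i, i < k -> x i = y i) -> psum x k = psum y k.
Proof. by move=> H; apply: eq_bigr => i _; apply: H. Qed.

Lemma psumD x y k : psum (fun i => x i + y i) k = psum x k + psum y k.
Proof. exact: big_split. Qed.

Lemma psum_const0 x k : (forall i, i < k -> x i = 0) -> psum x k = 0.
Proof. by move=> H; apply: big1 => i _; apply: H. Qed.

Lemma psum_single x i0 k : (forall i, i < k -> i != i0 -> x i = 0) ->
  psum x k = if i0 < k then x i0 else 0.
Proof.
move=> H; case: ltnP => ik.
  rewrite /psum (bigD1 (Ordinal ik)) //= big1 ?addn0 // => i ni.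
  by apply: H => //; apply: contraNneq ni => E; apply/eqP/val_inj.
by apply: psum_const0 => i i_k; apply: H => //; apply/eqP; lia.
Qed.

Lemma leq_psum_fun x y k : (forall i, i < k -> x i <= y i) -> psum x k <= psum y k.
Proof. by move=> H; apply: leq_sum => i _; apply: H. Qed.

Lemma psum_bool_lt (c : nat -> bool) k i : i < k -> c i -> psum (fun j => c j) i < psum (fun j => c j) k.
Proof.
move=> ik ci; apply: (@leq_trans (psum (fun j => c j) i.+1)); first by rewrite psumS ci addn1.
exact: leq_psum.
Qed.

Lemma psum_bool_le (c : nat -> bool) k : psum (fun j => c j) k <= k.
Proof. by rewrite psum_count -{2}(size_iota 0 k) count_size. Qed.

(* Counting sort without atomic counters: the processor group [i %/ b] handles
   its [b] items one after another, and [cell] orders the items by class first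
   and by group second. *)
Section Cells.
Variables (k b q : nat) (key : nat -> nat).
Hypotheses (b0 : 0 < b) (qE : q = ceil_div k b).

Definition cell i := key i * q + i %/ b.
Definition cell_lt y := psum (fun i => cell i < y) k.
Definition cell_eq y := psum (fun i => cell i == y) k.
Definition cell_rank i := psum (fun j => cell j == cell i) i.
(** A cell is filled from its end backwards, as the inclusive scan of the cell counters yields the
    end. *)
Definition cell_pos i := cell_lt (cell i).+1 - 1 - cell_rank i.
Definition class_lt c := psum (fun i => key i < c) k.

Lemma group_lt i : i < k -> i %/ b < q.
Proof. by move=> ik; rewrite qE ltn_ceil_div //; have := leq_trunc_div i b; lia. Qed.

Lemma cell_ltS y : cell_lt y.+1 = cell_lt y + cell_eq y.
Proof.
rewrite /cell_lt /cell_eq -psumD; apply: psum_ext => i _.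
by rewrite ltnS leq_eqVlt; case: (ltngtP (cell i) y).
Qed.

Lemma cell_lt_le y z : y <= z -> cell_lt y <= cell_lt z.
Proof. by move=> yz; apply: leq_psum_fun => i _; case: ltnP => // H; rewrite (leq_trans H yz). Qed.

Lemma cell_lt_psum y : psum cell_eq y = cell_lt y.
Proof.
elim: y => [|y IH]; first by rewrite psum0 [RHS]psum_const0 // => i _; rewrite ltn0.
by rewrite psumS IH cell_ltS.
Qed.

(** Cells are numbered class by class, [q] of them for each class, because a group index is less
    than [q]. *)
Lemma class_ltE c : cell_lt (c * q) = class_lt c.
Proof.
apply: psum_ext => i ik; congr nat_of_bool; have := group_lt ik.
rewrite /cell => H; apply/idP/idP => [|K].
  rewrite !ltnNge; apply: contra => K.
  exact: leq_trans (leq_mul K (leqnn q)) (leq_addr _ _).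
by apply: leq_trans (leq_mul K (leqnn q)); rewrite mulSn addnC ltn_add2r.
Qed.

Lemma class_lt_le c d : c <= d -> class_lt c <= class_lt d.
Proof. by move=> yz; apply: leq_psum_fun => i _; case: ltnP => // H; rewrite (leq_trans H yz). Qed.

Lemma cell_rank_lt i : i < k -> cell_rank i < cell_eq (cell i).
Proof. by move=> ik; apply: (psum_bool_lt (c := fun j => cell j == cell i)). Qed.

Lemma cell_pos_bounds i : i < k ->
  cell_lt (cell i) <= cell_pos i < cell_lt (cell i).+1.
Proof. by move=> /cell_rank_lt; rewrite /cell_pos cell_ltS; lia. Qed.

Lemma cell_pos_class i : i < k ->
  class_lt (key i) <= cell_pos i < class_lt (key i).+1.
Proof.
move=> ik; have /andP[H1 H2] := cell_pos_bounds ik; have H := group_lt ik.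
rewrite -!class_ltE; apply/andP; split.
  by apply: leq_trans H1; apply: cell_lt_le; rewrite leq_addr.
by apply: leq_trans H2 _; apply: cell_lt_le; rewrite /cell mulSn addnC ltn_add2r.
Qed.

Lemma cell_pos_lt i : i < k -> cell_pos i < k.
Proof.
by move=> /cell_pos_class/andP[_ H]; apply: leq_trans H (psum_bool_le _ _).
Qed.

(** Different cells occupy disjoint intervals of positions, and within a cell the rank strictly
    increases with the item. *)
Lemma cell_pos_inj i j : i < k -> j < k -> cell_pos i = cell_pos j -> i = j.
Proof.
move=> ik jk E; have ci := cell_pos_bounds ik; have cj := cell_pos_bounds jk.
have Ec : cell i = cell j.
  case: (ltngtP (cell i) (cell j)) => // H; have := cell_lt_le H; lia.
have := cell_rank_lt ik; have := cell_rank_lt jk; move: E.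
rewrite /cell_pos Ec cell_ltS => E H1 H2.
have {}E : cell_rank i = cell_rank j by lia.
case: (ltngtP i j) => // H.
- have := @psum_bool_lt (fun l => cell l == cell j) j i H; rewrite Ec eqxx => /(_ isT).
  by move: E; rewrite /cell_rank Ec; lia.
- have := @psum_bool_lt (fun l => cell l == cell i) i j H; rewrite Ec eqxx => /(_ isT).
  by move: E; rewrite /cell_rank Ec; lia.
Qed.

Lemma cell_pos_surj p : p < k -> exists2 i, i < k & cell_pos i = p.
Proof.
move=> pk; pose h (i : 'I_k) : 'I_k := Ordinal (cell_pos_lt (ltn_ord i)).
have hi : injective h.
  by move=> i j /(congr1 val) /= /cell_pos_inj E; apply/val_inj/E.
have /codomP[i /(congr1 val) /= E] := injF_onto hi (Ordinal pk).
by exists (val i); [exact: ltn_ord | rewrite E].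
Qed.

End Cells.

(** Counter [c * q + g] counts the items of class c in group g. In step r of the loop each group
    handles its r-th item; groups own disjoint sets of counters, so increments never conflict, and
    the value read before the increment is the rank of the item in its cell. There are [b * q]
    counters, at most k + b, so their scan stays linear. *)
Definition class_sort_cmd : hcmd :=
  let item := (HP * $0 + $40)%H in
  let hcell i := (27@[i] %% $0 * $39)%H in
  HSeq (HSet 39 (($29 + $0 - #1) %/ $0)) (
  HSeq (HSet 41 ($0 * $39)) (
  HSeq (HPar ($41) (#1) 33 HP (#0)) (
  HSeq (HFor 1 40 (
    HSeq (HPar ($39) (item < $29) 34 item (33@[hcell item + HP]))
         (HPar ($39) (item < $29) 33 (hcell item + HP) (34@[item] + #1)))) (
  HSeq (scan 33 41)
  (HPar ($29) (#1) 35 (33@[hcell HP + HP %/ $0] - #1 - 34@[HP]) HP)))))%H.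

Section ClassSort.
Variables (mc : config) (n : nat) (off dst : nat -> nat).
Hypothesis G : csr mc n off dst.
Local Notation b := (c_b mc).
Local Notation M := (off n).
Local Notation W := (2 ^ c_w mc).
Variables (ij : nat -> nat) (k : nat).
Hypothesis kM : k <= M.
Let q := ceil_div k b.
Let key i := ij i %% b.

Lemma hoare_class_sort s t :
  s 0 0 = b -> s 29 0 = k -> s 27 = ij -> (forall i, i < k -> ij i < M) ->
  hoare mc class_sort_cmd s t (fun s' u =>
    [/\ frame [:: 1; 2; 3; 33; 34; 35; 39; 40; 41] s s', s' 39 0 = q,
        forall c, c <= b -> 0 < c * q -> s' 33 (c * q - 1) = class_lt k key c,
        forall i, i < k -> s' 35 (cell_pos k b q key i) = i &
        u <= 1000 * (k + b)]).
Proof.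
move=> sb sk sj ijM.
have b0 := c_b_gt0 mc; have [lM lW lb] := csr_bounds G; have HB := csr_base G.
have xge : c_len mc <= c_ext mc by have := c_ext_ge mc; rewrite /NA; lia.
have qb : b * q <= k + b by rewrite mulnC; apply: ceil_div_le.
have q_le : q <= k + b by apply: leq_trans qb; rewrite leq_pmull.
have key_b i : key i < b by rewrite ltn_mod.
have cellE i : cell b q key i = ij i %% b * q + i %/ b by [].
have cell_b i : i < k -> cell b q key i < b * q.
  move=> ik; rewrite cellE; have := @group_lt k b q b0 erefl i ik; have := key_b i.
  rewrite /key => H1 H2; have := leq_mul H1 (leqnn q); lia.
have gq g : g < q -> g * b < k by rewrite ltn_ceil_div.
pose L := [:: 1; 2; 3; 33; 34; 35; 39; 40; 41].
apply: hoare_seq; apply: hoare_set => //=; first by rewrite sk sb; repeat split; lia.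
rewrite sk sb -/(ceil_div k b) -/q.
set sa := upd s 39 _.
have Fa : frame L s sa by apply: frame_upd.
have saq : sa 39 0 = q by [].
have sab : sa 0 0 = b by rewrite Fa.
clearbody sa.
apply: hoare_seq; apply: hoare_set => //=.
  by rewrite sab saq; repeat split; lia.
rewrite sab saq; set sc := upd sa 41 _.
have Fc : frame L s sc by apply: frame_upd.
have scq : sc 39 0 = q by [].
have sct : sc 41 0 = b * q by [].
clearbody sc.
apply: hoare_seq; apply: hoare_map => //=; rewrite ?sct.
- by repeat split; lia.
- by lia.
- by move=> i _; split; lia.
move=> c0 Hc0.
set s0 := upd _ 33 c0.
have F0 : frame L s s0 by apply: frame_upd.
have c0E y : y < b * q -> c0 y = 0 by move=> yq; rewrite Hc0 yq.
have s0q : s0 39 0 = q by [].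
have s0t : s0 41 0 = b * q by [].
have s0c : s0 33 = c0 by [].
clearbody s0.
apply: hoare_seq.
pose I r (s' : store) u := [/\ frame [:: 1; 2; 3; 33; 34; 35; 39; 40; 41] s s',
  s' 39 0 = q, s' 41 0 = b * q /\
  (forall y, y < b * q -> s' 33 y = psum (fun i => (cell b q key i == y) && (i %% b < r)) k),
  forall i, i < k -> i %% b < r -> s' 34 i = cell_rank b q key i &
  u <= 2 + r * (2 * q + 5)].
apply: (@hoare_for mc I) => //=; try lia.
- by rewrite F0.
- split=> //=; first by apply: frame_upd.
  split=> // y yq; rewrite /upd /= s0c c0E // [RHS]psum_const0 // => i _.
  by rewrite ltn0 andbF.
- move=> r s1 t1 u1; rewrite mul1n => rb s1r s1b [F1 s1q [s1t s1C] s1R Hu1].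
  have s1j : s1 27 = ij by rewrite F1.
  have s1k : s1 29 0 = k by rewrite F1.
  have cE g : ij (g * b + r) %% b * q + g = cell b q key (g * b + r).
    by rewrite cellE div_eucl.
  apply: hoare_seq; apply: (@hoare_parI _ (fun i => i %/ b)) => //=.
  + by repeat split; lia.
  + by lia.
  + move=> g; rewrite s1q s1r s1b s1k s1j => /gq gk; rewrite !guardE.
    split; first by repeat split; lia.
    move=> ik; have := cell_b _ ik; rewrite -cE => cb.
    by rewrite div_eucl //; repeat split; lia.
  rewrite s1q s1r s1b s1k s1j => rk Hrk.
  have rkE g : g * b + r < k -> rk (g * b + r) = cell_rank b q key (g * b + r).
    move=> ik; rewrite Hrk div_eucl // ltn_ceil_div // ik eqxx !guardE andbT ifT; last by lia.
    rewrite cE s1C ?cell_b // /cell_rank.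
    set i := g * b + r in ik *.
    have -> : k = i + (k - i) by lia.
    (* Items of the same cell lie in the same group, where those of smaller offset are exactly the
       earlier ones; so the items from i on do not contribute. *)
    rewrite psum_split [X in _ + X]big1 ?addn0; last first.
      move=> /= j _; apply/eqP; rewrite eqb0 negb_and -leqNgt.
      case: eqP => //= E; have [g' [v [vb Ej]]] := div_eucl_ex (i + j) b0.
      move: E; rewrite !cellE Ej mod_eucl // /i !div_eucl //.
      have gq' : g' < q.
        rewrite ltn_ceil_div //; have := ltn_ord j; rewrite -/i; lia.
      have gq1 : g < q by rewrite ltn_ceil_div //; lia.
      move=> E; have {}E : g' = g by have := congr1 (fun x => x %% q) E; rewrite !mod_eucl.
      by move: Ej; rewrite E /i; lia.
    apply: psum_ext => j ji; congr nat_of_bool; apply: andb_idr => /eqP.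
    have [g' [v [vb Ej]]] := div_eucl_ex j b0.
    rewrite Ej !cellE mod_eucl // /i !div_eucl //.
    have gq' : g' < q by rewrite ltn_ceil_div //; lia.
    have gq1 : g < q by rewrite ltn_ceil_div //; lia.
    move=> E; have {}E : g' = g by have := congr1 (fun x => x %% q) E; rewrite !mod_eucl.
    by move: ji; rewrite /i Ej E; lia.
  have rkN i : i %% b != r -> rk i = s1 34 i.
    move=> ni; rewrite Hrk; case: ifP => // /and3P[_ _ /eqP E].
    by move: ni; rewrite -E mod_eucl // eqxx.
  have cell_mod g : g * b + r < k -> (cell b q key (g * b + r)) %% q = g.
    by move=> ik; rewrite cellE div_eucl // mod_eucl // ltn_ceil_div //; lia.
  (* The group that owns a counter is the index of the counter modulo [q]. *)
  apply: (@hoare_parI _ (fun y => y %% q)) => //=.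
  + by rewrite /upd /=; repeat split; lia.
  + by rewrite /upd /=; lia.
  + rewrite /upd /= => g; rewrite s1q s1r s1b s1k s1j => /gq gk; rewrite !guardE.
    split; first by repeat split; lia.
    move=> ik; have cb := cell_b _ ik; rewrite cE cell_mod // rkE //.
    have := @psum_bool_le (fun j => cell b q key j == cell b q key (g * b + r)) (g * b + r).
    by rewrite -/(cell_rank _ _ _ _) -cE in cb * => ?; repeat split; lia.
  move=> cc Hcc; split=> //=.
  split=> //=.
  + by do 3 apply: frame_upd => //.
  + split; first by rewrite /upd /=.
    move=> y yq; rewrite {1}/upd [LHS]/= {1}/upd [LHS]/= Hcc /upd /= s1q s1r s1b s1k s1j !guardE cE.
    set g := y %% q; have q0 : 0 < q by case: (q) yq => //; rewrite muln0.
    have gq' : g < q by rewrite ltn_mod.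
    have E1 : psum (fun i => (cell b q key i == y) && (i %% b < r.+1)) k =
       psum (fun i => (cell b q key i == y) && (i %% b < r)) k +
       psum (fun i => (cell b q key i == y) && (i %% b == r)) k.
      rewrite -psumD; apply: psum_ext => i _; rewrite ltnS leq_eqVlt.
      by case: (_ == y) => //=; case: ltngtP.
    rewrite E1 -s1C // (@psum_single _ (g * b + r)); last first.
      move=> i ik ni; apply/eqP; rewrite eqb0; apply/negP => /andP[/eqP Ey /eqP Er].
      case/negP: ni; apply/eqP; have [g' [v [vb Ej]]] := div_eucl_ex i b0.
      move: Er Ey; rewrite Ej mod_eucl // cellE div_eucl // => Er Ey.
      have gq2 : g' < q by rewrite ltn_ceil_div //; lia.
      by rewrite /g -Ey mod_eucl // Er.
    rewrite mod_eucl // eqxx andbT gq' /=.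
    case: ltnP => ik //=; last by rewrite addn0.
    case: eqP => [Ey|_]; last by rewrite addn0.
    rewrite rkE // -Ey s1C ?cell_b // -rkE // Hrk div_eucl // ltn_ceil_div // ik eqxx !guardE andbT ifT; last by lia.
    by rewrite cE s1C ?cell_b.
  + move=> i ik; rewrite /upd /= ltnS leq_eqVlt => /orP[/eqP Er|ri].
      have [g [v [vb Ej]]] := div_eucl_ex i b0.
      by move: Er ik; rewrite Ej mod_eucl // => -> ik; rewrite rkE.
    by rewrite rkN ?s1R //; lia.
  + by rewrite /upd /= s1q; lia.
move=> s1 u1; rewrite mul1n => s1r s1b [F1 s1q [s1t s1C] s1R Hu1].
have s1j : s1 27 = ij by rewrite F1.
have s1k : s1 29 0 = k by rewrite F1.
have s1C' y : y < b * q -> s1 33 y = cell_eq k b q key y.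
  by move=> yq; rewrite s1C //; apply: psum_ext => i _; rewrite ltn_mod b0 andbT.
have s1P y : y <= b * q -> psum (s1 33) y = cell_lt k b q key y.
  by move=> yq; rewrite -cell_lt_psum; apply: psum_ext => i iy; apply: s1C'; lia.
have cltk y : cell_lt k b q key y <= k by apply: psum_bool_le.
apply: hoare_seq; apply: hoare_conseq.
  apply: (@hoare_scan mc 33 41 s1 _ (b * q) (s1 33)) => //; first by lia.
  by rewrite s1P //; have := cltk (b * q); lia.
move=> s2 u2 [F2 s2C Hu2].
have s2j : s2 27 = ij by rewrite F2.
have s2k : s2 29 0 = k by rewrite F2.
have s2q : s2 39 0 = q by rewrite F2.
have s2b : s2 0 0 = b by rewrite F2.
have s2R : s2 34 = s1 34 by rewrite F2.
have s2C' y : y < b * q -> s2 33 y = cell_lt k b q key y.+1.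
  by move=> yq; rewrite s2C yq s1P.
have posE i : i < k -> s2 33 (ij i %% b * q + i %/ b) - 1 - s1 34 i = cell_pos k b q key i.
  by move=> ik; rewrite -cellE s2C' ?cell_b // s1R ?ltn_mod.
apply: hoare_par => //=.
- by repeat split; lia.
- by lia.
- move=> i; rewrite s2k s2j s2q s2b s2R => ik; split; first by lia.
  move=> _; rewrite posE //; have := cell_b _ ik; rewrite cellE.
  have := @cell_pos_lt k b q key b0 erefl i ik => H1 H2.
  move: (ij i %% b * q) (i %/ b) H2 => X Y H2.
  by clear -H1 H2 ik kM lM lW lb qb b0; repeat split; lia.
move=> o Ho; split.
- apply: frame_upd => //; apply: frame_trans F1 F2 => // a.
  by rewrite !inE => /or4P[] /eqP ->.
- by [].
- move=> c cb cq0; rewrite /upd /= s2C'; last by have := leq_mul cb (leqnn q); lia.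
  by rewrite -(@class_ltE k b q key b0 erefl); congr cell_lt; lia.
- move=> i ik; rewrite /upd /=.
  case: (Ho (cell_pos k b q key i)) => [[_ H]|[j [/= jk _ + ->]]].
    by case: (H i); rewrite /= ?s2k // s2j s2q s2b s2R posE.
  rewrite s2k in jk; rewrite s2j s2q s2b s2R posE // => E.
  exact: (@cell_pos_inj k b q key b0 erefl).
- by rewrite /= s2k; lia.
Qed.

End ClassSort.

(** An item is a triple in arrays 26, 27, 28: a vertex v, a position j in its adjacency list (in
    later passes a block of positions) and the number of decrements that it carries.
    [off v + j %/ b] names the group that it joins; the name stays in the range of arcs of v, so
    different vertices or blocks have different names. *)
Definition hgroup (i : hexpr) : hexpr := (hoff (26@[i]) + 27@[i] %/ $0)%H.

(** A class begins where the preceding one ends, and the scanned counter of the last cell of a class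
    gives its end. The defaults cover class 0 and an empty list of items. *)
Definition class_lo : hexpr := HIf ($40 * $39 == #0) (#0) (33@[$40 * $39 - #1])%H.
Definition class_hi : hexpr :=
  HIf ($39 == #0) (#0) (33@[($40 + #1) * $39 - #1])%H.

(* Items of the same class lie in distinct groups, so each step of the loop
   writes exclusively. *)
Definition sum_groups_cmd : hcmd :=
  let item := (35@[class_lo + HP])%H in
  HSeq (HPar ($29) (#1) 36 (hgroup HP) (#0))
  (HFor 1 40 (HPar (class_hi - class_lo) (#1) 36 (hgroup item)
     (36@[hgroup item] + 28@[item])))%H.

(** Every item writes its index under the name of its group. The one that succeeds represents the
    group and takes its sum; the others are dropped. *)
Definition merge_groups_cmd : hcmd :=
  HSeq (HPar ($29) (#1) 30 (hgroup HP) HP) (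
  HSeq (compaction 29 (30@[hgroup HP] == HP) HP 37 38) (
  HSeq (HSet 29 ($38)) (
  HSeq (HPar ($29) (#1) 28 HP (36@[hgroup (37@[HP])])) (
  HSeq (HPar ($29) (#1) 27 HP (27@[37@[HP]] %/ $0))
  (HPar ($29) (#1) 26 HP (26@[37@[HP]]))))))%H.

Definition level_cmd : hcmd :=
  HSeq class_sort_cmd (HSeq sum_groups_cmd merge_groups_cmd).

Section Level.
Variables (mc : config) (n : nat) (off dst : nat -> nat).
Hypothesis G : csr mc n off dst.
Local Notation b := (c_b mc).
Local Notation M := (off n).
Local Notation W := (2 ^ c_w mc).
Local Notation deg := (odeg off).

Definition items_ok (iv ij : nat -> nat) (k : nat) :=
  (forall i, i < k -> iv i < n /\ ij i < deg (iv i)) /\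
  (forall i i', i < k -> i' < k -> iv i = iv i' -> ij i = ij i' -> i = i').

Definition items_weight (iv ij ic : nat -> nat) (k v j : nat) :=
  psum (fun i => if (iv i == v) && (ij i %/ b == j) then ic i else 0) k.

Lemma slot_inj u v i j : u < n -> v < n -> i < deg u -> j < deg v ->
  off u + i = off v + j -> u = v /\ i = j.
Proof.
move=> un vn iu jv E; suff uv : u = v by split=> //; rewrite uv in E; lia.
have := offS G un; have := offS G vn.
case: (ltngtP u v) => // H.
- by have := csr_mono G H (ltnW vn); lia.
- by have := csr_mono G H (ltnW un); lia.
Qed.

Lemma slot_lt v j : v < n -> j < deg v -> off v + j < M.
Proof. by move=> vn jv; have := off_le G vn; have := offS G vn; lia. Qed.

Variables (iv ij ic : nat -> nat) (k : nat).
Hypotheses (kM : k <= M) (Hi : items_ok iv ij k) (Hc : psum ic k <= M).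
Let q := ceil_div k b.
Let key i := ij i %% b.
Let grp i := off (iv i) + ij i %/ b.

Lemma grp_lt i : i < k -> grp i < M.
Proof.
move=> ik; have [vn jd] := proj1 Hi i ik; apply: slot_lt => //.
by apply: leq_ltn_trans jd; apply: leq_div.
Qed.

Lemma grp_inj i i' : i < k -> i' < k -> grp i = grp i' ->
  iv i = iv i' /\ ij i %/ b = ij i' %/ b.
Proof.
move=> ik ik'; have [vn jd] := proj1 Hi i ik; have [vn' jd'] := proj1 Hi i' ik'.
by apply: slot_inj => //; [apply: leq_ltn_trans jd | apply: leq_ltn_trans jd']; apply: leq_div.
Qed.

(** Quotient and remainder by b determine the position. Hence the items of one class belong to
    different groups, and adding them to the group sums causes no conflict. *)
Lemma grp_key_inj i i' : i < k -> i' < k -> grp i = grp i' -> key i = key i' -> i = i'.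
Proof.
move=> ik ik' /(grp_inj ik ik')[E1 E2] E3; apply: (proj2 Hi) => //.
by rewrite (divn_eq (ij i) b) (divn_eq (ij i') b) E2; congr (_ + _).
Qed.

(** Each step launches as many processors as its class has items, so all b steps together cost k +
    O(b). *)
Lemma hoare_sum_groups s t :
  s 0 0 = b -> s 29 0 = k -> s 26 = iv -> s 27 = ij -> s 28 = ic -> s 39 0 = q ->
  (forall c, c <= b -> 0 < c * q -> s 33 (c * q - 1) = class_lt k key c) ->
  (forall i, i < k -> s 35 (cell_pos k b q key i) = i) ->
  hoare mc sum_groups_cmd s t (fun s' u =>
    [/\ frame [:: 36; 40] s s',
        forall i, i < k -> s' 36 (grp i) = psum (fun j => if grp j == grp i then ic j else 0) k &
        u <= 20 * (k + b)]).
Proof.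
move=> sb sk sv sj sc sq sC sO.
have b0 := c_b_gt0 mc; have [lM lW lb] := csr_bounds G; have HB := csr_base G.
have xge : c_len mc <= c_ext mc by have := c_ext_ge mc; rewrite /NA; lia.
have grpE i : i < k -> c_inp mc (iv i + 1) + ij i %/ b = grp i.
  by move=> ik; have [vn _] := proj1 Hi i ik; rewrite (csr_offS G (ltnW vn)).
have ivn i : i < k -> iv i < n by move=> /(proj1 Hi)[].
have key_b i : key i < b by rewrite ltn_mod.
have cltk c : class_lt k key c <= k by apply: psum_bool_le.
have q_le : q <= k + b.
  have : q * b <= k + b by apply: ceil_div_le.
  by apply: leq_trans; rewrite leq_pmulr.
have qb : b * q <= k + b by rewrite mulnC; apply: ceil_div_le.
have sumW (x : nat -> bool) : psum (fun i => if x i then ic i else 0) k <= M.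
  by apply: leq_trans Hc; apply: leq_psum_fun => i _; case: ifP.
apply: hoare_seq; apply: hoare_par => //=; rewrite ?sk ?sv ?sj ?sb.
- by repeat split; lia.
- by lia.
- move=> i ik; have vn := ivn i ik; rewrite ?sv ?sj ?sb; split; first by lia.
  move=> _; rewrite grpE //; have := grp_lt ik => gM.
  by clear -ik lM lb lW HB b0 kM gM vn; repeat split; lia.
move=> a0 Ha0; set s0 := upd s 36 a0.
have F0 : frame [:: 36; 40] s s0 by apply: frame_upd.
have a0E i : i < k -> a0 (grp i) = 0.
  move=> ik; case: (Ha0 (grp i)) => [[_ H]|[j [_ _ _ ->]]] //.
  by case: (H i) => //=; rewrite ?sk // sv sj sb grpE.
have s0a : s0 36 = a0 by [].
clearbody s0.
pose I c (s' : store) u := [/\ frame [:: 36; 40] s s',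
  forall i, i < k -> s' 36 (grp i) =
    psum (fun j => if (grp j == grp i) && (key j < c) then ic j else 0) k &
  u <= 2 + 4 * c + class_lt k key c].
apply: (@hoare_for mc I) => //=; try lia.
- by rewrite F0.
- split=> //.
  + exact: frame_upd.
  + move=> i ik; rewrite /upd /= s0a a0E // [RHS]psum_const0 // => j _.
    by rewrite ltn0 andbF.
- move=> c s1 t1 u1; rewrite mul1n => cb s1c s1b [F1 s1A Hu].
  have s1k : s1 29 0 = k by rewrite F1.
  have s1v : s1 26 = iv by rewrite F1.
  have s1j : s1 27 = ij by rewrite F1.
  have s1i : s1 28 = ic by rewrite F1.
  have s1q : s1 39 0 = q by rewrite F1.
  have s1C : s1 33 = s 33 by rewrite F1.
  have s1O : s1 35 = s 35 by rewrite F1.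
  have q0 : q = 0 -> k = 0.
    by move=> q0; apply/eqP; rewrite -leqn0 leqNgt -[k]mul1n; apply/negP => H;
       have := ltn_ceil_div k 0 b0; rewrite -/q q0; lia.
  have lo i : den mc s1 i class_lo = class_lt k key c.
    rewrite /= s1c s1q s1C !guardE; case: (posnP (c * q)) => [E|cq] /=.
      move: E => /eqP; rewrite muln_eq0 => /orP[/eqP->|/eqP/q0->]; last by rewrite /class_lt psum0.
      by rewrite /class_lt psum_const0 // => j _; rewrite ltn0.
    by rewrite sC // ltnW.
  have hi i : den mc s1 i class_hi = class_lt k key c.+1.
    rewrite /= s1c s1q s1C !guardE; case: (posnP q) => [E|cq] /=.
      by rewrite (q0 E) /class_lt psum0.
    by rewrite addn1 sC // muln_gt0.
  have slo i : safe mc s1 i class_lo.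
    have := leq_mul (ltnW cb) (leqnn q) => H.
    rewrite /= s1c s1q; move: (c * q) H => X H.
    by clear -H qb kM lb lM lW cb b0 q_le; repeat split; lia.
  have shi i : safe mc s1 i class_hi.
    have := leq_mul cb (leqnn q) => H.
    rewrite /= s1c s1q addn1; move: (c.+1 * q) H => X H.
    by clear -H qb kM lb lM lW cb b0 q_le; repeat split; lia.
  have cls := class_lt_le k key (leqnSn c).
  (* [cell_pos] is a bijection that maps the items of class c onto this interval of positions. *)
  have itemE p : p < class_lt k key c.+1 - class_lt k key c ->
    exists i, [/\ i < k, key i = c, cell_pos k b q key i = class_lt k key c + p &
      s 35 (class_lt k key c + p) = i].
    move=> pk; have := cltk c.+1 => ck.
    have [|i ik E] := @cell_pos_surj k b q key b0 erefl (class_lt k key c + p); first by lia.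
    exists i; split=> //; last by rewrite -E sO.
    have := @cell_pos_class k b q key b0 erefl i ik; rewrite E.
    case: (ltngtP (key i) c) => // H /andP[H1 H2].
    - by have := class_lt_le k key H; lia.
    - by have := class_lt_le k key H; lia.
  have denN : den mc s1 0 (class_hi - class_lo)%H = class_lt k key c.+1 - class_lt k key c.
    by change (den mc s1 0 class_hi - den mc s1 0 class_lo = class_lt k key c.+1 - class_lt k key c);
       rewrite hi lo.
  have denI p : den mc s1 p (35@[class_lo + HP])%H = s 35 (class_lt k key c + p).
    by change (s1 35 (den mc s1 p class_lo + p) = s 35 (class_lt k key c + p)); rewrite lo s1O.
  have denG p i : i < k -> s 35 (class_lt k key c + p) = i ->
      den mc s1 p (hgroup (35@[class_lo + HP])%H) = grp i.
    move=> ik E; change (c_inp mc (s1 26 (den mc s1 p (35@[class_lo + HP])%H) + 1) +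
        s1 27 (den mc s1 p (35@[class_lo + HP])%H) %/ s1 0 0 = grp i).
    by rewrite denI E s1v s1j s1b grpE.
  have denV p i : i < k -> s 35 (class_lt k key c + p) = i ->
      den mc s1 p (36@[hgroup (35@[class_lo + HP])] + 28@[35@[class_lo + HP]])%H =
      s1 36 (grp i) + ic i.
    move=> ik E; change (s1 36 (den mc s1 p (hgroup (35@[class_lo + HP])%H)) +
      s1 28 (den mc s1 p (35@[class_lo + HP])%H) = s1 36 (grp i) + ic i).
    by rewrite (denG p i) // denI E s1i.
  apply: hoare_par => //.
  + by rewrite denN; have := cltk c.+1; lia.
  + move=> p; rewrite denN => pk.
    have [i [ik Ei Ep Eo]] := itemE p pk.
    have pe : den mc s1 p (35@[class_lo + HP])%H = i by rewrite denI Eo.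
    have ps : safe mc s1 p (35@[class_lo + HP])%H.
      have -> : safe mc s1 p (35@[class_lo + HP])%H =
        [/\ [/\ safe mc s1 p class_lo, True & den mc s1 p class_lo + p < W],
            den mc s1 p class_lo + p < c_len mc & 35 < NA] by [].
      rewrite lo; have := cltk c.+1 => ck; split=> //; [split=> //|]; lia.
    split; first by rewrite /=; lia.
    move=> _; have vn := ivn i ik; have gM := grp_lt ik.
    have Hg := denG p i ik Eo.
    have Sg : safe mc s1 p (hgroup (35@[class_lo + HP])%H).
      have H35 : safe mc s1 p (hgroup (35@[class_lo + HP])%H) =
       [/\ [/\ [/\ safe mc s1 p (35@[class_lo + HP])%H,
             den mc s1 p (35@[class_lo + HP])%H < c_len mc & 26 < NA],
             1 < W & s1 26 (den mc s1 p (35@[class_lo + HP])%H) + 1 < W] /\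
           s1 26 (den mc s1 p (35@[class_lo + HP])%H) + 1 < base mc,
         [/\ [/\ safe mc s1 p (35@[class_lo + HP])%H,
             den mc s1 p (35@[class_lo + HP])%H < c_len mc & 27 < NA],
             [/\ 0 < W, 0 < c_len mc & 0 < NA] & True] &
         den mc s1 p (hoff (26@[35@[class_lo + HP]])%H) +
         den mc s1 p (27@[35@[class_lo + HP]] %/ $0)%H < W] by [].
      rewrite H35 pe.
      have -> : den mc s1 p (hoff (26@[35@[class_lo + HP]])%H) +
         den mc s1 p (27@[35@[class_lo + HP]] %/ $0)%H = grp i by rewrite -Hg.
      by rewrite s1v; clear -ps vn ik kM lM lW lb HB gM; repeat split=> //; lia.
    split=> //; first by rewrite Hg; lia.
    have -> : safe mc s1 p (36@[hgroup (35@[class_lo + HP])] + 28@[35@[class_lo + HP]])%H =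
      [/\ [/\ safe mc s1 p (hgroup (35@[class_lo + HP])%H),
              den mc s1 p (hgroup (35@[class_lo + HP])%H) < c_len mc & 36 < NA],
          [/\ safe mc s1 p (35@[class_lo + HP])%H,
              den mc s1 p (35@[class_lo + HP])%H < c_len mc & 28 < NA] &
          s1 36 (den mc s1 p (hgroup (35@[class_lo + HP])%H)) +
          s1 28 (den mc s1 p (35@[class_lo + HP])%H) < W] by [].
    rewrite Hg pe s1A // s1i.
    have H1 := sumW (fun j => (grp j == grp i) && (key j < c)).
    have H2 : ic i <= psum ic k.
      apply: (@leq_trans (psum ic i.+1)); last exact: leq_psum.
      by rewrite psumS leq_addl.
    set X := psum _ k in H1 *.
    by clear -ps Sg H1 H2 Hc lM lW lb ik kM gM; repeat split=> //; lia.
  move=> f Hf; split=> //.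
  split; first by do 2 apply: frame_upd => //.
    move=> i ik; rewrite {1}/upd [LHS]/= {1}/upd [LHS]/=.
    have -> : psum (fun j => if (grp j == grp i) && (key j < c.+1) then ic j else 0) k =
      psum (fun j => if (grp j == grp i) && (key j < c) then ic j else 0) k +
      psum (fun j => if (grp j == grp i) && (key j == c) then ic j else 0) k.
      rewrite -psumD; apply: psum_ext => j _; rewrite ltnS leq_eqVlt.
      by case: (_ == grp i) => //=; case: ltngtP => //=; rewrite addn0.
    rewrite -s1A //; case: (Hf (grp i)) => [[-> H]|[p [pk _]]].
      rewrite [X in _ = _ + X]psum_const0 ?addn0 // => j jk.
      case: andP => // -[/eqP Eg /eqP Ek].
      have /andP[p1 p2] := @cell_pos_class k b q key b0 erefl j jk; rewrite Ek in p1 p2.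
      case: (H (cell_pos k b q key j - class_lt k key c)) => //.
        by rewrite denN; lia.
      by rewrite (denG _ j) // subnKC // sO.
    rewrite denN in pk; have [i1 [ik1 Ei1 Ep1 Eo1]] := itemE p pk.
    rewrite (denG p i1) // (denV p i1) // => Eg ->.
    rewrite Eg; congr (_ + _).
    rewrite (@psum_single _ i1) ?ik1 ?Eg ?Ei1 ?eqxx // => j jk nj.
    case: andP => // -[/eqP Ej /eqP Kj]; case/negP: nj; apply/eqP.
    by apply: grp_key_inj => //; rewrite ?Ej ?Eg // Kj Ei1.
  rewrite denN.
  by clear -Hu cls; lia.
move=> s1 u1; rewrite mul1n => _ _ [F1 s1A Hu]; split=> //.
- move=> i ik; rewrite s1A //; apply: psum_ext => j _.
  by rewrite ltn_mod b0 andbT.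
- by have := cltk b; rewrite /= ?sk; lia.
Qed.

End Level.

Section Merge.
Variables (mc : config) (n : nat) (off dst : nat -> nat).
Hypothesis G : csr mc n off dst.
Local Notation b := (c_b mc).
Local Notation M := (off n).
Local Notation W := (2 ^ c_w mc).
Local Notation deg := (odeg off).

(** A relation rather than a function, because the order of the surviving items depends on the
    arbiter. *)
Definition merged (iv ij ic : nat -> nat) (k : nat) (iv' ij' ic' : nat -> nat) (k' : nat) :=
  [/\ k' <= k,
      forall i, i < k' -> exists2 j, j < k & iv' i = iv j /\ ij' i = ij j %/ b,
      forall j, j < k -> exists2 i, i < k' & iv' i = iv j /\ ij' i = ij j %/ b,
      forall i i', i < k' -> i' < k' -> iv' i = iv' i' -> ij' i = ij' i' -> i = i' &
      forall i, i < k' -> ic' i = items_weight mc iv ij ic k (iv' i) (ij' i)].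

Variables (iv ij ic : nat -> nat) (k : nat).
Hypotheses (kM : k <= M) (Hi : items_ok n off iv ij k) (Hc : psum ic k <= M).
Let grp i := off (iv i) + ij i %/ b.

Lemma hoare_merge_groups s t :
  s 0 0 = b -> s 29 0 = k -> s 26 = iv -> s 27 = ij ->
  (forall i, i < k -> s 36 (grp i) = psum (fun j => if grp j == grp i then ic j else 0) k) ->
  hoare mc merge_groups_cmd s t (fun s' u =>
    [/\ frame [:: 1; 2; 3; 6; 26; 27; 28; 29; 30; 37; 38] s s',
        merged iv ij ic k (s' 26) (s' 27) (s' 28) (s' 29 0) &
        u <= 500 * (k + b)]).
Proof.
move=> sb sk sv sj sA.
have b0 := c_b_gt0 mc; have [lM lW lb] := csr_bounds G; have HB := csr_base G.
have xge : c_len mc <= c_ext mc by have := c_ext_ge mc; rewrite /NA; lia.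
have grpE i : i < k -> c_inp mc (iv i + 1) + ij i %/ b = grp i.
  by move=> ik; have [vn _] := proj1 Hi i ik; rewrite (csr_offS G (ltnW vn)).
have ivn i : i < k -> iv i < n by move=> /(proj1 Hi)[].
have gM i : i < k -> grp i < M by move=> ik; apply: (grp_lt G Hi).
have sgrp (s' : store) i j : s' 0 0 = b -> s' 26 = iv -> s' 27 = ij ->
    safe mc s' i j -> den mc s' i j < k -> safe mc s' i (hgroup j).
  move=> b' v' j' Sj jk; have vn := ivn _ jk; have gM' := gM _ jk.
  rewrite /= v' j' b' grpE //; clear -Sj jk vn gM' kM lM lW lb b0 HB.
  by repeat split=> //; lia.
apply: hoare_seq; apply: hoare_par => //=; rewrite ?sk ?sv ?sj ?sb.
- by repeat split; lia.
- by lia.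
- move=> i ik; split; first by lia.
  move=> _; split=> //; last by rewrite grpE //; have := gM i ik; lia.
  by have := sgrp s i HP sb sv sj Logic.I ik; rewrite /= sv sj sb.
move=> wn Hw; set s1 := upd s 30 wn.
have F1 : frame [:: 1; 2; 3; 6; 26; 27; 28; 29; 30; 37; 38] s s1 by apply: frame_upd.
have wP i : i < k -> wn (grp i) < k /\ grp (wn (grp i)) = grp i.
  move=> ik; case: (Hw (grp i)) => [[_ H]|[j [jk _ + ->]]].
    by case: (H i) => //=; rewrite sv sj sb grpE.
  by rewrite /= sv sj sb grpE.
have s1w : s1 30 = wn by [].
have s1b : s1 0 0 = b by [].
have s1k : s1 29 0 = k by [].
have s1v : s1 26 = iv by [].
have s1j : s1 27 = ij by [].
have s1A : s1 36 = s 36 by [].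
clearbody s1.
pose phi i := wn (grp i) == i.
apply: hoare_seq; apply: hoare_conseq.
  apply: (@hoare_compaction mc phi id 29 _ HP 37 38 s1 _ k) => //; first by lia.
  - move=> s' i F' ik.
    have b' : s' 0 0 = b by rewrite F'.
    have v' : s' 26 = iv by rewrite F'.
    have j' : s' 27 = ij by rewrite F'.
    have w' : s' 30 = wn by rewrite F'.
    have E : den mc s' i (30@[hgroup HP] == HP)%H = phi i.
      by rewrite /= b' v' j' w' grpE.
    rewrite E guardE; split; last by split=> //; case: (phi i).
    split=> //; have := gM i ik; split=> //; first by apply: sgrp.
    by rewrite /= b' v' j' grpE //; lia.
move=> s2 u2 [F2 s2n s2e Hu2].
set l := selected phi id k in s2n s2e.
have lE : l = [seq i <- iota 0 k | phi i] by rewrite /l /selected map_id.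
have ul : uniq l by rewrite lE filter_uniq // iota_uniq.
have lk : size l <= k by rewrite lE size_filter -{2}(size_iota 0 k) count_size.
pose e i := nth 0 l i.
have eP i : i < size l -> e i < k /\ phi (e i).
  by move=> il; have := mem_nth 0 il; rewrite lE mem_filter mem_iota -lE add0n => /andP[? ?].
have eS i : i < k -> phi i -> exists2 j, j < size l & e j = i.
  move=> ik Hp; have il : i \in l by rewrite lE mem_filter mem_iota Hp.
  by exists (index i l); [rewrite index_mem | apply: nth_index].
have eI i j : i < size l -> j < size l -> e i = e j -> i = j.
  by move=> il jl /eqP; rewrite nth_uniq // => /eqP.
have s2b : s2 0 0 = b by rewrite F2.
have s2v : s2 26 = iv by rewrite F2.
have s2j : s2 27 = ij by rewrite F2.
have s2A : s2 36 = s 36 by rewrite F2.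
have F2' : frame [:: 1; 2; 3; 6; 26; 27; 28; 29; 30; 37; 38] s s2.
  by apply: frame_trans F1 F2 => // a; rewrite !inE => /or4P[/eqP->//|/eqP->//|/eqP->//|/or3P[]/eqP->].
apply: hoare_seq; apply: hoare_set => //=; first by repeat split; lia.
rewrite s2n; set s3 := upd s2 29 _.
have s3b : s3 0 0 = b by [].
have s3k : s3 29 0 = size l by [].
have s3v : s3 26 = iv by [].
have s3j : s3 27 = ij by [].
have s3A : s3 36 = s 36 by [].
have s3e i : i < size l -> s3 37 i = e i by move=> il; exact: s2e.
have F3 : frame [:: 1; 2; 3; 6; 26; 27; 28; 29; 30; 37; 38] s s3 by apply: frame_upd.
clearbody s3.
apply: hoare_seq; apply: hoare_map => //=; rewrite ?s3k ?s3v ?s3j ?s3b.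
- by repeat split; lia.
- by lia.
- move=> i il; have [ek _] := eP i il; split; first by lia.
  move=> _; split=> //; last by rewrite s3e // grpE //; have := gM _ ek; lia.
  have := sgrp s3 i (37@[HP])%H s3b s3v s3j; rewrite /= s3e // s3v s3j s3b.
  by apply=> //; split=> //; lia.
move=> fc Hfc; set s4 := upd s3 28 fc.
have s4b : s4 0 0 = b by [].
have s4k : s4 29 0 = size l by [].
have s4v : s4 26 = iv by [].
have s4j : s4 27 = ij by [].
have s4e i : i < size l -> s4 37 i = e i by move=> il; exact: s3e.
have s4c : s4 28 = fc by [].
have F4 : frame [:: 1; 2; 3; 6; 26; 27; 28; 29; 30; 37; 38] s s4 by apply: frame_upd.
clearbody s4.
apply: hoare_seq; apply: hoare_map => //=; rewrite ?s4k ?s4v ?s4j ?s4b.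
- by repeat split; lia.
- by lia.
- move=> i il; have [ek _] := eP i il; split; first by lia.
  by rewrite s4e //; move=> _; repeat split; lia.
move=> fj Hfj; set s5 := upd s4 27 fj.
have s5b : s5 0 0 = b by [].
have s5k : s5 29 0 = size l by [].
have s5v : s5 26 = iv by [].
have s5e i : i < size l -> s5 37 i = e i by move=> il; exact: s4e.
have s5c : s5 28 = fc by [].
have s5j : s5 27 = fj by [].
have F5 : frame [:: 1; 2; 3; 6; 26; 27; 28; 29; 30; 37; 38] s s5 by apply: frame_upd.
clearbody s5.
apply: hoare_map => //=; rewrite ?s5k ?s5v ?s5j ?s5b.
- by repeat split; lia.
- by lia.
- move=> i il; have [ek _] := eP i il; split; first by lia.
  by rewrite s5e //; move=> _; repeat split; lia.
move=> fv Hfv; split; [by apply: frame_upd | | by rewrite /=; lia].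
rewrite /upd /= ?s5k ?s5j ?s5c.
have fvE i : i < size l -> fv i = iv (e i).
  by move=> il; rewrite Hfv ?s5k il /= s5e // ?s5v.
have fjE i : i < size l -> fj i = ij (e i) %/ b.
  by move=> il; rewrite Hfj ?s4k il /= s4e // ?s4j ?s4b.
have fcE i : i < size l -> fc i = s 36 (grp (e i)).
  move=> il; rewrite Hfc ?s3k il /= s3e // ?s3v ?s3j ?s3b ?s3A.
  by rewrite grpE //; case: (eP i il).
split=> //.
- by move=> i il; exists (e i); [case: (eP i il) | rewrite fvE // fjE].
- move=> j jk; have [wk Ew] := wP j jk.
  have [|i il Ei] := eS (wn (grp j)) wk; first by rewrite /phi Ew.
  exists i => //; rewrite fvE // fjE // Ei.
  exact: (grp_inj G Hi wk jk Ew).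
- move=> i i' il il'; rewrite !fvE // !fjE // => Ev Ej; apply: eI => //.
  have [ek /eqP p1] := eP i il; have [ek' /eqP p2] := eP i' il'.
  by rewrite -p1 -p2; congr wn; rewrite /grp Ev Ej.
- move=> i il; have [ek _] := eP i il; rewrite fcE // sA // /items_weight.
  apply: psum_ext => j jk; rewrite fvE // fjE //; congr (if _ then _ else _).
  apply/eqP/andP => [/(grp_inj G Hi jk ek)[-> ->]//|[/eqP E1 /eqP E2]].
  by rewrite /grp E1 E2.
Qed.

Lemma hoare_level s t :
  s 0 0 = b -> s 29 0 = k -> s 26 = iv -> s 27 = ij -> s 28 = ic ->
  hoare mc level_cmd s t (fun s' u =>
    [/\ frame ([:: 1; 2; 3; 6] ++ iota 26 5 ++ iota 33 9) s s',
        merged iv ij ic k (s' 26) (s' 27) (s' 28) (s' 29 0) &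
        u <= 2000 * (k + b)]).
Proof.
move=> sb sk sv sj sc.
apply: hoare_seq; apply: hoare_conseq.
  apply: (@hoare_class_sort _ _ _ _ G ij k kM s t sb sk sj) => i ik.
  have [vn jd] := proj1 Hi i ik; have := slot_lt G vn jd; lia.
move=> s1 u1 [F1 s1q s1C s1O Hu1].
apply: hoare_seq; apply: hoare_conseq.
  by apply: (hoare_sum_groups G kM Hi Hc _ _ _ _ _ _ s1q s1C s1O); rewrite F1.
move=> s2 u2 [F2 s2A Hu2].
apply: hoare_conseq.
  by apply: (hoare_merge_groups _ _ _ _ _ s2A); rewrite F2 // F1.
move=> s3 u3 [F3 H3 Hu3]; split=> //; last by lia.
move=> a Ha; rewrite F3 ?F2 ?F1 //; apply: contra Ha; rewrite !inE /=.
- by do ?(case/orP); move/eqP=> ->.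
- by do ?(case/orP); move/eqP=> ->.
- by do ?(case/orP); move/eqP=> ->.
Qed.

End Merge.

(** * Subtracting the merged decrements from the degrees *)

Definition hbig : hexpr := ($0 * $0 < hdeg (26@[HP]))%H.
Definition hbase : hexpr := (#2 * (hoff (26@[HP]) %/ ($0 * $0)))%H.

(* A vertex of degree more than [b ^ 2] keeps its blocks in an interval of
   length [ceil_div deg (b ^ 2)] starting at [2 * (off %/ b ^ 2)]: these
   intervals are disjoint and have total length [O(M / b ^ 2)], so that a scan
   of all of them is affordable in each of the [O(b ^ 2)] rounds. *)
Definition decrease_degrees_cmd : hcmd :=
  HSeq (HSet 43 (#2 * (HI (HI #0 + #1) %/ ($0 * $0)) + #3)) (
  HSeq (HPar ($43) (#1) 42 HP (#0)) (
  HSeq (HPar ($29) hbig 42 (hbase + 27@[HP] + #1) (28@[HP])) (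
  HSeq (scan 42 43) (
  HSeq (HPar ($29) (hbig == #0) 20 (26@[HP]) (20@[26@[HP]] - 28@[HP]))
  (HPar ($29) hbig 20 (26@[HP]) (20@[26@[HP]] -
     (42@[hbase + (hdeg (26@[HP]) + $0 * $0 - #1) %/ ($0 * $0)] - 42@[hbase])))))))%H.

Lemma exchange_psum (x : nat -> nat -> nat) k m :
  psum (fun y => psum (fun i => x i y) k) m = psum (fun i => psum (fun y => x i y) m) k.
Proof. exact: exchange_big. Qed.

Lemma psum_pick (c : bool) p a m :
  psum (fun y => if c && (p == y) then a else 0) m = if c && (p < m) then a else 0.
Proof.
case: c => /=; last by rewrite psum_const0.
by rewrite (@psum_single _ p) ?eqxx // => y _ /negbTE; rewrite eq_sym => ->.
Qed.

Lemma psum_subr x y k : (forall i, i < k -> y i <= x i) ->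
  psum x k - psum y k = psum (fun i => x i - y i) k.
Proof.
move=> H; rewrite -[RHS](addnK (psum y k)) -psumD; congr (_ - _).
by apply: psum_ext => i ik; rewrite subnK ?H.
Qed.

Section Decrease.
Variables (mc : config) (n : nat) (off dst : nat -> nat).
Hypothesis G : csr mc n off dst.
Local Notation b := (c_b mc).
Local Notation M := (off n).
Local Notation W := (2 ^ c_w mc).
Local Notation deg := (odeg off).
Variables (iv ij ic : nat -> nat) (k : nat) (D : nat -> nat).
Let B := b * b.
Hypotheses (kM : k <= M)
  (Hv : forall i, i < k -> iv i < n /\ ij i * B < deg (iv i))
  (Hinj : forall i i', i < k -> i' < k -> iv i = iv i' -> ij i = ij i' -> i = i')
  (Hc : psum ic k <= M).
Let base v := 2 * (off v %/ B).
Let nb v := ceil_div (deg v) B.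
(** Shifted by one, so that the inclusive prefix sums at [base v] and [base v + nb v] enclose
    exactly the blocks of v. *)
Let pos i := base (iv i) + ij i + 1.
Let big v := B < deg v.

Let B_gt0 : 0 < B. Proof. by rewrite muln_gt0 c_b_gt0. Qed.

Lemma block_lt i : i < k -> ij i < nb (iv i).
Proof. by move=> /Hv[_ H]; rewrite ltn_ceil_div. Qed.

(** Rounding up at most doubles a quotient that is at least 1; whence the factor 2 in [base] and the
    restriction to large vertices. *)
Lemma nb_le v : 0 < deg v %/ B -> nb v <= 2 * (deg v %/ B).
Proof.
move=> d1; rewrite /nb leqNgt ltn_ceil_div // -leqNgt.
apply: leq_trans (ltnW (ltn_ceil (deg v) B_gt0)) _.
by rewrite leq_mul2r; lia.
Qed.

(** Quotients by [B] are superadditive, so the disjoint ranges of arcs stay disjoint after division,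
    and doubling leaves room for the [nb u] blocks. *)
Lemma block_disjoint u v : u < v -> v < n -> big u -> base u + nb u <= base v.
Proof.
move=> uv vn bu; have := csr_mono G uv (ltnW vn).
rewrite (offS G (ltn_trans uv vn)) => H.
have H1 : off u %/ B + deg u %/ B <= off v %/ B.
  apply: leq_trans (leq_div2r B H).
  by rewrite {2}(divn_eq (off u) B) {2}(divn_eq (deg u) B) addnACA -mulnDl divnMDl // leq_addr.
have H2 : nb u <= 2 * (deg u %/ B).
  have d1 : 0 < deg u %/ B by rewrite divn_gt0 // ltnW.
  by apply: nb_le.
by rewrite /base; lia.
Qed.

Lemma block_bound v : v < n -> big v -> base v + nb v <= 2 * (M %/ B).
Proof.
move=> vn bv; have := off_le G vn; rewrite (offS G vn) => H.
have H1 : off v %/ B + deg v %/ B <= M %/ B.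
  apply: leq_trans (leq_div2r B H).
  by rewrite {2}(divn_eq (off v) B) {2}(divn_eq (deg v) B) addnACA -mulnDl divnMDl // leq_addr.
have H2 : nb v <= 2 * (deg v %/ B).
  have d1 : 0 < deg v %/ B by rewrite divn_gt0 // ltnW.
  by apply: nb_le.
by rewrite /base; lia.
Qed.

Lemma pos_in v i : v < n -> big v -> i < k -> big (iv i) ->
  (base v < pos i <= base v + nb v) = (iv i == v).
Proof.
move=> vn bv ik bi; have [in_ _] := Hv ik; have := block_lt ik; rewrite /pos.
case: (ltngtP (iv i) v) => H.
- by have := block_disjoint H vn bi; lia.
- by have := block_disjoint H in_ bv; lia.
- by rewrite H; lia.
Qed.

Lemma pos_inj i i' : i < k -> i' < k -> big (iv i) -> big (iv i') -> pos i = pos i' -> i = i'.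
Proof.
move=> ik ik' bi bi' E; have [in_ _] := Hv ik; have [in_' _] := Hv ik'.
have Ev : iv i = iv i'.
  by apply/eqP; rewrite -pos_in // E pos_in ?eqxx.
by apply: Hinj => //; move: E; rewrite /pos Ev; lia.
Qed.

Definition vertex_weight v := psum (fun i => if iv i == v then ic i else 0) k.

Lemma hoare_decrease_degrees s t :
  s 0 0 = b -> s 29 0 = k -> s 26 = iv -> s 27 = ij -> s 28 = ic -> s 20 = D ->
  hoare mc decrease_degrees_cmd s t (fun s' u =>
    [/\ frame [:: 1; 2; 3; 20; 42; 43] s s',
        forall v, v < n -> s' 20 v = D v - vertex_weight v &
        u <= 1000 * (k + M %/ B + b)]).
Proof.
move=> sb sk sv sj sc sD.
have b0 := c_b_gt0 mc; have [lM lW lb] := csr_bounds G; have HB := csr_base G.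
have xge : c_len mc <= c_ext mc by have := c_ext_ge mc; rewrite /NA; lia.
have lge := c_len_ge mc.
have MB : M %/ B <= M by apply: leq_div.
have clen := csr_len G.
have bb : b * b < W.
  have := c_lenW mc; have := c_b_len mc => H1 H2.
  apply: leq_ltn_trans (_ : c_len mc * c_len mc < W); last by lia.
  by apply: leq_mul; lia.
have nM : c_inp mc (n + 1) = M by rewrite addn1 (csr_off G (leqnn _)).
have ivn i : i < k -> iv i < n by move=> /Hv[].
pose L := [:: 1; 2; 3; 20; 42; 43].
pose NB := 2 * (M %/ B) + 3.
have offE i : i < k -> c_inp mc (iv i + 1) = off (iv i) by move=> /ivn H; apply: (csr_offS G (ltnW H)).
have degE i : i < k -> c_inp mc (iv i + 2) - c_inp mc (iv i + 1) = deg (iv i).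
  by move=> H; rewrite offE // (csr_offSS G (ivn i H)).
have off_b i : i < k -> off (iv i) <= M by move=> /ivn H; apply: (off_le G (ltnW H)).
have deg_b i : i < k -> deg (iv i) <= M.
  by move=> /ivn H; have := off_le G H; rewrite (offS G H); lia.
have div_b i : i < k -> off (iv i) %/ B <= M by move=> H; apply: leq_trans (leq_div _ _) (off_b i H).
apply: hoare_seq; apply: hoare_set => //=.
  by rewrite (csr_n G) nM sb -/B; repeat split; lia.
rewrite (csr_n G) nM sb -/B -/NB.
set s0 := upd s 43 _.
have F0 : frame L s s0 by apply: frame_upd.
have s0n : s0 43 0 = NB by [].
have s0D : s0 20 = D by [].
clearbody s0.
apply: hoare_seq; apply: hoare_map => //=; rewrite ?s0n.
- by repeat split; lia.
- by rewrite /NB; lia.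
- by move=> i _; split; lia.
move=> z Hz; set s1 := upd s0 42 z.
have F1 : frame L s s1 by apply: frame_upd.
have z0 y : y < NB -> z y = 0 by move=> yN; rewrite Hz ?s0n yN.
have s1n : s1 43 0 = NB by [].
have s1z : s1 42 = z by [].
have s1D : s1 20 = D by [].
clearbody s1.
have bigP (s' : store) i : frame L s s' -> i < k ->
    safe mc s' i hbig /\ den mc s' i hbig = big (iv i).
  move=> F' ik; have b' : s' 0 0 = b by rewrite F'.
  have v' : s' 26 = iv by rewrite F'.
  have := ivn i ik => vn.
  rewrite /= b' v' degE // -/B; split=> //.
  by clear -ik kM vn lM lW lb b0 HB bb; repeat split; lia.
have baseP (s' : store) i : frame L s s' -> i < k ->
    safe mc s' i hbase /\ den mc s' i hbase = base (iv i).
  move=> F' ik; have b' : s' 0 0 = b by rewrite F'.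
  have v' : s' 26 = iv by rewrite F'.
  have := ivn i ik => vn; have := div_b i ik.
  rewrite /= b' v' offE // -/B => H; split=> //.
  move: (off (iv i) %/ B) H => X H.
  by clear -ik kM vn lM lW lb b0 HB bb H lge; repeat split; lia.
have blk i : i < k -> big (iv i) -> pos i < NB.
  move=> ik bi; have := block_bound (ivn i ik) bi; have := block_lt ik.
  by rewrite /pos /NB; lia.
have s1k : s1 29 0 = k by rewrite F1.
have s1j : s1 27 = ij by rewrite F1.
have s1c : s1 28 = ic by rewrite F1.
apply: hoare_seq; apply: hoare_par => //.
- by rewrite /=; repeat split; lia.
- by rewrite /= s1k; lia.
- move=> i; rewrite [X in _ < X]/= s1k => ik; have [S1 E1] := bigP s1 i F1 ik; split=> //.
  rewrite E1 nat_of_bool_neq0 => bi; have [S2 E2] := baseP s1 i F1 ik.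
  have Ep : den mc s1 i (hbase + 27@[HP] + #1)%H = pos i.
    by change (den mc s1 i hbase + s1 27 i + 1 = pos i); rewrite E2 s1j.
  have := blk i ik bi => pN; split.
  + change ([/\ [/\ safe mc s1 i hbase, [/\ True, i < c_len mc & 27 < NA] &
      den mc s1 i hbase + s1 27 i < W], 1 < W & den mc s1 i hbase + s1 27 i + 1 < W]).
    rewrite E2 s1j -/(pos i); move: pN; rewrite /pos /NB => pN.
    by clear -pN S2 ik kM lM lW MB lge; repeat split=> //; lia.
  + by rewrite Ep; move: pN; rewrite /NB; lia.
  + by rewrite /=; repeat split=> //; lia.
move=> f Hf; set s2 := upd s1 42 f.
have F2 : frame L s s2 by apply: frame_upd.
have posE i : i < k -> den mc s1 i (hbase + 27@[HP] + #1)%H = pos i.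
  move=> ik; change (den mc s1 i hbase + s1 27 i + 1 = pos i).
  by have [_ ->] := baseP s1 i F1 ik; rewrite s1j.
pose bg y := psum (fun i => if big (iv i) && (pos i == y) then ic i else 0) k.
have fE y : y < NB -> f y = bg y.
  move=> yN; case: (Hf y) => [[-> H]|[i [+ + +]]].
    rewrite s1z z0 // /bg psum_const0 // => i ik; case: andP => // -[bi /eqP Ei].
    case: (H i); rewrite ?posE //; first by rewrite /= s1k.
    by have [_ ->] := bigP s1 i F1 ik; rewrite bi.
  rewrite [X in _ < X]/= s1k => ik; have [_ ->] := bigP s1 i F1 ik.
  rewrite nat_of_bool_neq0 => bi; rewrite posE // => Ey ->.
  rewrite /bg (@psum_single _ i) ?ik ?bi ?Ey ?eqxx /= ?s1c // => j jk nj.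
  case: andP => // -[bj /eqP Ej]; case/negP: nj; apply/eqP.
  by apply: pos_inj => //; rewrite Ej.
have s2n : s2 43 0 = NB by [].
have s2f : s2 42 = f by [].
have s2D : s2 20 = D by [].
have Hs1 : (den mc s1 0 ($29)).+1 = k.+1 by rewrite /= s1k.
rewrite Hs1.
clearbody s2.
have bgE m : m <= NB -> psum f m = psum (fun i => if big (iv i) && (pos i < m) then ic i else 0) k.
  move=> mN; rewrite (@psum_ext f bg); last by move=> i im; apply: fE; lia.
  by rewrite /bg exchange_psum; apply: psum_ext => i _; rewrite psum_pick.
apply: hoare_seq; apply: hoare_conseq.
  apply: (@hoare_scan mc 42 43 s2 _ NB f) => //; first by rewrite F2.
    by rewrite /NB; lia.
  rewrite bgE //; apply: (@leq_ltn_trans M); last by lia.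
  by apply: leq_trans Hc; apply: leq_psum_fun => i _; case: ifP.
move=> s3 u3 [F3 s3P Hu3].
have F3' : frame L s s3.
  by apply: frame_trans F2 F3 => // a; rewrite !inE => /or4P[]/eqP->.
have s3k : s3 29 0 = k by rewrite F3'.
have s3v : s3 26 = iv by rewrite F3'.
have s3c : s3 28 = ic by rewrite F3'.
have s3D : s3 20 = D by rewrite F3.
have w0 v : (forall i, i < k -> iv i != v) -> vertex_weight v = 0.
  by move=> H; apply: psum_const0 => i ik; rewrite (negbTE (H i ik)).
have diffE v : v < n -> big v -> s3 42 (base v + nb v) - s3 42 (base v) = vertex_weight v.
  move=> vn bv; have := block_bound vn bv => Hb.
  rewrite !s3P !ifT; try by rewrite /NB; lia.
  rewrite !bgE; try by rewrite /NB; lia.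
  rewrite psum_subr; last first.
    move=> i _; case: big => //=; case: (ltnP (pos i) (base v).+1) => // H.
    by rewrite ifT //; lia.
  apply: psum_ext => i ik; case: (boolP (big (iv i))) => bi /=; last first.
    by rewrite ifF //; apply: contraNF bi => /eqP->.
  rewrite -(pos_in vn bv ik bi) !ltnS.
  by case: (leqP (pos i) (base v)) => H /=; [rewrite ifT ?subnn //; lia | rewrite subn0].
apply: hoare_seq; apply: hoare_par => //.
- by rewrite /=; repeat split; lia.
- by rewrite /= s3k; lia.
- move=> i; rewrite [X in _ < X]/= s3k => ik; have [S1 E1] := bigP s3 i F3' ik; split.
    by split=> //; exact: W_gt0.
  by move=> _; have := ivn i ik => vn; rewrite /= s3v; repeat split; lia.
move=> f5 Hf5; rewrite [den _ _ _ _]/= s3k; set s5 := upd s3 20 f5.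
have F5 : frame L s s5 by apply: frame_upd.
have s5k : s5 29 0 = k by [].
have s5v : s5 26 = iv by [].
have s5f : s5 20 = f5 by [].
have s5P : s5 42 = s3 42 by [].
clearbody s5.
have den5 i : i < k -> (den mc s3 i (hbig == #0)%H != 0) = ~~ big (iv i).
  move=> ik; have [_ E] := bigP s3 i F3' ik.
  by change ((((den mc s3 i hbig == 0) : nat) != 0) = ~~ big (iv i)); rewrite E !guardE.
have f5s v : v < n -> ~~ big v -> f5 v = D v - vertex_weight v.
  move=> vn nbv; case: (Hf5 v) => [[-> H]|[i [+ + +]]].
    rewrite s3D w0 ?subn0 // => i ik; apply/eqP => Ei.
    by case: (H i) => //; [rewrite /= s3k | rewrite den5 // Ei | rewrite /= s3v].
  rewrite [X in _ < X]/= s3k => ik _; rewrite [LHS]/= s3v => Ei ->.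
  rewrite [LHS]/= s3v s3D s3c Ei; congr (_ - _).
  rewrite /vertex_weight (@psum_single _ i) ?ik ?Ei ?eqxx // => j jk nj.
  case: eqP => // Ej; case/negP: nj; apply/eqP; apply: Hinj => //; first by rewrite Ej.
  (* A vertex of degree at most [B] has block 0 only, hence a single item, and the direct
     subtraction is exclusive. *)
  have ij0 l : l < k -> iv l = v -> ij l = 0.
    move=> lk El; have [_] := Hv lk; rewrite El; move: nbv; rewrite /big -leqNgt => H1 H2.
    have := leq_trans H2 H1; rewrite -{2}(mul1n B) ltn_mul2r => /andP[_]; lia.
  by rewrite !ij0.
have f5b v : big v -> f5 v = D v.
  move=> bv; case: (Hf5 v) => [[-> _]|[i [+ + +]]]; first by rewrite s3D.
  rewrite [X in _ < X]/= s3k => ik; rewrite den5 // [LHS]/= s3v => + Ei.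
  by rewrite Ei bv.
have nbE i : i < k -> den mc s5 i ((hdeg (26@[HP]) + $0 * $0 - #1) %/ ($0 * $0))%H = nb (iv i).
  move=> ik; have b' : s5 0 0 = b by rewrite F5.
  by rewrite /= b' s5v degE.
(* All items of a large vertex write the same value, so it does not matter which one succeeds. *)
apply: hoare_par => //.
- by rewrite /=; repeat split; lia.
- by rewrite /= s5k; lia.
- move=> i; rewrite [X in _ < X]/= s5k => ik; have [S1 E1] := bigP s5 i F5 ik; split=> //.
  rewrite E1 nat_of_bool_neq0 => bi; have [S2 E2] := baseP s5 i F5 ik.
  have vn := ivn i ik; split.
  + by rewrite /=; repeat split; lia.
  + by rewrite /= s5v; lia.
  + have := block_bound vn bi => Hb; have b' : s5 0 0 = b by rewrite F5.
    change ([/\ [/\ [/\ True, i < c_len mc & 26 < NA], s5 26 i < c_len mc & 20 < NA],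
      [/\ [/\ [/\ safe mc s5 i hbase,
              safe mc s5 i ((hdeg (26@[HP]) + $0 * $0 - #1) %/ ($0 * $0))%H &
              den mc s5 i hbase + den mc s5 i ((hdeg (26@[HP]) + $0 * $0 - #1) %/ ($0 * $0))%H < W],
              den mc s5 i hbase + den mc s5 i ((hdeg (26@[HP]) + $0 * $0 - #1) %/ ($0 * $0))%H < c_len mc & 42 < NA],
          [/\ safe mc s5 i hbase, den mc s5 i hbase < c_len mc & 42 < NA] & True] & True]).
    rewrite nbE // E2 s5v; have Sd : safe mc s5 i ((hdeg (26@[HP]) + $0 * $0 - #1) %/ ($0 * $0))%H.
      have dM := deg_b i ik.
      have bb2 : M + B < W.
        have := c_lenW mc; have := c_b_len mc => H1 H2.
        have : B <= c_len mc * c_len mc by apply: leq_mul; lia.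
        by clear -H2 lM lge lW; nia.
      rewrite /= b' s5v degE // -/B; clear -ik kM vn lM lW lb b0 HB bb bb2 dM.
      by repeat split; lia.
    have Hb' : base (iv i) + nb (iv i) <= 2 * M by lia.
    clear -S2 Sd Hb' ik kM vn lM lW lge clen; repeat split=> //; lia.
move=> f6 Hf6; split.
- by apply: frame_upd.
- move=> v vn; rewrite upd_same.
  case: (boolP (big v)) => bv; last first.
    case: (Hf6 v) => [[-> _]|[i [+ + +]]]; first by rewrite s5f f5s.
    rewrite [X in _ < X]/= s5k => ik; have [_ ->] := bigP s5 i F5 ik.
    by rewrite nat_of_bool_neq0 [LHS]/= s5v => bi Ei; rewrite -Ei bi in bv.
  case: (Hf6 v) => [[-> H]|[i [+ _ +]]].
    rewrite s5f f5b // w0 ?subn0 // => i ik; apply/eqP => Ei.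
    case: (H i) => //; first by rewrite /= s5k.
      by have [_ ->] := bigP s5 i F5 ik; rewrite Ei bv.
    by rewrite /= s5v.
  rewrite [X in _ < X]/= s5k => ik; rewrite [LHS]/= s5v => Ei ->.
  have [_ E2] := baseP s5 i F5 ik.
  change (s5 20 (s5 26 i) - (s5 42 (den mc s5 i hbase + den mc s5 i ((hdeg (26@[HP]) + $0 * $0 - #1) %/ ($0 * $0))%H) -
    s5 42 (den mc s5 i hbase)) = D v - vertex_weight v).
  by rewrite E2 nbE // s5v Ei s5f f5b // s5P diffE.
- by rewrite /= s5k; move: Hu3; rewrite /NB; move: (M %/ B) => X; clear -b0; lia.
Qed.

End Decrease.

Lemma psum_list (l : seq nat) (P : nat -> bool) (g : nat -> nat) n :
  uniq l -> (forall v, (v \in l) = (v < n) && P v) ->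
  psum (fun i => g (nth 0 l i)) (size l) = psum (fun v => if P v then g v else 0) n.
Proof.
move=> ul ml; rewrite /psum -(big_mkord xpredT (fun i => g (nth 0 l i))).
rewrite -(big_nth 0 xpredT g).
rewrite -(big_mkord xpredT (fun v => if P v then g v else 0)) /index_iota subn0.
rewrite -big_mkcond -[RHS]big_filter; apply: perm_big; apply: uniq_perm => //.
  by rewrite filter_uniq // iota_uniq.
by move=> v; rewrite ml mem_filter mem_iota add0n andbC.
Qed.

(** Exchange of sums: every old item contributes to exactly one merged item. *)
Lemma merged_sum mc iv ij ic k iv' ij' ic' k' (h : nat -> bool) :
  merged mc iv ij ic k iv' ij' ic' k' ->
  psum (fun i => if h (iv' i) then ic' i else 0) k' =
  psum (fun j => if h (iv j) then ic j else 0) k.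
Proof.
case=> _ H1 H2 H3 H4.
rewrite (@psum_ext _ (fun i => psum (fun j =>
   if h (iv j) && (iv j == iv' i) && (ij j %/ c_b mc == ij' i) then ic j else 0) k)); last first.
  move=> i ik; rewrite H4 //; case: (boolP (h (iv' i))) => hi.
    apply: psum_ext => j _; case: (eqVneq (iv j) (iv' i)) => [->|_]; last by rewrite andbF.
    by rewrite hi.
  rewrite psum_const0 // => j _; case: (eqVneq (iv j) (iv' i)) => [->|_]; last by rewrite andbF.
  by rewrite (negbTE hi).
rewrite exchange_psum; apply: psum_ext => j jk.
have [i ik [E1 E2]] := H2 j jk.
rewrite (@psum_single _ i); last first.
  move=> i' ik' ni; case: andP => // -[/andP[_ /eqP F1] /eqP F2].
  by case/negP: ni; apply/eqP; apply: H3 => //; rewrite -?F1 -?F2.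
by rewrite ik E1 E2 !eqxx !andbT.
Qed.

Lemma merged_items_ok mc n off iv ij ic k iv' ij' ic' k' :
  items_ok n off iv ij k -> merged mc iv ij ic k iv' ij' ic' k' ->
  items_ok n off iv' ij' k'.
Proof.
move=> [H1 _] [_ E _ I _]; split=> // i ik; have [j jk [-> ->]] := E i ik.
by have [vn jd] := H1 j jk; split=> //; apply: leq_ltn_trans jd; apply: leq_div.
Qed.

Lemma merged_total mc iv ij ic k iv' ij' ic' k' :
  merged mc iv ij ic k iv' ij' ic' k' -> psum ic' k' = psum ic k.
Proof. by move=> /(@merged_sum _ _ _ _ _ _ _ _ _ xpredT). Qed.

Lemma scatter_list mc s N a e v l c f :
  (forall i, i < N -> den mc s i e = nth 0 l i) -> N = size l ->
  (forall i, i < N -> den mc s i v = c) ->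
  par_content mc s N (HC 1) a e v f ->
  forall x, f x = if x \in l then c else s a x.
Proof.
move=> He EN Hv Hf x; case: (Hf x) => [[-> H]|[i [iN _ E ->]]].
  case: ifP => // xl; case: (H (index x l)) => //.
    by rewrite EN index_mem.
  by rewrite He ?nth_index // EN index_mem.
by rewrite Hv // -E He // mem_nth // -EN.
Qed.

(** * One round of simultaneous removals *)

Definition hselect : hexpr := ((21@[26@[HP]] == #0) && (20@[26@[HP]] <= $44))%H.

(** A vertex may occur several times among the candidates, so a write to array 30 elects one
    occurrence. The arc from a removed u to v becomes an item of v at the position of u in the list
    of v, computed from the reverse arc in array 19. The final list of items serves as the next list
    of candidates: only a vertex whose degree has dropped can newly fall below the threshold. *)
Definition round_cmd : hcmd :=
  HSeq (HPar ($29) hselect 30 (26@[HP]) HP) (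
  HSeq (compaction 29 (hselect && (30@[26@[HP]] == HP)) (26@[HP]) 31 32) (
  HSeq (HPar ($32) (#1) 21 (31@[HP]) (#1)) (
  HSeq (HPar ($32) (#1) 22 (31@[HP]) ($23)) (
  HSeq flatten_cmd (
  HSeq (HPar ($13) (#1) 26 HP (hdst (11@[HP]))) (
  HSeq (HPar ($13) (#1) 27 HP (19@[11@[HP]] - #1 - hoff (hdst (11@[HP])))) (
  HSeq (HPar ($13) (#1) 28 HP (#1)) (
  HSeq (HSet 29 ($13)) (
  HSeq level_cmd (
  HSeq level_cmd decrease_degrees_cmd))))))))))%H.

Section Round.
Variables (mc : config) (n : nat) (off dst : nat -> nat).
Hypothesis G : csr mc n off dst.
Local Notation b := (c_b mc).
Local Notation M := (off n).
Local Notation W := (2 ^ c_w mc).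
Local Notation deg := (odeg off).
Let B := b * b.

Definition arcs (u v : nat) := psum (fun r => dst (off u + r) == v) (deg u).

(** Injectivity keeps the items of different removed arcs different, as [items_ok] demands. *)
Definition twins (tw : nat -> nat) :=
  (forall u r, u < n -> r < deg u ->
     [/\ off (dst (off u + r)) <= tw (off u + r),
         tw (off u + r) < off (dst (off u + r)).+1 &
         dst (tw (off u + r)) = u]) /\
  (forall a a', a < M -> a' < M -> tw a = tw a' -> a = a').

Lemma psum_deg m : m <= n -> psum deg m = off m.
Proof.
elim: m => [|m IH] mn; first by rewrite psum0 (csr_off0 G).
by rewrite psumS IH ?(ltnW mn) // (offS G mn).
Qed.

Variables (iv : nat -> nat) (k th T : nat) (rem lay D tw : nat -> nat).
Hypotheses (kM : k <= n + M) (Hv : forall i, i < k -> iv i < n /\ 0 < deg (iv i))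
  (tb : th < W) (TW : T < W) (Htw : twins tw).

Definition removed (v : nat) : bool :=
  [&& has (fun i => iv i == v) (iota 0 k), rem v == 0 & D v <= th].

Let Delta := psum (fun v => if removed v then deg v else 0) n.
Let weight v := psum (fun u => if removed u then arcs u v else 0) n.

Lemma removed_lt v : removed v -> v < n /\ 0 < deg v.
Proof. by case/and3P=> /hasP[i]; rewrite mem_iota => /andP[_ ik] /eqP<- _ _; apply: Hv. Qed.

Lemma Delta_le : Delta <= M.
Proof.
rewrite -(psum_deg (leqnn n)); apply: leq_psum_fun => v _.
by case: ifP.
Qed.

(** The new candidates number at most [Delta], so the term k in the cost of the next round is paid
    by the degrees removed in this one. *)
Lemma hoare_round s t :
  s 0 0 = b -> s 29 0 = k -> s 26 = iv -> s 20 = D -> s 21 = rem -> s 22 = lay ->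
  s 23 0 = T -> s 44 0 = th -> (forall a, a < M -> s 19 a = (tw a).+1) ->
  (forall v, v < n -> D v < W) ->
  hoare mc round_cmd s t (fun s' u =>
    [/\ frame ([:: 1; 2; 3; 6] ++ iota 9 5 ++ iota 20 3 ++ iota 26 18) s s',
        forall v, v < n -> [/\ s' 20 v = D v - weight v,
          s' 21 v = (if removed v then 1 else rem v) &
          s' 22 v = (if removed v then T else lay v)],
        s' 29 0 <= Delta /\
        (forall i, i < s' 29 0 -> s' 26 i < n /\ 0 < deg (s' 26 i)),
        forall v, v < n -> 0 < weight v -> exists2 i, i < s' 29 0 & s' 26 i = v &
        u <= 100 * (100 * (k + Delta + M %/ B + b))]).
Proof.
move=> sb sk sv sD sR sL sT sth stw DW.
have b0 := c_b_gt0 mc; have [lM lW lb] := csr_bounds G; have HB := csr_base G.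
have xge : c_len mc <= c_ext mc by have := c_ext_ge mc; rewrite /NA; lia.
have lge := c_len_ge mc; have clen := csr_len G; have blen := c_b_len mc.
have DM := Delta_le.
pose L := [:: 1; 2; 3; 6] ++ iota 9 5 ++ iota 20 3 ++ iota 26 18.
pose cand i := (rem (iv i) == 0) && (D (iv i) <= th).
have selP (s' : store) i : s' 26 = iv -> s' 20 = D -> s' 21 = rem -> s' 44 0 = th -> i < k ->
    safe mc s' i hselect /\ den mc s' i hselect = cand i.
  move=> v' D' R' th' ik; have [vn _] := Hv ik.
  rewrite /= v' D' R' th' !guardE -leqNgt; split.
    by clear -ik vn kM lM lW lb lge clen; repeat split; lia.
  by rewrite /cand; case: (rem _ == 0); case: (_ <= _).
apply: hoare_seq; apply: hoare_par => //.
- by rewrite /=; repeat split; lia.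
- by rewrite /= sk; lia.
- move=> i; rewrite [X in _ < X]/= sk => ik; have [vn _] := Hv ik.
  have [S1 E1] := selP s i sv sD sR sth ik; split=> // _; split=> //=.
    by repeat split; lia.
  by rewrite sv; lia.
move=> wn Hw; rewrite [den _ _ _ _]/= sk; set s1 := upd s 30 wn.
have F1 : frame L s s1 by apply: frame_upd.
have wP i : i < k -> cand i -> [/\ wn (iv i) < k, cand (wn (iv i)) & iv (wn (iv i)) = iv i].
  move=> ik ci; case: (Hw (iv i)) => [[_ H]|[j [+ + + ->]]].
    have [_ E] := selP s i sv sD sR sth ik.
    by case: (H i); rewrite ?E ?ci //; [rewrite /= sk | rewrite /= sv].
  rewrite [X in _ < X]/= sk [X in _ -> _ -> X = _ -> _]/= sv => jk.
  have [_ ->] := selP s j sv sD sR sth jk.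
  by rewrite nat_of_bool_neq0.
have s1w : s1 30 = wn by [].
have s1b : s1 0 0 = b by [].
have s1k : s1 29 0 = k by [].
have s1v : s1 26 = iv by [].
have s1D : s1 20 = D by [].
have s1R : s1 21 = rem by [].
have s1th : s1 44 0 = th by [].
have s1L : s1 22 = lay by [].
clearbody s1.
pose phi i := cand i && (wn (iv i) == i).
apply: hoare_seq; apply: hoare_conseq.
  apply: (@hoare_compaction mc phi iv 29 _ (26@[HP])%H 31 32 s1 _ k) => //; first by lia.
  - move=> s' i F' ik.
    have v' : s' 26 = iv by rewrite F'.
    have D' : s' 20 = D by rewrite F'.
    have R' : s' 21 = rem by rewrite F'.
    have th' : s' 44 0 = th by rewrite F'.
    have w' : s' 30 = wn by rewrite F'.
    have [S1 E1] := selP s' i v' D' R' th' ik; have [vn _] := Hv ik.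
    have E : den mc s' i (hselect && (30@[26@[HP]] == HP))%H = phi i.
      change ((if den mc s' i hselect != 0 then ((s' 30 (s' 26 i) == i) : nat) else 0) = phi i).
      by rewrite E1 nat_of_bool_neq0 w' v' /phi; case: (cand i).
    rewrite E nat_of_bool_neq0; split; last by split=> //; case: (phi i).
    change ([/\ safe mc s' i hselect, den mc s' i hselect != 0 ->
      [/\ [/\ [/\ True, i < c_len mc & 26 < NA], s' 26 i < c_len mc & 30 < NA], True & True] &
      den mc s' i hselect = 0 -> 0 < W]).
    by rewrite v'; split=> // _; repeat split; lia.
  - move=> s' i F' ik _; have v' : s' 26 = iv by rewrite F'.
    by rewrite /= v'; split=> //; split=> //; lia.
move=> s2 u2 [F2 s2n s2e Hu2].
set l := selected phi iv k in s2n s2e.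
have lP v : (v \in l) = (v < n) && removed v.
  apply/mapP/andP => [[i]|[vn /and3P[/hasP[i]]]].
    rewrite mem_filter mem_iota => /andP[/andP[/andP[c1 c2] wi] ik] ->.
    split; first by have [] := Hv ik.
    by rewrite /removed c1 c2 !andbT; apply/hasP; exists i => //; rewrite mem_iota.
  rewrite mem_iota add0n => /andP[_ ik] /eqP Ei r0 Dt.
  have ci : cand i by rewrite /cand Ei r0 Dt.
  have [wk wc Ew] := wP i ik ci; exists (wn (iv i)); last by rewrite Ew Ei.
  by rewrite mem_filter mem_iota add0n leq0n wk /phi wc Ew eqxx.
have ul : uniq l.
  rewrite map_inj_in_uniq ?filter_uniq ?iota_uniq // => i j.
  rewrite !mem_filter => /andP[/andP[_ /eqP wi] _] /andP[/andP[_ /eqP wj] _] E.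
  by rewrite -wi -wj E.
pose f := size l; pose fl i := nth 0 l i.
have flP i : i < f -> fl i < n /\ removed (fl i).
  by move=> i_f; apply/andP; rewrite -lP mem_nth.
have fl_inj i j : i < f -> j < f -> fl i = fl j -> i = j.
  by move=> i_f jf /eqP; rewrite nth_uniq // => /eqP.
have fn : f <= n.
  rewrite /f -(size_iota 0 n); apply: uniq_leq_size => // v; rewrite lP mem_iota => /andP[-> _]//.
have F2' : frame L s s2.
  by apply: frame_transb F1 F2.
have s2f : s2 32 0 = f by [].
have s2fl i : i < f -> s2 31 i = fl i by exact: s2e.
have s2b : s2 0 0 = b by rewrite F2'.
have s2T : s2 23 0 = T by rewrite F2'.
have s2R : s2 21 = rem by rewrite F2.
have s2L : s2 22 = lay by rewrite F2.
have s2D : s2 20 = D by rewrite F2.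
have fW i : i < f -> fl i < c_len mc by move=> /flP[H _]; lia.
apply: hoare_seq; apply: hoare_par => //.
- by rewrite /=; repeat split; lia.
- by rewrite /= s2f; lia.
- move=> i; rewrite [X in _ < X]/= s2f => i_f; split; first by rewrite /=; lia.
  by move=> _; split=> //=; [split=> //; lia | rewrite s2fl // fW | lia].
move=> r Hr; rewrite [den _ _ _ _]/= s2f.
have rE x : r x = if x \in l then 1 else rem x.
  by rewrite -s2R; apply: (scatter_list _ _ _ Hr) => //= i; rewrite s2f => /s2fl.
set s3 := upd s2 21 r.
have F3 : frame L s s3 by apply: frame_upd.
have s3f : s3 32 0 = f by [].
have s3fl : s3 31 = s2 31 by [].
have s3r : s3 21 = r by [].
have s3L : s3 22 = lay by [].
have s3D : s3 20 = D by [].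
have s3T : s3 23 0 = T by rewrite F3.
clearbody s3.
apply: hoare_seq; apply: hoare_par => //.
- by rewrite /=; repeat split; lia.
- by rewrite /= s3f; lia.
- move=> i; rewrite [X in _ < X]/= s3f => i_f; split; first by rewrite /=; lia.
  by move=> _; rewrite /= s3fl s2fl //; have := fW i i_f; repeat split; lia.
move=> la Hla; rewrite [den _ _ _ _]/= s3f.
have laE x : la x = if x \in l then T else lay x.
  rewrite -s3L; apply: (scatter_list _ _ _ Hla) => //= i; rewrite s3f.
  by rewrite s3fl => /s2fl.
set s4 := upd s3 22 la.
have F4 : frame L s s4 by apply: frame_upd.
have s4f : s4 32 0 = f by [].
have s4fl i : i < f -> s4 31 i = fl i by move=> i_f; rewrite -s2fl // -s3fl.
have s4r : s4 21 = r by [].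
have s4la : s4 22 = la by [].
have s4D : s4 20 = D by [].
have s4b : s4 0 0 = b by rewrite F4.
clearbody s4.
pose d i := deg (s4 31 i).
have dE i : i < f -> d i = deg (fl i) by move=> i_f; rewrite /d s4fl.
have EDelta : psum d f = Delta.
  rewrite (@psum_ext _ (fun i => deg (nth 0 l i))) //.
  exact: (psum_list _ ul lP).
apply: hoare_seq; apply: hoare_conseq.
  apply: (hoare_flatten G _ s4b s4f erefl _ EDelta DM) => i i_f.
  by rewrite s4fl //; have [vn /removed_lt[]] := flP i i_f.
move=> s5 u5 [F5 s5k s5A Hu5].
have s5b : s5 0 0 = b by rewrite F5.
have s5r : s5 21 = r by rewrite F5.
have s5la : s5 22 = la by rewrite F5.
have s5D : s5 20 = D by rewrite F5.
have F5' : frame L s s5.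
  by apply: frame_transb F4 F5.
have s5tw : s5 19 = s 19 by rewrite F5'.
pose arc p := s5 11 p.
have arcP p : p < Delta -> exists i r, [/\ i < f, r < deg (fl i), p = psum d i + r &
    arc p = off (fl i) + r].
  rewrite -EDelta => /psum_locate[i [q [i_f qd ->]]]; exists i, q.
  by rewrite dE // in qd; split=> //; rewrite /arc; have [_ ->] := s5A i q i_f ltac:(by rewrite -/(d i) dE); rewrite s4fl.
have arcM p : p < Delta -> arc p < M.
  move=> /arcP[i [q [i_f qd _ ->]]]; have [vn _] := flP i i_f; exact: (slot_lt G).
have dst_n p : p < Delta -> dst (arc p) < n by move=> /arcM; apply: (csr_dst_lt G).
have inp0 := csr_n G.
have d13_5 : den mc s5 0 ($13) = Delta by rewrite /= s5k.
apply: hoare_seq; apply: hoare_map => //; rewrite ?d13_5.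
- by rewrite /=; repeat split; lia.
- by lia.
- move=> p pD; have := arcM p pD; rewrite /arc => aM.
  split; first by rewrite /=; lia.
  move=> _; rewrite /= inp0; clear -aM pD DM lM lW lb lge HB clen; repeat split=> //; lia.
move=> iv2 Hiv2; have ivE p : p < Delta -> iv2 p = dst (arc p).
  by move=> pD; rewrite Hiv2 pD /= inp0 (csr_dst G) //; exact: arcM.
set s6 := upd s5 26 iv2.
have F6 : frame L s s6 by apply: frame_upd.
have s6k : s6 13 0 = Delta by [].
have s6a : s6 11 = arc by [].
have s6v : s6 26 = iv2 by [].
have s6r : s6 21 = r by [].
have s6la : s6 22 = la by [].
have s6D : s6 20 = D by [].
have s6tw : s6 19 = s 19 by [].
clearbody s6.
have d13_6 : den mc s6 0 ($13) = Delta by rewrite /= s6k.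
apply: hoare_seq; apply: hoare_map => //; rewrite ?d13_6.
- by rewrite /=; repeat split; lia.
- by lia.
- move=> p pD; have aM := arcM p pD; have dn := dst_n p pD.
  split; first by rewrite /=; lia.
  move=> _; rewrite /= inp0 s6a (csr_dst G) // ?(csr_offS G (ltnW dn)).
  clear -aM dn pD DM lM lW lb lge HB clen; repeat split=> //; lia.
move=> ij2 Hij2; have ijE p : p < Delta -> ij2 p = tw (arc p) - off (dst (arc p)).
  move=> pD; have aM := arcM p pD; have dn := dst_n p pD.
  by rewrite Hij2 pD /= inp0 s6a (csr_dst G) // (csr_offS G (ltnW dn)) s6tw stw // subn1.
set s7 := upd s6 27 ij2.
have F7 : frame L s s7 by apply: frame_upd.
have s7k : s7 13 0 = Delta by [].
have s7v : s7 26 = iv2 by [].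
have s7j : s7 27 = ij2 by [].
have s7r : s7 21 = r by [].
have s7la : s7 22 = la by [].
have s7D : s7 20 = D by [].
clearbody s7.
have d13_7 : den mc s7 0 ($13) = Delta by rewrite /= s7k.
apply: hoare_seq; apply: hoare_map => //; rewrite ?d13_7.
- by rewrite /=; repeat split; lia.
- by lia.
- by move=> p _; rewrite /=; split; lia.
move=> ic2 Hic2; have icE p : p < Delta -> ic2 p = 1 by move=> pD; rewrite Hic2 pD.
set s8 := upd s7 28 ic2.
have F8 : frame L s s8 by apply: frame_upd.
have s8k : s8 13 0 = Delta by [].
have s8v : s8 26 = iv2 by [].
have s8j : s8 27 = ij2 by [].
have s8c : s8 28 = ic2 by [].
have s8r : s8 21 = r by [].
have s8la : s8 22 = la by [].
have s8D : s8 20 = D by [].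
clearbody s8.
apply: hoare_seq; apply: hoare_set => //=; first by repeat split; lia.
rewrite s8k; set s9 := upd s8 29 _.
have F9 : frame L s s9 by apply: frame_upd.
have s9k : s9 29 0 = Delta by [].
have s9v : s9 26 = iv2 by [].
have s9j : s9 27 = ij2 by [].
have s9c : s9 28 = ic2 by [].
have s9r : s9 21 = r by [].
have s9la : s9 22 = la by [].
have s9D : s9 20 = D by [].
have s9b : s9 0 0 = b by rewrite F9.
clearbody s9.
(* Vertex and position of an item together are the reverse arc, and [tw] is injective. *)
have Hok : items_ok n off iv2 ij2 Delta.
  split=> [p pD|p p' pD pD']; have [i [q [i_f qd Ep Ea]]] := arcP p pD; have [vn _] := flP i i_f.
    have dn := dst_n p pD; rewrite ivE // ijE //; split=> //.
    have [/(_ _ _ vn qd)[t1 t2 _] _] := Htw; rewrite -Ea in t1 t2.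
    by have := offS G dn; lia.
  have [i' [q' [i_f' qd' Ep' Ea']]] := arcP p' pD'; have [vn' _] := flP i' i_f'.
  have [/(_ _ _ vn qd)[t1 t2 _] ti] := Htw; rewrite -Ea in t1 t2.
  have [/(_ _ _ vn' qd')[t1' t2' _] _] := Htw; rewrite -Ea' in t1' t2'.
  rewrite !ivE // !ijE // => Ev Ej; rewrite Ev in Ej t1.
  have {}Ej : tw (arc p) = tw (arc p') by lia.
  have := ti _ _ (arcM p pD) (arcM p' pD') Ej; rewrite Ea Ea' => E.
  have [E1 E2] := slot_inj G vn vn' qd qd' E.
  by rewrite Ep Ep' (fl_inj i i') // E2.
have icsum : psum ic2 Delta = Delta.
  by rewrite (@psum_ext _ (fun=> 1)) // /psum sum1_card card_ord.
apply: hoare_seq; apply: hoare_conseq.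
  by apply: (hoare_level G DM Hok _ _ s9b s9k s9v s9j s9c); rewrite icsum.
move=> s10 u10 [F10 m10 Hu10].
have F10' : frame L s s10.
  by apply: frame_transb F9 F10.
have k10 : s10 29 0 <= Delta by case: m10.
have ok10 := merged_items_ok Hok m10.
have sum10 : psum (s10 28) (s10 29 0) <= M by rewrite (merged_total m10) icsum.
apply: hoare_seq; apply: hoare_conseq.
  by apply: (hoare_level G (leq_trans k10 DM) ok10 sum10 _ _ erefl erefl erefl erefl); rewrite F10'.
move=> s11 u11 [F11 m11 Hu11].
have F11' : frame L s s11 by apply: frame_transb F10' F11.
have k11 : s11 29 0 <= Delta by apply: leq_trans k10; case: m11.
have sum11 : psum (s11 28) (s11 29 0) <= M by rewrite (merged_total m11).
(* The two passes divide a position twice by b, so it ends up as the index of its block of length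
   [b * b]. *)
have Hb i : i < s11 29 0 -> s11 26 i < n /\ s11 27 i * (b * b) < deg (s11 26 i).
  move=> ik; case: m11 => _ /(_ i ik)[j jk [-> ->]] _ _ _.
  case: m10 => _ /(_ j jk)[p pD [-> ->]] _ _ _.
  have [vn jd] := proj1 Hok p pD; split=> //; apply: leq_ltn_trans jd.
  rewrite mulnA; apply: leq_trans (leq_trunc_div _ b).
  by rewrite leq_mul2r leq_trunc_div orbT.
have inj11 : forall i i', i < s11 29 0 -> i' < s11 29 0 -> s11 26 i = s11 26 i' -> s11 27 i = s11 27 i' -> i = i'.
  by case: m11.
have s11D : s11 20 = D by rewrite F11 // F10.
have s11r : s11 21 = r by rewrite F11 // F10.
have s11la : s11 22 = la by rewrite F11 // F10.
apply: hoare_conseq.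
  by apply: (hoare_decrease_degrees G (leq_trans k11 DM) Hb inj11 sum11 _ _ erefl erefl erefl erefl s11D); rewrite F11'.
move=> s12 u12 [F12 s12D Hu12].
have wE v : vertex_weight (s11 26) (s11 28) (s11 29 0) v = weight v.
  rewrite /vertex_weight (merged_sum (pred1 v) m11) (merged_sum (pred1 v) m10) -EDelta psum_psum.
  rewrite /weight -(psum_list _ ul lP) -/f; apply: eq_bigr => -[i i_f] _ /=.
  rewrite dE //; apply: eq_bigr => -[q qd] _ /=.
  have pD : psum d i + q < Delta by rewrite -EDelta psum_bound // dE.
  rewrite icE // ivE // /arc.
  have [_ ->] := s5A i q i_f ltac:(by rewrite -/(d i) dE).
  by rewrite s4fl //; case: eqP.
have s12k : s12 29 0 = s11 29 0 by rewrite F12.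
have s12v : s12 26 = s11 26 by rewrite F12.
split.
- by apply: frame_transb F11' F12.
- move=> v vn; rewrite s12D // wE F12 // F12 // s11r s11la rE laE lP vn.
  by [].
- rewrite s12k s12v; split=> // i ik; have [vn] := Hb i ik.
  by split=> //; lia.
- move=> v vn; rewrite -wE lt0n => /eqP H.
  have [[i ik]] : exists i : 'I_(s11 29 0), s11 26 i == v.
    apply/existsP; apply: contra_notT H => /existsPn H.
    by apply: psum_const0 => i ik; rewrite ifN //; exact: (H (Ordinal ik)).
  by move=> /= /eqP E; exists i; rewrite ?s12k ?s12v.
- have fD : f <= Delta.
    rewrite -EDelta; apply: (@leq_trans (psum (fun=> 1) f)).
      by rewrite /psum sum1_card card_ord.
    by apply: leq_psum_fun => i i_f; rewrite dE //; have [_ /removed_lt[]] := flP i i_f.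
  rewrite -/B in Hu12; move: (M %/ B) Hu12 => X Hu12.
  clear -fD Hu2 Hu5 Hu10 Hu11 Hu12 k10 k11 fn b0 EDelta dE flP; lia.
Qed.

End Round.

(** * Combinatorics of the peeling *)

Section Peeling.
Import fintype.
Variables (V : finType) (e : rel V).
Hypothesis e_sym : symmetric e.

Definition deg_in (A : {set V}) (v : V) : nat := #|[set u in A | e v u]%SET|.

Definition above (t : nat) : {set V} := [set v | t < coreness e v]%SET.

Lemma deg_in_sub (A A' : {set V}) v : A \subset A' -> deg_in A v <= deg_in A' v.
Proof.
move=> AA; apply: subset_leq_card; apply/subsetP => u; rewrite !inE => /andP[/(subsetP AA)-> ->//].
Qed.

Lemma min_degree_leq k k' (S : {set V}) : k' <= k -> min_degree_geq e k S -> min_degree_geq e k' S.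
Proof.
move=> kk /forallP H; apply/forallP => v; apply/implyP => vS.
by apply: leq_trans kk (implyP (H v) vS).
Qed.

Lemma coreness_geq k v (S : {set V}) : min_degree_geq e k S -> v \in S -> k <= coreness e v.
Proof.
move=> HS vS; have kV : k < #|V|.+1.
  rewrite ltnS; apply: leq_trans (implyP (forallP HS v) vS) (max_card _).
rewrite /coreness; apply: (leq_trans _ (leq_bigmax_cond (Ordinal kV) _)) => //=.
have [S' HS' SS'] := maxset_exists HS.
by apply/existsP; exists S'; rewrite /kcore HS' (subsetP SS').
Qed.

(** A positive maximum is attained, at an index whose core serves as witness; the value 0 may also
    come from an empty maximum. *)
Lemma coreness_witness k v : 0 < k <= coreness e v ->
  exists2 S : {set V}, min_degree_geq e k S & v \in S.
Proof.
case/andP=> k0 kc; rewrite /coreness in kc.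
have [i Hi Ei] : {i : 'I_#|V|.+1 | [exists S, kcore e i S && (v \in S)] &
    \max_(k < #|V|.+1 | [exists S, kcore e k S && (v \in S)]) k = i :> nat}.
  apply: eq_bigmax_cond; apply/card_gt0P; apply/existsP; apply: contraLR kc.
  move=> /existsPn H; rewrite -ltnNge big1 // => i Hi.
  by have := H i; rewrite unfold_in Hi.
have /existsP[S /andP[/maxsetP[HS _] vS]] := Hi.
by exists S => //; apply: min_degree_leq HS; rewrite -Ei.
Qed.

(** [above t] is the (t + 1)-core: a set of minimum degree t + 1 consists of vertices of coreness
    more than t, so the witness for v lies in [above t]. *)
Lemma above_min_degree t v : v \in above t -> t < deg_in (above t) v.
Proof.
rewrite inE => tv; have [|S HS vS] := @coreness_witness t.+1 v; first by [].
apply: (leq_trans (implyP (forallP HS v) vS)); apply: deg_in_sub.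
by apply/subsetP => u uS; rewrite inE; apply: coreness_geq HS uS.
Qed.

(** Otherwise [X :|: above t] would have minimum degree more than t, and [X] would be contained in
    [above t]. *)
Lemma low_vertex t (X : {set V}) : [disjoint X & above t] -> X != finset.set0 ->
  exists2 v, v \in X & deg_in (X :|: above t) v <= t.
Proof.
move=> dX /set0Pn[w wX]; apply/exists_inP; apply: contraT => /exists_inPn H.
suff : w \in above t by rewrite (disjointFr dX wX).
rewrite inE; apply: (@coreness_geq _ _ (X :|: above t)); last by rewrite inE wX.
apply/forallP => v; apply/implyP; rewrite inE => /orP[vX|vA].
  by have := H v vX; rewrite -ltnNge.
apply: (@leq_trans (deg_in (above t) v)); first exact: above_min_degree.
by apply: deg_in_sub; apply: finset.subsetUr.
Qed.

Lemma deg_inD1 (A : {set V}) w v : w \in A -> deg_in A v = (e v w) + deg_in (A :\ w) v.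
Proof.
move=> wA; rewrite /deg_in (cardsD1 w) inE wA /=; congr (_ + #|pred_of_set _|).
by apply/setP => u; rewrite !inE andbA.
Qed.

(* Removing the vertices of [X] in the order given by [low_vertex] charges
   every edge with an end in [X] to a vertex with at most [t] such edges. *)
Lemma sum_low_degrees t (X : {set V}) : [disjoint X & above t] ->
  \sum_(v in X) deg_in (X :|: above t) v <= 2 * t * #|X|.
Proof.
have [m] := ubnP #|X|; elim: m X => // m IH X; rewrite ltnS => Xm dX.
have [->|X0] := eqVneq X finset.set0; first by rewrite big_set0.
have [w wX wt] := low_vertex dX X0.
have dX' : [disjoint X :\ w & above t] by apply: disjointWl dX; apply: finset.subsetDl.
have cX : #|X :\ w|.+1 = #|X| by rewrite (cardsD1 w X) wX.
have wA : w \notin above t by rewrite (disjointFr dX wX).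
have EX : (X :|: above t) :\ w = (X :\ w) :|: above t.
  by rewrite finset.setDUl; congr (_ :|: _); apply/finset.setDidPl; rewrite disjoint_sym finset.disjoints1.
rewrite (big_setD1 w) //=.
under eq_bigr => v _ do rewrite (@deg_inD1 _ w) ?EX ?inE ?wX //.
rewrite big_split /= addnA.
(* w is charged at most t twice: for its own degree, and for what it takes from the degrees of the
   other vertices of [X]. *)
have H1 : \sum_(v in X :\ w) e v w <= t.
  apply: leq_trans wt; rewrite /deg_in -sum1_card [X in _ <= X]big_mkcond /= big_mkcond /=.
  apply: leq_sum => v _; rewrite !inE e_sym; case: (v == w) => //=.
  by case: (v \in X) => //=; case: (e w v).
have := IH _ _ dX'; rewrite cX => /(_ Xm) H2.
by rewrite -cX; lia.
Qed.

(** Markov's inequality: over the vertices of coreness at most t the degrees average at most 2 t,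
    while those counted here are at least (2 + 1 / q) t; so their fraction is at most 2 q / (2 q +
    1). *)
Lemma high_degree_count t th q (A : {set V}) :
  2 * q * t + t <= q * th.+1 ->
  (2 * q + 1) * #|[set v in A :\: above t | th < deg_in A v]%SET| <= 2 * q * #|A :\: above t|.
Proof.
move=> Hth; set X := A :\: above t; set Y := [set v in X | _]%SET.
have dX : [disjoint X & above t] by rewrite -setI_eq0 /X finset.setDE -finset.setIA [~: _ :&: _]finset.setIC finset.setICr finset.setI0.
have EA : A \subset X :|: above t.
  by apply/fintype.subsetP => v vA; rewrite !inE vA andbT orNb.
have H : \sum_(v in X) deg_in A v <= 2 * t * #|X|.
  by apply: leq_trans (sum_low_degrees dX); apply: leq_sum => v _; apply: deg_in_sub.
have H2 : th.+1 * #|Y| <= \sum_(v in X) deg_in A v.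
  rewrite mulnC -sum_nat_const [X in _ <= X](big_setID Y) /=.
  apply: leq_trans (leq_addr _ _).
  have -> : X :&: Y = Y by apply/finset.setIidPr; apply/subsetP => v; rewrite inE => /andP[].
  by apply: leq_sum => v; rewrite inE => /andP[].
have {H2 H} H := leq_trans H2 H.
move: #|Y| #|X| H => y x {dX EA X Y} H.
case: t Hth H => [|t] Hth H; first by move: H; rewrite muln0 mul0n leqn0 muln_eq0 => /eqP ->; rewrite muln0.
have : (2 * q * t.+1 + t.+1) * y <= q * (2 * t.+1 * x).
  by apply: leq_trans (leq_mul Hth (leqnn _)) _; rewrite -mulnA leq_mul2l H orbT.
have -> : (2 * q * t.+1 + t.+1) * y = t.+1 * ((2 * q + 1) * y) by lia.
have -> : q * (2 * t.+1 * x) = t.+1 * (2 * q * x) by lia.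
by rewrite leq_pmul2l.
Qed.

Lemma core_alive th (A : {set V}) v : above th \subset A -> v \in above th -> th < deg_in A v.
Proof. by move=> tA vA; apply: leq_trans (above_min_degree vA) (deg_in_sub _ tA). Qed.

End Peeling.

(** By Bernoulli's inequality (1 + 1 / 2q) ^ 2q is at least 2, so [2 * q] rounds halve the number of
    vertices and [2 * q * b] rounds bring it from n below 1. *)
Lemma peeling_rounds q b n : 0 < q -> n < 2 ^ b ->
  forall x, (2 * q + 1) ^ (2 * q * b) * x <= (2 * q) ^ (2 * q * b) * n -> x = 0.
Proof.
move=> q0 nb x; rewrite !(expnM _ (2 * q) b) => H.
have B : 2 * (2 * q) ^ (2 * q) <= (2 * q + 1) ^ (2 * q).
  have bern m a : a ^ m * (a + m) <= a * (a + 1) ^ m.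
    elim: m => [|m IH]; first by rewrite !expn0; lia.
    rewrite !expnS; have := leq_mul (leqnn (a + 1)) IH.
    set X := a ^ m; set Y := (a + 1) ^ m; nia.
  have := bern (2 * q) (2 * q); set X := _ ^ _; set Y := (_ + 1) ^ _ => HB.
  by rewrite -(@leq_pmul2l (2 * q)) ?muln_gt0 ?q0 //; clear -HB; lia.
have {B}B : 2 ^ b * ((2 * q) ^ (2 * q)) ^ b <= ((2 * q + 1) ^ (2 * q)) ^ b.
  rewrite -expnMn; case: b {nb H} => [|b']; first by rewrite !expn0.
  by rewrite leq_exp2r.
have P : 0 < ((2 * q) ^ (2 * q)) ^ b by rewrite !expn_gt0 muln_gt0 q0.
set P1 := (_ ^ _) ^ b in P B H; set P2 := (_ ^ _) ^ b in B H.
case: x H => // x H; have : P2 <= P1 * n by apply: leq_trans H; rewrite leq_pmulr.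
move=> /(leq_trans B); rewrite mulnC leq_pmul2l //; lia.
Qed.

(** * One level: all rounds for a fixed threshold *)

Definition round_cost := 100 * 100.

(** The first round examines all remaining vertices, the later ones only those that have just lost a
    neighbour. The number of rounds is fixed, to keep the running time independent of the graph. *)
Definition stage_cmd (q : nat) : hcmd :=
  HSeq (compaction 8 (21@[7@[HP]] == #0) (7@[HP]) 7 8) (
  HSeq (HPar ($8) (#1) 26 HP (7@[HP])) (
  HSeq (HSet 29 ($8)) (
  HSeq (HSet 44 (#2 * $23 + $23 %/ #q)) (
  HSeq (HFor (2 * q) 25 round_cmd)
  (HSet 23 ($23 + $23))))))%H.

Lemma selected_nth (P : nat -> bool) (l : seq nat) :
  selected (fun i => P (nth 0 l i)) (nth 0 l) (size l) = [seq x <- l | P x].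
Proof.
rewrite /selected -(filter_map (nth 0 l) P).
by have := mkseq_nth 0 l; rewrite /mkseq => ->.
Qed.

Lemma size_uniq_psum (l : seq nat) (P : nat -> bool) n :
  uniq l -> (forall v, v \in l -> v < n /\ P v) -> size l <= psum (fun v => P v) n.
Proof.
move=> ul H; rewrite psum_count -size_filter; apply: uniq_leq_size => // v /H[vn Pv].
by rewrite mem_filter mem_iota Pv.
Qed.

Lemma round_units c u k u' k' dR Delta Y b r A :
  u + c * k <= A + 2 * c * dR + r * (c * (Y + b) + 3) ->
  u' <= c * (k + Delta + Y + b) -> k' <= Delta ->
  u + u' + 3 + c * k' <= A + 2 * c * (dR + Delta) + r.+1 * (c * (Y + b) + 3).
Proof.
move=> H1 H2 H3; have : c * k' <= c * Delta by rewrite leq_mul2l H3 orbT.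
by rewrite mulSn; lia.
Qed.

Section Stage.
Variables (mc : config) (n : nat) (off dst : nat -> nat) (e : rel 'I_n) (q : nat).
Hypothesis G : csr mc n off dst.
Local Notation b := (c_b mc).
Local Notation M := (off n).
Local Notation W := (2 ^ c_w mc).
Local Notation deg := (odeg off).
Hypotheses (e_sym : symmetric e) (q_gt0 : 0 < q) (qW : 2 * q < W) (qbW : 2 * q * b + 1 < W)
  (n_lt : n < 2 ^ b)
  (arcsE : forall u v : 'I_n, arcs off dst u v = e u v).
Local Notation core := (coreness e).

(** Isolated vertices are excluded: they are never listed, and their layer stays 0, which is their
    coreness. *)
Definition alive (rem : nat -> nat) : {set 'I_n} :=
  [set v : 'I_n | (0 < deg v) && (rem v == 0)]%SET.

(** Approximation by 2 + 1 / q from below and by 2 from above, cleared of denominators. *)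
Definition layer_ok (v : 'I_n) (x : nat) :=
  q * core v <= (2 * q + 1) * x /\ x <= 2 * core v.

(** For a vertex removed at level t, the second clause implies that its coreness is at most [th],
    and the third that t is at most twice its coreness: these are the two halves of [layer_ok]. *)
Definition peeled (t th : nat) (rem D lay : nat -> nat) :=
  [/\ forall v : 'I_n, D v = deg_in e (alive rem) v,
      above e th \subset alive rem,
      forall v, v \in alive rem -> t <= 2 * core v &
      forall v, v \notin alive rem -> layer_ok v (lay v)].

(** The potential that pays for the rounds; it is at most M. *)
Definition removed_degrees (rem : nat -> nat) :=
  psum (fun v => if rem v == 0 then 0 else deg v) n.

Lemma odegE (u : 'I_n) : deg u = deg_in e [set: 'I_n] u.
Proof.
transitivity (\sum_(v < n) arcs off dst u v).
  rewrite /arcs /psum exchange_big /= -[LHS]card_ord -sum1_card.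
  apply: eq_bigr => -[r rd] _ /=.
  have an : dst (off u + r) < n by apply: (csr_dst_lt G); apply: (slot_lt G).
  rewrite (bigD1 (Ordinal an)) //= eqxx big1 // => v.
  by rewrite -val_eqE /= eq_sym => /negbTE ->.
rewrite /deg_in -sum1_card [RHS]big_mkcond /=; apply: eq_bigr => v _.
by rewrite arcsE !inE /=; case: e.
Qed.

Lemma coreness_le_deg (v : 'I_n) : core v <= deg v.
Proof.
case: (posnP (core v)) => [->//|c0].
have [|S HS vS] := @coreness_witness _ e (core v) v; first by rewrite c0 leqnn.
rewrite odegE; apply: leq_trans (implyP (forallP HS v) vS) _.
by apply: subset_leq_card; apply/fintype.subsetP => u; rewrite !inE => /andP[].
Qed.

Lemma deg_in_alive (rem : nat -> nat) (v : 'I_n) :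
  (forall u : 'I_n, rem u = 0) -> deg_in e (alive rem) v = deg v.
Proof.
move=> r0; rewrite odegE; congr #|pred_of_set _|; apply/setP => u; rewrite !inE r0 eqxx andbT.
case: (boolP (e v u)) => evu; rewrite ?andbF // andbT odegE card_gt0; apply/set0Pn; exists v.
by rewrite !inE e_sym.
Qed.

Section RoundStep.
Variables (t th : nat) (iv : nat -> nat) (k : nat) (rem D lay rem' D' lay' : nat -> nat).
Hypotheses (thE : th = 2 * t + t %/ q)
  (Hpeel : peeled t th rem D lay)
  (Hv : forall i, i < k -> iv i < n /\ 0 < deg (iv i))
  (cover : forall v : 'I_n, v \in alive rem -> D v <= th -> exists2 i, i < k & iv i = v).
Local Notation rmv := (removed iv k th rem D).
Let weight v := psum (fun u => if rmv u then arcs off dst u v else 0) n.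
Hypotheses (D'E : forall v, v < n -> D' v = D v - weight v)
  (rem'E : forall v, v < n -> rem' v = if rmv v then 1 else rem v)
  (lay'E : forall v, v < n -> lay' v = if rmv v then t else lay v).

Lemma removed_alive (v : 'I_n) : rmv v -> v \in alive rem.
Proof.
move=> rv; have [_ d0] := removed_lt Hv rv.
by rewrite inE d0; case/and3P: rv.
Qed.

Lemma alive_round : alive rem' = [set v in alive rem | ~~ rmv v]%SET.
Proof.
apply/setP => v; rewrite !inE rem'E //; case: (boolP (rmv v)) => // rv.
  by rewrite andbF /= andbF.
by rewrite andbT.
Qed.

Lemma removed_iff (v : 'I_n) : rmv v = (v \in alive rem) && (D v <= th).
Proof.
apply/idP/andP => [rv|[vA Dv]]; first by split; [exact: removed_alive | case/and3P: rv].
have [i ik Ei] := cover vA Dv; apply/and3P; split=> //.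
  by apply/hasP; exists i; [rewrite mem_iota | apply/eqP].
by move: vA; rewrite inE => /andP[].
Qed.

Lemma weightE (v : 'I_n) : weight v = deg_in e [set u in alive rem | rmv u]%SET v.
Proof.
rewrite /weight /psum /deg_in -sum1_card [RHS]big_mkcond /=; apply: eq_bigr => u _.
rewrite !inE; case: (boolP (rmv u)) => ru; rewrite ?andbF //= andbT arcsE e_sym.
by have := removed_alive ru; rewrite inE => ->; case: e.
Qed.

Lemma peeled_round : peeled t th rem' D' lay'.
Proof.
case: Hpeel => HD Hth Ht Hl; rewrite /peeled alive_round.
have D'P v : D' (nat_of_ord v) = deg_in e [set v in alive rem | ~~ rmv v]%SET v.
  rewrite D'E // weightE HD /deg_in.
  have -> : [set u in alive rem | e v u]%SET =
    [set u in [set u in alive rem | rmv u]%SET | e v u]%SET :|: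
    [set u in [set v in alive rem | ~~ rmv v]%SET | e v u]%SET.
    by apply/setP => u; rewrite !inE; case: (rmv u); case: (e v u); rewrite ?andbT ?andbF ?orbF.
  rewrite cardsU (_ : _ :&: _ = finset.set0) ?cards0 ?subn0 ?addKn //.
  apply/setP => u; rewrite !inE; case: (rmv u); rewrite /= ?andbF //.
split=> //.
- apply/fintype.subsetP => v vA; rewrite inE (fintype.subsetP Hth) //=.
  by rewrite removed_iff negb_and -ltnNge HD (core_alive Hth vA) orbT.
- by move=> v; rewrite inE => /andP[vA _]; apply: Ht.
- move=> v; rewrite inE negb_and negbK lay'E // => H; case: ifP => rv.
    have vA := removed_alive rv; split; last exact: Ht.
    have ct : core v <= th.
      rewrite leqNgt; apply/negP => H'; have vab : v \in above e th by rewrite inE.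
      by have := core_alive Hth vab; rewrite -HD ltnNge; move: rv; rewrite removed_iff => /andP[_ ->].
    apply: leq_trans (leq_mul (leqnn q) ct) _; rewrite thE mulnDr.
    by have := leq_trunc_div t q; lia.
  by apply: Hl; case/orP: H => //; rewrite rv.
Qed.

Lemma round_shrinks :
  (2 * q + 1) * #|alive rem' :\: above e t| <= 2 * q * #|alive rem :\: above e t|.
Proof.
have Hth : 2 * q * t + t <= q * th.+1.
  by rewrite thE; have := ltn_ceil t q_gt0; rewrite !mulSn !mulnS; lia.
apply: leq_trans (high_degree_count e_sym (alive rem) Hth).
rewrite leq_mul2l; apply/orP; right; apply: subset_leq_card.
apply/fintype.subsetP => v; case: Hpeel => HD _ _ _.
rewrite finset.in_setD => /andP[vt]; rewrite alive_round finset.in_set => /andP[vA].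
by rewrite removed_iff vA /= -ltnNge HD => Dv; rewrite finset.in_set finset.in_setD vt vA Dv.
Qed.

(** A vertex without removed neighbour keeps its degree; if this is at most [th], the vertex itself
    was removed in this round. *)
Lemma cover_round (v : 'I_n) : v \in alive rem' -> D' v <= th -> 0 < weight v.
Proof.
move=> vA Dv; rewrite lt0n; apply/eqP => w0; move: vA Dv.
rewrite alive_round inE D'E // w0 subn0 removed_iff => /andP[->].
by move=> /= /negbTE ->.
Qed.

End RoundStep.

Lemma removed_degrees_round (iv : nat -> nat) k th (rem D rem' : nat -> nat) :
  (forall v, v < n -> rem' v = if removed iv k th rem D v then 1 else rem v) ->
  removed_degrees rem' = removed_degrees rem +
    psum (fun v => if removed iv k th rem D v then deg v else 0) n.
Proof.
move=> H; rewrite /removed_degrees -psumD; apply: psum_ext => v vn; rewrite H //.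
case: (boolP (removed iv k th rem D v)) => rv; last by rewrite addn0.
by case/and3P: (rv) => _ /eqP-> _.
Qed.

Variable tw : nat -> nat.
Hypothesis Htw : twins n off dst tw.

Definition listed (s : store) (l : seq nat) :=
  [/\ s 8 0 = size l, forall j, j < size l -> s 7 j = nth 0 l j, uniq l,
      forall v, v \in l -> v < n /\ 0 < deg v &
      forall v : 'I_n, v \in alive (s 21) -> (v : nat) \in l].

Lemma hoare_stage s t0 T l :
  s 0 0 = b -> s 23 0 = T -> 4 * T < W -> listed s l ->
  (forall a, a < M -> s 19 a = (tw a).+1) ->
  peeled T (2 * T + T %/ q) (s 21) (s 20) (s 22) ->
  hoare mc (stage_cmd q) s t0 (fun s' u =>
    [/\ frame (iota 1 3 ++ iota 6 8 ++ iota 20 4 ++ iota 25 20) s s',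
        s' 23 0 = 2 * T /\ (forall v : 'I_n, v \in alive (s' 21) -> T < core v),
        exists2 l', listed s' l' & {subset l' <= [seq v <- l | s 21 v == 0]} /\
          removed_degrees (s 21) <= removed_degrees (s' 21) /\
          u <= 300 * (size l + b) + 20 + round_cost * size l' +
            2 * round_cost * (removed_degrees (s' 21) - removed_degrees (s 21)) +
            2 * q * b * (round_cost * (M %/ (b * b) + b) + 3) &
        peeled (2 * T) (2 * (2 * T) + (2 * T) %/ q) (s' 21) (s' 20) (s' 22)]).
Proof.
move=> sb sT TW [s8 s7 ul ln la] stw Hpeel.
have b0 := c_b_gt0 mc; have [lM lW lb] := csr_bounds G; have HB := csr_base G.
have xge : c_len mc <= c_ext mc by have := c_ext_ge mc; rewrite /NA; lia.
have lge := c_len_ge mc; have clen := csr_len G; have blen := c_b_len mc.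
pose L := iota 1 3 ++ iota 6 8 ++ iota 20 4 ++ iota 25 20.
set th := 2 * T + T %/ q in Hpeel *.
have th3 : th <= 3 * T by rewrite /th; have := leq_div T q; lia.
have thW : th < W by clear -th3 TW; lia.
have TW' : T < W by clear -TW; lia.
have nW : n < W by clear -lM lW; lia.
set rem := s 21 in la Hpeel *.
pose ll := [seq v <- l | rem v == 0].
have sl : size l <= n.
  rewrite -(size_iota 0 n); apply: uniq_leq_size => // v /ln[vn _]; rewrite mem_iota //.
have ull : uniq ll by rewrite filter_uniq.
have lln v : v \in ll -> v < n /\ 0 < deg v by rewrite mem_filter => /andP[_ /ln].
have sll : size ll <= size l by rewrite size_filter count_size.
have l7 (s' : store) i : frame [:: 1; 2; 3; 6] s s' -> i < size l -> s' 7 i = nth 0 l i.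
  by move=> F' il; rewrite F' // s7.
have nln i : i < size l -> nth 0 l i < n by move=> il; have [] := ln _ (mem_nth 0 il).
apply: hoare_seq; apply: hoare_conseq.
  apply: (@hoare_compaction mc (fun i => rem (nth 0 l i) == 0) (nth 0 l) 8 _ (7@[HP])%H 7 8 s _ (size l)) => //; first by lia.
  - move=> s' i F' il; have := nln i il => vn.
    rewrite /= (l7 s' i F' il) F' //; split; first by repeat split; lia.
    by rewrite nat_of_bool_neq0; split=> //; case: eqP.
  - by move=> s' i F' il _; rewrite /= (l7 s' i F' il); split=> //; split=> //; lia.
rewrite (selected_nth (fun v => rem v == 0)) -/ll => s1 u1 [F1 s1n s1l Hu1].
have s1b : s1 0 0 = b by rewrite F1.
have F1' : frame L s s1 by apply: (frame_transb (L1 := [::])) F1.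
apply: hoare_seq; apply: hoare_map => //=; rewrite ?s1n.
- by repeat split; lia.
- by lia.
- by move=> i il; split; [lia | move=> _; repeat split; lia].
move=> iv Hiv; have ivE i : i < size ll -> iv i = nth 0 ll i by move=> il; rewrite Hiv il /= s1l.
set s2 := upd s1 26 iv.
have F2 : frame L s s2 by apply: frame_upd.
have s2n : s2 8 0 = size ll by [].
have s2v : s2 26 = iv by [].
have s2l j : j < size ll -> s2 7 j = nth 0 ll j by exact: s1l.
have s2D : s2 20 = s 20 by exact: (F1 20 isT).
have s2R : s2 21 = rem by exact: (F1 21 isT).
have s2L : s2 22 = s 22 by exact: (F1 22 isT).
have s2T : s2 23 0 = T by rewrite -sT -(F1 23 isT).
clearbody s2.
apply: hoare_seq; apply: hoare_set => //=; first by repeat split; lia.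
rewrite s2n; set s3 := upd s2 29 _.
have F3 : frame L s s3 by apply: frame_upd.
have s3k : s3 29 0 = size ll by [].
have s3n : s3 8 0 = size ll by [].
have s3v : s3 26 = iv by [].
have s3l j : j < size ll -> s3 7 j = nth 0 ll j by exact: s2l.
have s3D : s3 20 = s 20 by [].
have s3R : s3 21 = rem by [].
have s3L : s3 22 = s 22 by [].
have s3T : s3 23 0 = T by [].
clearbody s3.
apply: hoare_seq; apply: hoare_set => //=.
  by rewrite s3T; have := leq_div T q; repeat split; lia.
rewrite s3T -/th; set s4 := upd s3 44 _.
have F4 : frame L s s4 by apply: frame_upd.
have s4k : s4 29 0 = size ll by [].
have s4n : s4 8 0 = size ll by [].
have s4v : s4 26 = iv by [].
have s4l j : j < size ll -> s4 7 j = nth 0 ll j by exact: s3l.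
have s4D : s4 20 = s 20 by [].
have s4R : s4 21 = rem by [].
have s4L : s4 22 = s 22 by [].
have s4T : s4 23 0 = T by [].
have s4th : s4 44 0 = th by [].
have s4b : s4 0 0 = b by rewrite F4.
have s4tw : s4 19 = s 19 by rewrite F4.
clearbody s4.
pose LR := [:: 1; 2; 3; 6] ++ iota 9 5 ++ iota 20 3 ++ iota 25 19.
set cR := round_cost.
(* The term [cR * s' 29 0] is the reserve of [round_units]. The powers of [2 * q + 1] and [2 * q]
   record the geometric decrease of the low vertices without division. *)
pose I r (s' : store) u := [/\ frame LR s4 s', peeled T th (s' 21) (s' 20) (s' 22),
  (forall i, i < s' 29 0 -> s' 26 i < n /\ 0 < deg (s' 26 i)) /\ s' 29 0 <= n + M,
  (forall v : 'I_n, v \in alive (s' 21) -> s' 20 v <= th -> exists2 i, i < s' 29 0 & s' 26 i = v) /\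
  (2 * q + 1) ^ r * #|alive (s' 21) :\: above e T| <= (2 * q) ^ r * n /\
  alive (s' 21) \subset alive rem &
  removed_degrees rem <= removed_degrees (s' 21) /\
  u + cR * s' 29 0 <= 2 + cR * size ll +
    2 * cR * (removed_degrees (s' 21) - removed_degrees rem) +
    r * (cR * (M %/ (b * b) + b) + 3)].
apply: hoare_seq; apply: (@hoare_for mc I) => //=.
- split.
  + exact: frame_upd.
  + by rewrite /upd /= s4D s4R s4L.
  + rewrite /upd /= s4k s4v; split=> [i il|]; last by lia.
    by rewrite ivE //; apply: lln; rewrite mem_nth.
  + rewrite /upd /= s4k s4v s4R; split; last split=> //.
      move=> v vA _; have vl : (v : nat) \in ll.
        by rewrite mem_filter (la v vA) andbT; move: vA; rewrite inE => /andP[].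
      by exists (index (v : nat) ll); rewrite ?index_mem // ivE ?index_mem // nth_index.
    rewrite !expn0 !mul1n; apply: leq_trans (max_card _) _; by rewrite card_ord.
  + by rewrite /upd /= s4k s4R subnn muln0 mul0n !addn0.
- move=> r s5 t5 u5 rL s5r s5b [F5 P5 [v5 k5] [c5 [sh5 al5]] [R5 U5]].
  have s5T : s5 23 0 = T by rewrite F5.
  have s5th : s5 44 0 = th by rewrite F5.
  have D5 v : v < n -> s5 20 v < W.
    move=> vn; case: P5 => /(_ (Ordinal vn)) /= -> _ _ _.
    by apply: leq_ltn_trans (max_card _) _; rewrite card_ord.
  apply: hoare_conseq.
    apply: (hoare_round G k5 v5 _ _ Htw _ s5b erefl erefl erefl erefl erefl s5T s5th _ D5) => //.
    by rewrite F5 // s4tw.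
  move=> s6 u6 [F6 s6P [s6k s6v] s6c Hu6].
  have D'E v : v < n -> s6 20 v = s5 20 v - psum (fun u => if removed (s5 26) (s5 29 0) th (s5 21) (s5 20) u then arcs off dst u v else 0) n.
    by move=> vn; have [] := s6P v vn.
  have rem'E v : v < n -> s6 21 v = if removed (s5 26) (s5 29 0) th (s5 21) (s5 20) v then 1 else s5 21 v.
    by move=> vn; have [] := s6P v vn.
  have lay'E v : v < n -> s6 22 v = if removed (s5 26) (s5 29 0) th (s5 21) (s5 20) v then T else s5 22 v.
    by move=> vn; have [] := s6P v vn.
  have RD := removed_degrees_round rem'E.
  set Delta := psum _ n in RD s6k Hu6.
  split; [by rewrite F6 | by rewrite F6 | ].
  split; rewrite /upd /=.
  + apply: frame_upd => //; exact: frame_transb F5 F6.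
  + exact: (peeled_round erefl P5 v5 c5 D'E rem'E lay'E).
  + split=> //; apply: leq_trans s6k _; apply: leq_trans (Delta_le G (s5 26) (s5 29 0) th (s5 21) (s5 20)) _; lia.
  + split; last split.
    * move=> v vA Dv; apply: s6c => //; exact: (cover_round v5 c5 D'E rem'E vA Dv).
    * have := round_shrinks erefl P5 v5 c5 rem'E; rewrite !expnS.
      move: sh5; set y := #|_|; set y' := #|_|; set p := _ ^ r; set p' := (2 * q) ^ r => H1 H2.
      rewrite -(mulnA (2 * q + 1)) mulnCA -(mulnA (2 * q)).
      by apply: leq_trans (leq_mul (leqnn p) H2) _; rewrite mulnCA leq_mul2l H1 orbT.
    * apply: fintype.subset_trans al5; rewrite (alive_round rem'E).
      by apply/fintype.subsetP => v; rewrite inE => /andP[].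
  + rewrite RD; split; first by apply: leq_trans R5 _; rewrite leq_addr.
    have Hu6' : u6 <= cR * (s5 29 0 + Delta + M %/ (b * b) + b).
      by apply: leq_trans Hu6 _; rewrite mulnA.
    have -> : removed_degrees (s5 21) + Delta - removed_degrees rem =
      (removed_degrees (s5 21) - removed_degrees rem) + Delta by rewrite addnBAC.
    exact: round_units U5 Hu6' s6k.
move=> s5 u5 s5r s5b [F5 P5 [v5 k5] [c5 [sh5 al5]] [R5 U5]].
have low0 : #|alive (s5 21) :\: above e T| = 0 by apply: (peeling_rounds q_gt0 n_lt).
have hi v : v \in alive (s5 21) -> T < core v.
  move=> vA; rewrite ltnNge; apply/negP => vT; move/eqP: low0; rewrite cards_eq0 => /eqP/setP/(_ v).
  by rewrite !inE -leqNgt vT /=; move: vA; rewrite inE => ->.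
have s5T : s5 23 0 = T by rewrite F5.
apply: hoare_set => //=.
  by rewrite s5T; repeat split=> //; clear -TW lge; lia.
rewrite s5T; split.
- apply: frame_upd => //; exact: frame_transb F4 F5.
- by rewrite /upd /= addnn -mul2n.
- exists ll; rewrite /upd /=; last split=> //; last split=> //.
  + split=> //=; first by rewrite F5.
      by move=> j jl; rewrite F5 // s4l.
    move=> v /(fintype.subsetP al5) vA; rewrite mem_filter (la v vA) andbT.
    by move: vA; rewrite inE => /andP[].
  + move: (M %/ (b * b)) U5 => Y U5; rewrite -/cR.
    have {}U5 := leq_trans (leq_addr _ _) U5.
    move: U5; set Z := 2 * q * b * _; set Z' := 2 * cR * _; set Z2 := cR * _ => U5.
    clearbody Z Z' Z2; clear -U5 Hu1 sll b0; lia.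
- rewrite /upd /=; case: P5 => P5a P5b P5c P5d; split=> //.
  + apply: fintype.subset_trans P5b; apply/fintype.subsetP => v; rewrite !inE; apply: leq_ltn_trans.
    rewrite /th leq_add //; last by apply: leq_div2r; rewrite leq_pmull.
    by rewrite leq_mul2l leq_pmull.
  + by move=> v /hi; move: (core v) => x; clear; lia.
Qed.

End Stage.

(** * All levels together *)

Definition peel_cmd (q : nat) : hcmd :=
  HSeq (HPar (HI #0) (#1) 20 HP (hdeg HP)) (
  HSeq (HSet 23 (#1)) (HFor 2 24 (stage_cmd q)))%H.

Section Peel.
Variables (mc : config) (n : nat) (off dst : nat -> nat) (e : rel 'I_n) (q : nat).
Hypothesis G : csr mc n off dst.
Local Notation b := (c_b mc).
Local Notation M := (off n).
Local Notation W := (2 ^ c_w mc).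
Local Notation deg := (odeg off).
Hypotheses (e_sym : symmetric e) (q_gt0 : 0 < q) (qW : 2 * q < W) (qbW : 2 * q * b + 1 < W)
  (n_lt : n < 2 ^ b)
  (arcsE : forall u v : 'I_n, arcs off dst u v = e u v).
Local Notation core := (coreness e).
Variable tw : nat -> nat.
Hypothesis Htw : twins n off dst tw.

Let bnd i := psum (fun v => (i <= deg v : bool)) n.

(** Exchange of sums: v is counted at most [deg v + 1] times. A vertex alive at the start of level
    [2 ^ i] has degree at least i, so this bounds the total length of the lists over all levels. *)
Lemma sum_bnd m : psum bnd m <= n + M.
Proof.
rewrite /bnd exchange_psum -(psum_deg G (leqnn n)).
have n1 : psum (fun=> 1) n = n by rewrite /psum sum1_card card_ord.
rewrite -{2}n1 -psumD; apply: leq_psum_fun => v _.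
elim: m => [|m IH]; first by rewrite psum0.
rewrite psumS; case: (leqP m (deg v)) => H /=; last by rewrite addn0.
apply: leq_trans (_ : m + 1 <= _); last by lia.
by rewrite leq_add2r; apply: psum_bool_le.
Qed.

Lemma sum_bnd_pred m : psum (fun i => bnd i.-1) m <= 2 * n + M.
Proof.
case: m => [|m]; first by rewrite psum0.
have -> : psum (fun i => bnd i.-1) m.+1 = bnd 0 + psum bnd m.
  by rewrite /psum big_ord_recl.
have : bnd 0 <= n by apply: psum_bool_le.
by have := sum_bnd m; lia.
Qed.

Lemma psum_affine f g x y z m :
  psum (fun j => x * f j + y * g j + z) m = x * psum f m + y * psum g m + m * z.
Proof. by rewrite /psum !big_split /= -!big_distrr sum_nat_const card_ord. Qed.

Lemma peeled_init (rem D lay : nat -> nat) th :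
  (forall v, v < n -> rem v = 0) -> (forall v, v < n -> D v = deg v) ->
  (forall v, v < n -> lay v = 0) -> peeled off e q 1 th rem D lay.
Proof.
move=> r0 D0 l0; have dA (v : 'I_n) := deg_in_alive G e_sym arcsE v (fun u : 'I_n => r0 u (ltn_ord u)).
have mA : min_degree_geq e 1 (alive n off rem).
  by apply/forallP => v; apply/implyP => vA; have := dA v; rewrite /deg_in => ->;
     move: vA; rewrite inE => /andP[].
split.
- by move=> v; rewrite D0 // dA.
- apply/fintype.subsetP => v; rewrite !inE r0 // eqxx andbT => H.
  by apply: leq_trans (coreness_le_deg G arcsE v); lia.
- by move=> v vA; have := coreness_geq mA vA; lia.
- move=> v; rewrite inE r0 // eqxx andbT -eqn0Ngt => /eqP d0.
  have := coreness_le_deg G arcsE v; rewrite d0 leqn0 => /eqP c0.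
  by split; rewrite c0 ?l0 // muln0.
Qed.

Lemma hoare_peel s t l :
  s 0 0 = b -> listed n off s l -> 4 * 2 ^ (2 * b) < W ->
  (forall v, v < n -> s 21 v = 0) -> (forall v, v < n -> s 22 v = 0) ->
  (forall a, a < M -> s 19 a = (tw a).+1) ->
  hoare mc (peel_cmd q) s t (fun s' u =>
    (forall v : 'I_n, layer_ok e q v (s' 22 v)) /\
    u <= 10 * q.+1 * round_cost * (n + M + b ^ 3)).
Proof.
move=> sb Hl HW sR sL stw.
have b0 := c_b_gt0 mc; have [lM lW lb] := csr_bounds G; have HB := csr_base G.
have xge : c_len mc <= c_ext mc by have := c_ext_ge mc; rewrite /NA; lia.
have lge := c_len_ge mc; have clen := csr_len G; have blen := c_b_len mc.
have inp0 := csr_n G.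
apply: hoare_seq; apply: hoare_map => //=; rewrite ?inp0.
- by split; [lia | rewrite HB; lia].
- by lia.
- by move=> i il; split; [lia | move=> _; repeat split; lia].
move=> D HD; have DE v : v < n -> D v = deg v.
  by move=> vn; rewrite HD vn /= (csr_offSS G vn) (csr_offS G (ltnW vn)).
set s1 := upd s 20 D.
have l1 : listed n off s1 l by [].
have s1D : s1 20 = D by [].
have s1R : s1 21 = s 21 by [].
have s1L : s1 22 = s 22 by [].
have s1tw : s1 19 = s 19 by [].
have s1b : s1 0 0 = b by [].
clearbody s1.
apply: hoare_seq; apply: hoare_set => //=; first by lia.
set s2 := upd s1 23 _.
have l2 : listed n off s2 l by [].
have s2D : s2 20 = D by [].
have s2R : s2 21 = s 21 by [].
have s2L : s2 22 = s 22 by [].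
have s2tw : s2 19 = s 19 by [].
have s2b : s2 0 0 = b by [].
have s2T : s2 23 0 = 1 by [].
clearbody s2.
set cR := round_cost.
pose K := 300 * b + 23 + 2 * q * b * (cR * (M %/ (b * b) + b) + 3).
pose I i (s' : store) u := [/\ s' 23 0 = 2 ^ i, s' 19 = s 19,
  peeled off e q (2 ^ i) (2 * 2 ^ i + 2 ^ i %/ q) (s' 21) (s' 20) (s' 22),
  (forall v : 'I_n, v \in alive n off (s' 21) -> 2 ^ i <= 2 * core v) /\
  (0 < i -> forall v : 'I_n, v \in alive n off (s' 21) -> 2 ^ i < 2 * core v) &
  exists2 l', listed n off s' l' & size l' <= bnd i.-1 /\
    u <= 2 + psum (fun j => 300 * bnd j.-1 + cR * bnd j + K) i +
      2 * cR * removed_degrees n off (s' 21)].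
apply: (@hoare_for mc I) => //=; try lia.
- split; rewrite /upd /=.
  + by [].
  + by [].
  + by rewrite s2D s2R s2L; apply: peeled_init.
  + split=> // v vA; have [_ _ H _] : peeled off e q 1 1 (s 21) D (s 22) by apply: peeled_init.
    by rewrite s2R in vA; exact: H.
  + exists l => //; split; last by lia.
    case: l2 => _ _ ul ln _; apply: size_uniq_psum => // v /ln[vn _].
    by rewrite vn.
- move=> i s3 t3 u3 ib s3i s3b [s3T s3tw P3 [_ hi3] [l3 L3 [sl3 Hu3]]].
  apply: hoare_conseq.
    apply: (hoare_stage G e_sym q_gt0 qW qbW n_lt arcsE Htw t3 s3b s3T _ L3 _ P3).
      by apply: leq_ltn_trans HW; rewrite leq_mul2l leq_exp2l // ltnW.
    by rewrite s3tw.
  move=> s4 u4 [F4 [s4T hi4] [l4 L4 [sub4 [R4 Hu4]]] P4].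
  split; [by rewrite F4 | by rewrite F4 |].
  (* For positive i, a vertex alive at the start of level [2 ^ i] has coreness, hence degree, more
     than [2 ^ i.-1], which is at least i. *)
  have sl4 : size l4 <= bnd i.
    case: L4 => _ _ ul4 ln4 _; apply: size_uniq_psum => // v vl.
    have [vn d0] := ln4 v vl; split=> //.
    have := sub4 v vl; rewrite mem_filter => /andP[/eqP r0 _].
    have vA : Ordinal vn \in alive n off (s3 21) by rewrite inE d0 r0 eqxx.
    case: i {ib s3i P3 hi4 Hu4 sl3 Hu3 s4T P4} hi3 s3T => // i hi3 s3T.
    have := hi3 isT _ vA; have := coreness_le_deg G arcsE (Ordinal vn).
    rewrite /= expnS ltn_mul2l /= => H1 H2.
    have H3 := ltn_expl i (isT : 1 < 2).
    by lia.
  split; rewrite /upd /=.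
  + by rewrite s4T expnS.
  + by rewrite F4.
  + by rewrite expnS.
  + split=> [v vA|_ v vA]; have := hi4 v vA; rewrite ?expnS; lia.
  + exists l4; first exact: L4.
    split; first exact: sl4.
    rewrite psumS; move: Hu3 Hu4; set P := psum _ i; rewrite /K -/cR.
    set Z := 2 * q * b * _.
    have : cR * size l4 <= cR * bnd i by rewrite leq_mul2l sl4 orbT.
    have : 300 * size l3 <= 300 * bnd i.-1 by rewrite leq_mul2l sl3 orbT.
    have -> : 2 * cR * removed_degrees n off (s4 21) =
      2 * cR * (removed_degrees n off (s4 21) - removed_degrees n off (s3 21)) +
      2 * cR * removed_degrees n off (s3 21) by rewrite -mulnDr subnK.
    by clear; lia.
move=> s3 u3 s3i s3b [s3T s3tw P3 [_ hi3] [l3 L3 [sl3 Hu3]]]; split.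
(* A vertex alive after [2 * b] levels would have coreness more than 2 ^ (2 b - 1), but its degree
   is at most n < 2 ^ b. *)
- move=> v; case: P3 => _ _ _; apply; apply/negP => vA.
  have := hi3 _ v vA; have := coreness_le_deg G arcsE v.
  have dn : deg v <= n by rewrite (odegE G arcsE); apply: leq_trans (max_card _) _; rewrite card_ord.
  have : 2 ^ b <= 2 ^ (2 * b).-1 by rewrite leq_exp2l //; lia.
  have -> : 2 ^ (2 * b) = 2 * 2 ^ (2 * b).-1 by rewrite -expnS prednK //; lia.
  by move=> H1 H2 /(_ ltac:(lia)); lia.
- have RM : removed_degrees n off (s3 21) <= M.
    rewrite -(psum_deg G (leqnn n)); apply: leq_psum_fun => v _; by case: ifP.
  have E : psum (fun j => 300 * bnd j.-1 + cR * bnd j + K) (2 * b) =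
     300 * psum (fun j => bnd j.-1) (2 * b) + cR * psum bnd (2 * b) + 2 * b * K.
    exact: psum_affine.
  have S1 := sum_bnd (2 * b); have S2 := sum_bnd_pred (2 * b).
  have cRge : 1000 <= cR by rewrite /cR /round_cost -[1000]/(10 * 100) leq_mul2r.
  clearbody cR.
  (* There are [4 * q * b * b] rounds in all, each scanning O(M / b^2) block cells: this is where
     merging blocks of length b^2 pays off. *)
  have Y : b * b * (M %/ (b * b)) <= M by rewrite mulnC leq_trunc_div.
  have b3 : b * b <= b ^ 3 by rewrite mulnn leq_pexp2l.
  have b1 : b <= b ^ 3 by rewrite -{1}(expn1 b) leq_pexp2l.
  have KE : 2 * b * K = 600 * (b * b) + 46 * b + 4 * q * cR * (b * b * (M %/ (b * b))) +
     4 * q * cR * b ^ 3 + 12 * q * (b * b).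
    by rewrite /K !expnS expn0; lia.
  rewrite E KE in Hu3; clear E KE.
  have T1 : cR * psum bnd (2 * b) <= cR * (n + M) by rewrite leq_mul2l S1 orbT.
  have T2 : 4 * q * cR * (b * b * (M %/ (b * b))) <= 4 * q * cR * M by rewrite leq_mul2l Y orbT.
  have T3 : 2 * cR * removed_degrees n off (s3 21) <= 2 * cR * M by rewrite leq_mul2l RM orbT.
  have T4 : 1000 * (n + M + b ^ 3) <= cR * (n + M + b ^ 3) by rewrite leq_mul2r cRge orbT.
  have T5 : 12 * q * (b * b) <= q * cR * b ^ 3.
    by apply: leq_mul => //; rewrite mulnC leq_mul2l; lia.
  have -> : 10 * q.+1 * cR * (n + M + b ^ 3) = 10 * (q * cR * n) + 10 * (q * cR * M) +
     10 * (q * cR * b ^ 3) + 10 * (cR * (n + M + b ^ 3)) by lia.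
  have T6 : 4 * q * cR * M = 4 * (q * cR * M) by lia.
  have T7 : 4 * q * cR * b ^ 3 = 4 * (q * cR * b ^ 3) by lia.
  have T8 : 2 * cR * M = 2 * (cR * M) by lia.
  have b1' : 0 < b ^ 3 by rewrite expn_gt0 b0.
  rewrite T6 in T2; rewrite T8 in T3; rewrite T7 in Hu3; rewrite mulnDr in T1.
  rewrite !mulnDr in T4 *.
  clear -Hu3 T1 T2 T3 T4 T5 S2 b3 b1 b1'; lia.
Qed.

End Peel.

Lemma frame_widen L1 L s s' : all [in L] L1 -> frame L1 s s' -> frame L s s'.
Proof. by move=> /allP S F a Ha; rewrite F //; apply: contraNN Ha; apply: S. Qed.

(** * Finding reverse arcs by hashing *)

Definition hkey (e : hexpr) : hexpr :=
  (HIf (14@[e] < hdst e) (14@[e] * HI #0 + hdst e) (hdst e * HI #0 + 14@[e]))%H.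

Definition hhash (e : hexpr) : hexpr := (HB ODiv (HM OMul ($17) (hkey e)) ($45))%H.

(** The key depends on the unordered edge only, so an arc and its twin share a bucket, in which one
    arc wins the write. If the winner is the twin of the reader, the reader records it; the twin has
    found itself in the bucket, and is informed in the next step. Old contents of array 18 do no
    harm, as a bucket that is read has just been written. *)
Definition hash_round : hcmd :=
  HSeq (HSeed 17) (
  HSeq (HPar ($16) (#1) 18 (hhash (15@[HP])) (15@[HP])) (
  HSeq (HPar ($16) ((14@[18@[hhash (15@[HP])]] == hdst (15@[HP])) &&
                    (hdst (18@[hhash (15@[HP])]) == 14@[15@[HP]]))
         19 (15@[HP]) (18@[hhash (15@[HP])] + #1)) (
  HSeq (HPar ($16) (19@[15@[HP]] != #0) 19 (19@[15@[HP]] - #1) (15@[HP] + #1))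
  (compaction 16 (19@[15@[HP]] == #0) (15@[HP]) 15 16))))%H.

Section Hash.
Variables (mc : config) (n : nat) (off dst src tw : nat -> nat) (Dv : nat).
Hypothesis G : csr mc n off dst.
Local Notation b := (c_b mc).
Local Notation M := (off n).
Local Notation W := (2 ^ c_w mc).
Hypotheses (src_lt : forall a, a < M -> src a < n)
  (simple : forall a a', a < M -> a' < M -> src a = src a' -> dst a = dst a' -> a = a')
  (noloop : forall a, a < M -> src a != dst a)
  (tw_lt : forall a, a < M -> tw a < M)
  (src_tw : forall a, a < M -> src (tw a) = dst a)
  (dst_tw : forall a, a < M -> dst (tw a) = src a)
  (D_gt0 : 0 < Dv) (D_len : W <= Dv * c_len mc).

Definition key (a : nat) :=
  if src a < dst a then src a * n + dst a else dst a * n + src a.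

Definition hash (z a : nat) := (z * key a %% W) %/ Dv.

Definition collides (z a : nat) :=
  has (fun a' => (key a' != key a) && (hash z a' == hash z a)) (iota 0 M).

Lemma dst_lt a : a < M -> dst a < n. Proof. exact: (csr_dst_lt G). Qed.

Lemma twK a : a < M -> tw (tw a) = a.
Proof.
by move=> aM; apply: simple; rewrite ?tw_lt // ?src_tw ?dst_tw ?tw_lt // ?src_tw ?dst_tw.
Qed.

Lemma key_lt a : a < M -> key a < n * n.
Proof.
clear D_gt0 D_len => aM; rewrite /key; have := src_lt aM; have := dst_lt aM.
by case: ifP => _; nia.
Qed.

Lemma key_tw a : a < M -> key (tw a) = key a.
Proof.
move=> aM; rewrite /key src_tw // dst_tw //.
by have := noloop aM; case: ltngtP.
Qed.

Lemma key_eq a a' : a < M -> a' < M -> key a = key a' -> a' = a \/ a' = tw a.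
Proof.
move=> aM aM'; rewrite /key.
have E x y x' y' : y < n -> y' < n -> x * n + y = x' * n + y' -> x = x' /\ y = y'.
  by move=> yn yn' E; have := congr1 (divn^~ n) E; have := congr1 (modn^~ n) E;
     rewrite !modnMDl !divnMDl ?divn_small ?modn_small ?addn0; lia.
have [[[sa da] sa'] da'] := (src_lt aM, dst_lt aM, src_lt aM', dst_lt aM').
case: ifP => _; case: ifP => _ EE.
- by have [E1 E2] := E _ _ _ _ da da' EE; left; apply: simple.
- by have [E1 E2] := E _ _ _ _ da sa' EE; right; apply: simple; rewrite ?tw_lt ?src_tw ?dst_tw.
- by have [E1 E2] := E _ _ _ _ sa da' EE; right; apply: simple; rewrite ?tw_lt ?src_tw ?dst_tw.
- by have [E1 E2] := E _ _ _ _ sa sa' EE; left; apply: simple.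
Qed.

Lemma hash_lt z a : hash z a < c_len mc.
Proof.
by rewrite /hash ltn_divLR //; apply: leq_trans (ltn_pmod _ (W_gt0 mc)) _; rewrite mulnC.
Qed.

(** By the last clause an arc and its twin are resolved in the same round, so both or none of them
    compete for a bucket. The bound on array 18 makes its entries valid arcs. *)
Definition hash_inv (s : store) (l : seq nat) :=
  [/\ s 0 0 = b, s 45 0 = Dv, forall a, a < M -> s 14 a = src a,
      forall j, s 18 j = 0 \/ s 18 j < M &
  [/\ s 16 0 = size l /\ forall j, j < size l -> s 15 j = nth 0 l j, uniq l,
      forall a, (a \in l) = (a < M) && (s 19 a == 0),
      forall a, a < M -> s 19 a = 0 \/ s 19 a = (tw a).+1 &
      forall a, a < M -> (s 19 (tw a) == 0) = (s 19 a == 0)]].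

Lemma den_hhash s i e z a :
  (forall a, a < M -> s 14 a = src a) -> s 45 0 = Dv -> s 17 0 = z -> z < W ->
  safe mc s i e -> den mc s i e = a -> a < M ->
  safe mc s i (hhash e) /\ den mc s i (hhash e) = hash z a.
Proof.
move=> s14 s45 s17 zW Se De aM.
have [lM lW lb] := csr_bounds G; have HB := csr_base G; have HL := c_lenW mc.
have sn := src_lt aM; have dn := dst_lt aM.
have nn : n * n <= c_len mc * c_len mc by apply: leq_mul; lia.
have inp0 := csr_n G; have inpd := csr_dst G aM.
have Xn x : x < n -> x * n < W.
  move=> xn; have H : x * n <= n * n by rewrite leq_mul2r (ltnW xn) orbT.
  by clear -H xn nn HL lM; lia.
have Xnn x y : x < n -> y < n -> x * n + y < W.
  move=> xn yn; have H : x.+1 * n <= n * n by rewrite leq_mul2r xn orbT.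
  by clear -H yn nn HL; lia.
have H14 : s 14 (den mc s i e) = src a by rewrite De s14.
have Hd : c_inp mc (c_inp mc 0 + 2 + den mc s i e) = dst a by rewrite inp0 De.
split; last first.
  rewrite /hash /key /= Hd H14 s45 s17 inp0.
  by case: (src a < dst a).
rewrite /= Hd H14 inp0 De HB.
do ! split=> //; try lia; try exact: Xn; try exact: Xnn.
Qed.

Lemma hoare_hash_round s t l : 0 < M -> hash_inv s l ->
  hoare mc hash_round s t (fun s' u =>
    frame [:: 1; 2; 3; 6; 15; 16; 17; 18; 19] s s' /\
    exists2 l', hash_inv s' l' &
      [/\ {subset l' <= l}, forall a, a \in l' -> collides (c_rnd mc (t + 1) 0) a &
          u <= 300 * (size l + b)]).
Proof.
move=> M0 [sb s45 s14 s18 [[s16 s15] ul lE s19 s19t]].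
have b0 := c_b_gt0 mc; have [lM lW lb] := csr_bounds G; have HB := csr_base G.
have xge : c_len mc <= c_ext mc by have := c_ext_ge mc; rewrite /NA; lia.
have lge := c_len_ge mc; have inp0 := csr_n G.
set z := c_rnd mc (t + 1) 0; have zW : z < W := c_rndW mc _ _.
set k := size l.
have lM' a : a \in l -> a < M by rewrite lE => /andP[].
have kM : k <= M.
  by rewrite -(size_iota 0 M); apply: uniq_leq_size => // a /lM'; rewrite mem_iota.
have nM i : i < k -> nth 0 l i < M by move=> ik; apply: lM'; rewrite mem_nth.
apply: hoare_seq; apply: hoare_seed => //; first by lia.
rewrite -/z; set s1 := upd s 17 _.
have s1z : s1 17 0 = z by [].
have s1_14 a : a < M -> s1 14 a = src a by exact: s14.
have s1_15 j : j < k -> s1 15 j = nth 0 l j by exact: s15.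
have s1_16 : s1 16 0 = k by [].
have s1_45 : s1 45 0 = Dv by [].
have s1_18 : s1 18 = s 18 by [].
have s1_19 : s1 19 = s 19 by [].
have F1 : frame [:: 17] s s1 by apply: frame_upd.
clearbody s1.
have HH i (s' : store) : frame [:: 18; 19] s1 s' -> i < k ->
  safe mc s' i (hhash (15@[HP])%H) /\ den mc s' i (hhash (15@[HP])%H) = hash z (nth 0 l i).
  move=> F ik; have ni := nM i ik; apply: den_hhash => //=; rewrite ?F ?s1_15 //;
    by [split=> //; lia | move=> a aM; rewrite F // s1_14].
apply: hoare_seq; apply: hoare_par => //=; rewrite ?s1_16.
- by split=> //; lia.
- by lia.
- move=> i ik; split; first by lia.
  move=> _; have [S1 D1] := HH i s1 (fun a _ => erefl) ik.
  split; [exact: S1 | by move: D1 => /= ->; exact: hash_lt | by split=> //; lia].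
move=> tab Htab.
have tabP a : a \in l -> tab (hash z a) \in l /\ hash z (tab (hash z a)) = hash z a.
  move=> al; have ia : index a l < k by rewrite index_mem.
  case: (Htab (hash z a)) => [[_ /(_ (index a l) ia isT)]|[i [ik _]]].
    by have [_ ->] := HH _ s1 (fun a _ => erefl) ia; rewrite nth_index.
  have [_ ->] := HH _ s1 (fun a _ => erefl) ik.
  by move=> E ->; rewrite /= s1_15 // mem_nth.
have tab_lt j : tab j = 0 \/ tab j < M.
  case: (Htab j) => [[-> _]|[i [ik _ _ ->]]]; first by rewrite s1_18.
  by right; rewrite /= s1_15 // nM.
have tabM j : tab j < M by case: (tab_lt j) => [->|].
clear Htab.
set s2 := upd s1 18 tab.
have F2 : frame [:: 18; 19] s1 s2 by apply: frame_upd.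
have F2' : frame [:: 17; 18] s s2 by apply: frame_upd => //; exact: frame_widen F1.
have s2_14 a : a < M -> s2 14 a = src a by exact: s1_14.
have s2_15 j : j < k -> s2 15 j = nth 0 l j by exact: s1_15.
have s2_16 : s2 16 0 = k by [].
have s2_18 : s2 18 = tab by [].
have s2_19 : s2 19 = s 19 by [].
have s2_45 : s2 45 0 = Dv by [].
clearbody s2.
pose matched a := tab (hash z a) == tw a.
have matchE a : a < M -> (src (tab (hash z a)) == dst a) && (dst (tab (hash z a)) == src a) = matched a.
  move=> aM; apply/andP/eqP => [[/eqP E1 /eqP E2]|->]; last by rewrite src_tw // dst_tw // !eqxx.
  by apply: simple; rewrite ?tw_lt ?src_tw ?dst_tw.
pose g3 := ((14@[18@[hhash (15@[HP])]] == hdst (15@[HP])) &&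
            (hdst (18@[hhash (15@[HP])]) == 14@[15@[HP]]))%H.
have G3 i : i < k -> safe mc s2 i g3 /\ (den mc s2 i g3 != 0) = matched (nth 0 l i).
  move=> ik; have [S2 D2] := HH i s2 F2 ik; have ni := nM i ik; have tl := tabM (hash z (nth 0 l i)).
  have hl := hash_lt z (nth 0 l i).
  move: S2 D2; move: (hhash _) @g3 => he g3 S2 D2; rewrite /g3 /= D2 s2_18 s2_15 // inp0 HB.
  rewrite (s2_14 _ ni) (s2_14 _ tl) !(csr_dst G) //.
  rewrite -matchE // !guardE; split; first by do ! split=> //; lia.
  by do 2 case: eqP.
apply: hoare_seq; apply: (@hoare_parI mc (fun j => index j l)) => //=; rewrite ?s2_16.
- by split=> //; lia.
- by lia.
- move=> i ik; have [Sg _] := G3 i ik; split; first exact: Sg.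
  move=> _; have [S2 D2] := HH i s2 F2 ik; have ni := nM i ik; have hl := hash_lt z (nth 0 l i).
  have tl := tabM (hash z (nth 0 l i)).
  split.
  + by split=> //; lia.
  + by rewrite s2_15 //; lia.
  + change (safe mc s2 i (18@[hhash (15@[HP])] + #1)%H).
    move: S2 D2; move: (hhash _) => he S2 D2; rewrite /= D2 s2_18; split; [by split | lia | lia].
  + by rewrite s2_15 // index_uniq.
move=> f Hf.
have fE a : f a = if (a \in l) && matched a then (tw a).+1 else s 19 a.
  rewrite Hf index_mem; case: (boolP (a \in l)) => al /=; last by rewrite s2_19.
  have ia : index a l < k by rewrite index_mem.
  have [_ G3a] := G3 _ ia; rewrite -/g3 G3a nth_index //.
  have [_ D2] := HH _ s2 F2 ia; move: D2; rewrite nth_index //=.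
  rewrite s2_15 // nth_index // eqxx andbT => ->; rewrite s2_18 s2_19 addn1.
  by case: ifP => // /eqP->.
clear Hf.
set s3 := upd s2 19 f.
have F3 : frame [:: 17; 18; 19] s s3.
  by apply: frame_upd => //; exact: frame_widen F2'.
have s3_15 j : j < k -> s3 15 j = nth 0 l j by exact: s2_15.
have s3_16 : s3 16 0 = k by [].
have s3_18 : s3 18 = tab by [].
have s3_19 : s3 19 = f by [].
clearbody s3.
have fT a : a < M -> f a = 0 \/ f a = (tw a).+1.
  by move=> aM; rewrite fE; case: ifP => _; [right | exact: s19].
have twl a : a < M -> (tw a \in l) = (a \in l) by move=> aM; rewrite !lE tw_lt // aM s19t.
(* Cell j is written by the arc that has found j, which is the twin of j. *)
apply: hoare_seq; apply: (@hoare_parI mc (fun j => if j < M then index (tw j) l else k)) => //=; rewrite ?s3_16.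
- by split=> //; lia.
- by lia.
- move=> i ik; have ni := nM i ik; rewrite s3_15 // s3_19 !guardE.
  split; first by do ! split=> //; lia.
  rewrite -[_ == 0]negbK -lt0n -leqNgt -ltnNge => f0.
  have fE' : f (nth 0 l i) = (tw (nth 0 l i)).+1 by case: (fT _ ni) => // E; move: f0; rewrite E.
  have tl := tw_lt ni.
  rewrite fE' subn1 /= tl; split.
  + by do ! split=> //; lia.
  + by lia.
  + by do ! split=> //; lia.
  + by rewrite twK // index_uniq.
move=> f' Hf'.
have f'E a : a < M -> f' a = if (tw a \in l) && (f (tw a) != 0) then (tw a).+1 else f a.
  move=> aM; rewrite Hf' aM index_mem; case: (boolP (tw a \in l)) => al //=; last by rewrite s3_19.
  have ia : index (tw a) l < k by rewrite index_mem.
  rewrite s3_15 // nth_index // s3_19 !guardE addn1.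
  case: (fT _ (tw_lt aM)) => ->; first by rewrite eqxx.
  by rewrite /= subn1 /= twK // eqxx.
clear Hf'.
set s4 := upd s3 19 f'.
have F4 : frame [:: 17; 18; 19] s s4.
  by apply: frame_upd => //; exact: frame_widen F3.
have s4_15 j : j < k -> s4 15 j = nth 0 l j by exact: s3_15.
have s4_16 : s4 16 0 = k by [].
have s4_18 : s4 18 = tab by [].
have s4_19 : s4 19 = f' by [].
have s4b : s4 0 0 = b by rewrite F4.
clearbody s4.
apply: hoare_conseq.
  apply: (@hoare_compaction mc (fun i => f' (nth 0 l i) == 0) (nth 0 l) 16 _ (15@[HP])%H 15 16 s4 _ k) => //.
  - by lia.
  - move=> s' i F' ik; have ni := nM i ik.
    rewrite /= (F' 15) // (F' 19) // s4_15 // s4_19; split; first by do ! split=> //; lia.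
    by rewrite nat_of_bool_neq0; split=> //; case: eqP.
  - by move=> s' i F' ik _; have ni := nM i ik; rewrite /= (F' 15) // s4_15 //; split=> //; split=> //; lia.
rewrite (selected_nth (fun a => f' a == 0)) => s5 u5 [F5 s5_16 s5_15 Hu5].
have F5' : frame [:: 1; 2; 3; 6; 15; 16; 17; 18; 19] s s5 by apply: frame_transb F4 F5.
split; first exact: F5'.
have s5_19 : s5 19 = f' by rewrite F5.
set l' := [seq a <- l | f' a == 0] in s5_16 s5_15 *.
have f'0 a : a < M -> (f' a == 0) = if a \in l then (f a == 0) && (f (tw a) == 0) else false.
  move=> aM; rewrite f'E // twl //; case: (boolP (a \in l)) => al /=.
    by case: ifP => [/negbTE->|/negbFE->]; rewrite ?andbF ?andbT.
  by move: al; rewrite lE aM /= => /negbTE E; rewrite fE lE aM E /= E.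
exists l'.
- split.
  + by rewrite F5'.
  + by rewrite F5'.
  + by move=> a aM; rewrite F5' // s14.
  + by move=> j; rewrite F5 // s4_18.
  split=> //.
  + by rewrite filter_uniq.
  + move=> a; rewrite mem_filter s5_19 lE; case: (ltnP a M) => aM; last by rewrite andbF.
    by rewrite f'0 // lE aM /=; case: (s 19 a == 0); rewrite ?andbT // andbF.
  + move=> a aM; rewrite s5_19 f'E //; case: ifP => _; [by right | exact: fT].
  + move=> a aM; rewrite s5_19 !f'0 ?tw_lt // twl // twK //; case: ifP => // _; exact: andbC.
- split.
  + by move=> a; rewrite mem_filter => /andP[].
  + move=> a; rewrite mem_filter => /andP[fa al]; have aM := lM' a al.
    move: fa; rewrite f'0 // al => /andP[fa fta].
    have m1 : ~~ matched a by move: fa; rewrite fE al /=; case: ifP.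
    have m2 : ~~ matched (tw a) by move: fta; rewrite fE twl // al /=; case: ifP.
    have [xl xh] := tabP a al; have xM := lM' _ xl.
    apply/hasP; exists (tab (hash z a)); first by rewrite mem_iota.
    (* The bucket of an unresolved arc holds neither its twin, which it would have recognised, nor
       the arc itself, which its twin would have recognised; so it holds an arc of another edge. *)
    rewrite xh eqxx andbT; apply/negP => /eqP/esym/(key_eq aM xM) [E|E].
      by move: m2; rewrite /matched twK // /hash key_tw // -/(hash z a) E eqxx.
    by move: m1; rewrite /matched E eqxx.
  + by apply: leq_trans (_ : 2 + (k.+1 + (k.+1 + (k.+1 + u5))) <= _); [lia | lia].
Qed.

End Hash.

(** * Commands whose running time depends on the coins *)

Definition runs (mc : config) (c : cmd) (s : store) (t : nat)
    (Q : store -> nat -> nat -> Prop) :=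
  forall M wk sp, represents mc M s -> sp <= c_ext mc ->
  exists M' s' k u sp' t', [/\
    exec (c_w mc) (c_arb mc) (c_rnd mc) c (State M t wk sp)
      (State M' t' (wk + k) sp'),
    represents mc M' s', sp' <= c_ext mc, k <= op_bound * u & Q s' u t'].

Section Runs.
Variable mc : config.

Lemma runs_hoare c s t (Q : store -> nat -> nat -> Prop) :
  hoare mc c s t (fun s' u => Q s' u (t + hdepth (c_b mc) c)) ->
  runs mc (compile_cmd c) s t Q.
Proof.
move=> H M wk sp HM Hsp; have [M' [s' [k [u [sp' [? ? ? ? ?]]]]]] := H M wk sp HM Hsp.
by exists M', s', k, u, sp', (t + hdepth (c_b mc) c); split.
Qed.

Lemma runs_conseq c s t (Q Q' : store -> nat -> nat -> Prop) :
  runs mc c s t Q -> (forall s' u t', Q s' u t' -> Q' s' u t') -> runs mc c s t Q'.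
Proof.
move=> H QQ M wk sp HM Hsp.
have [M' [s' [k [u [sp' [t' [? ? ? ? ?]]]]]]] := H M wk sp HM Hsp.
by exists M', s', k, u, sp', t'; split=> //; apply: QQ.
Qed.

Lemma runs_seq c1 c2 s t (Q : store -> nat -> nat -> Prop) :
  runs mc c1 s t (fun s1 u1 t1 =>
    runs mc c2 s1 t1 (fun s2 u2 t2 => Q s2 (u1 + u2) t2)) ->
  runs mc (Seq c1 c2) s t Q.
Proof.
move=> H M wk sp HM Hsp.
have [M1 [s1 [k1 [u1 [sp1 [t1 [X1 R1 S1 K1 H2]]]]]]] := H M wk sp HM Hsp.
have [M2 [s2 [k2 [u2 [sp2 [t2 [X2 R2 S2 K2 H3]]]]]]] := H2 M1 (wk + k1) sp1 R1 S1.
exists M2, s2, (k1 + k2), (u1 + u2), sp2, t2; split=> //.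
  by apply: (exec_seq X1); rewrite addnA.
by rewrite mulnDr leq_add.
Qed.

Lemma ctl_charge_le M t wk sp s g :
  represents mc M s -> safe mc s 0 g -> sp <= c_ext mc ->
  let st := State M t wk sp in
  ctl_value (c_w mc) (c_rnd mc) st (compile g) = den mc s 0 g /\
  exists2 sp', sp' <= c_ext mc & ctl_charge (c_w mc) (c_rnd mc) st (compile g) =
    State M (t + ops (compile g)) (wk + ops (compile g)) sp'.
Proof.
move=> HM Hg Hsp st; have [V X _] := compileP (c_rnd mc t 0) HM (W_gt0 mc) Hg.
split=> //; eexists; last by []; by rewrite geq_max Hsp X.
Qed.

Lemma runs_while_end g c s t (Q : store -> nat -> nat -> Prop) :
  ops (compile g) <= op_bound -> safe mc s 0 g -> den mc s 0 g = 0 ->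
  Q s 1 (t + ops (compile g)) -> runs mc (While (compile g) c) s t Q.
Proof.
move=> Hops Hg Dg HQ M wk sp HM Hsp.
have [V [sp' S' E]] := ctl_charge_le t wk HM Hg Hsp.
exists M, s, (ops (compile g)), 1, sp', (t + ops (compile g)); split=> //.
  by rewrite -E; apply: exec_while_end; rewrite V.
Qed.

Lemma runs_while_loop g c s t (Q : store -> nat -> nat -> Prop) :
  ops (compile g) <= op_bound -> safe mc s 0 g -> den mc s 0 g != 0 ->
  runs mc c s (t + ops (compile g)) (fun s1 u1 t1 =>
    runs mc (While (compile g) c) s1 t1 (fun s2 u2 t2 => Q s2 (u1 + u2).+1 t2)) ->
  runs mc (While (compile g) c) s t Q.
Proof.
move=> Hops Hg Dg H M wk sp HM Hsp.
have [V [sp' S' E]] := ctl_charge_le t wk HM Hg Hsp.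
have [M1 [s1 [k1 [u1 [sp1 [t1 [X1 R1 S1 K1 H2]]]]]]] := H M (wk + ops (compile g)) sp' HM S'.
have [M2 [s2 [k2 [u2 [sp2 [t2 [X2 R2 S2 K2 H3]]]]]]] := H2 M1 (wk + ops (compile g) + k1) sp1 R1 S1.
exists M2, s2, (ops (compile g) + k1 + k2), (u1 + u2).+1, sp2, t2; split=> //.
  apply: (@exec_while_loop _ _ _ _ _ _ (State M1 t1 (wk + ops (compile g) + k1) sp1)).
  - by rewrite V.
  - by rewrite E.
  - by have -> : wk + (ops (compile g) + k1 + k2) = wk + ops (compile g) + k1 + k2 by lia.
by move: Hops K1 K2; rewrite mulnS mulnDr; lia.
Qed.

End Runs.

(** * Computation of the bit length, the bucket width and the sources of the arcs *)

Definition size_guard : hexpr := ($1 <= HI #0)%H.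

Definition size_step : hcmd := HSeq (HSet 0 ($0 + #1)) (HSet 1 ($1 + $1))%H.

(** [HFor] reads the bit length from register 0, which is computed only here; hence a plain loop,
    whose time [size_time] still depends on b alone. *)
Definition size_cmd : cmd :=
  Seq (compile_cmd (HSet 1 (#1)%H)) (While (compile size_guard) (compile_cmd size_step)).

Definition hM : hexpr := HI (HI #0 + #1)%H.

(* Register 46 is doubled until the next doubling would overflow, which yields
   2 ^ (w - 1). *)
Definition prepare_cmd (kappa : nat) : hcmd :=
  HSeq (HSet 46 (#1)) (
  HSeq (HFor kappa 40 (HSet 46 (HIf (HM OAdd ($46) ($46)) (HM OAdd ($46) ($46)) ($46)))) (
  HSeq (HSet 45 ($46 %/ (#4 * hM + #1))) (
  HSeq (HSet 47 (HI #0)) (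
  HSeq (compaction 47 (#0 < hdeg HP) HP 7 8) (
  HSeq (HSet 32 ($8)) (
  HSeq (HPar ($8) (#1) 31 HP (7@[HP])) (
  HSeq flatten_cmd (
  HSeq (HPar ($13) (#1) 14 (11@[HP]) (12@[HP])) (
  HSeq (HPar ($13) (#1) 15 HP HP)
  (HSet 16 ($13)))))))))))%H.

Section Prepare.
Variables (mc : config) (n : nat) (off dst : nat -> nat).
Hypothesis G : csr mc n off dst.
Local Notation b := (c_b mc).
Local Notation M := (off n).
Local Notation W := (2 ^ c_w mc).
Local Notation deg := (odeg off).
Hypotheses (n_lt : n < 2 ^ b) (n_ge : 2 ^ b.-1 <= n).

Definition size_time b :=
  hdepth b (HSet 1 (#1)%H) + b * (ops (compile size_guard) + hdepth b size_step) + ops (compile size_guard).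

Lemma runs_size s :
  (forall a i, s a i = 0) ->
  runs mc size_cmd s 0 (fun s' u t' =>
    [/\ s' 0 0 = b, frame [:: 0; 1] s s', t' = size_time b & u <= 10 * b + 10]).
Proof.
move=> s0; have b0 := c_b_gt0 mc; have [lM lW lb] := csr_bounds G; have HB := csr_base G.
have lge := c_len_ge mc; have blen := c_b_len mc; have inp0 := csr_n G.
have loop j : forall i s1 t1, i + j = b -> frame [:: 0; 1] s s1 -> s1 0 0 = i -> s1 1 0 = 2 ^ i ->
  runs mc (While (compile size_guard) (compile_cmd size_step)) s1 t1 (fun s' u t' =>
    [/\ s' 0 0 = b, frame [:: 0; 1] s s',
        t' = t1 + (j * (ops (compile size_guard) + hdepth b size_step) + ops (compile size_guard)) &
        u <= 5 * j + 1]).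
  elim: j => [|j IH] i s1 t1 ij F1 s10 s11.
    have iE : i = b by lia.
    rewrite iE in s10 s11.
    apply: runs_while_end => //=; rewrite ?s11 ?inp0 ?HB.
    - by do ! split=> //; lia.
    - by rewrite n_lt.
  have ib : i <= b.-1 by lia.
  have in2 : 2 ^ i <= n by apply: leq_trans n_ge; rewrite leq_exp2l.
  apply: runs_while_loop => //=; rewrite ?s11 ?inp0 ?HB.
  - by do ! split=> //; lia.
  - by rewrite ltnNge in2.
  apply: (runs_hoare (c := size_step)).
  apply: hoare_seq; apply: hoare_set => //=.
    by rewrite s10; do ! split=> //; lia.
  rewrite s10; apply: hoare_set => //=.
    by rewrite /upd /= s11; do ! split=> //; lia.
  rewrite /upd /= s11; set s2 := fun a' => _.
  apply: runs_conseq.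
    apply: (IH i.+1 s2) => //; first by lia.
    - by rewrite /s2; do 2 apply: frame_upd => //.
    - by rewrite /s2 /= /upd0 addn1.
    - by rewrite /s2 /= /upd0 addnn -mul2n expnS.
  move=> s3 u3 t3 [s30 F3 t3E u3E]; split=> //; last by lia.
  rewrite t3E mulSn /=; lia.
apply: runs_seq; apply: (runs_hoare (c := HSet 1 (#1)%H)); apply: hoare_set => //=; first by lia.
apply: runs_conseq.
  by apply: (loop b 0) => //; [apply: frame_upd | exact: s0].
move=> s3 u3 t3 [s30 F3 t3E u3E]; split=> //; last by lia.
Qed.

Variable src : nat -> nat.
Hypotheses (src_lt : forall a, a < M -> src a < n)
  (src_off : forall a, a < M -> off (src a) <= a < off (src a).+1).

Lemma src_eq u a : u < n -> off u <= a -> a < off u.+1 -> src a = u.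
Proof.
move=> un ua au; have aM : a < M by apply: leq_trans au (off_le G un).
have sn := src_lt aM; have /andP[s1 s2] := src_off aM.
case: (ltngtP (src a) u) => // H.
- by have := csr_mono G (u := (src a).+1) (v := u) H (ltnW un); lia.
- by have := csr_mono G (u := u.+1) (v := src a) H (ltnW sn); lia.
Qed.

Definition busy := [seq v <- iota 0 n | 0 < deg v].

Lemma hoare_prepare kappa s t tw :
  s 0 0 = b -> (forall a i, 1 < a -> s a i = 0) -> kappa * b = c_w mc -> 4 * kappa < W ->
  c_w mc + 1 < W ->
  hoare mc (prepare_cmd kappa) s t (fun s' u =>
    [/\ hash_inv mc n off src tw (2 ^ (c_w mc).-1 %/ (4 * M + 1)) s' (iota 0 M),
        forall i, s' 21 i = 0 /\ s' 22 i = 0,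
        listed n off s' busy &
        u <= 2000 * (n + M + b) + 5 * (kappa * b) + 40]).
Proof.
move=> sb s0 kb kW wW.
have b0 := c_b_gt0 mc; have [lM lW lb] := csr_bounds G; have HB := csr_base G.
have xge : c_len mc <= c_ext mc by have := c_ext_ge mc; rewrite /NA; lia.
have lge := c_len_ge mc; have inp0 := csr_n G; have inpM := csr_offS G (leqnn n).
have w0 : 0 < c_w mc by case: (c_w mc) lW lge => //; lia.
apply: hoare_seq; apply: hoare_set => //=; first by lia.
set s1 := upd s 46 _.
have F1 : frame [:: 46] s s1 by apply: frame_upd.
have s1_46 : s1 46 0 = 1 by [].
clearbody s1.
(* Doubling gives 0 modulo [2 ^ w] exactly when the exponent has reached w - 1, and this result is
   discarded. The loop has [kappa * b] iterations, that is w. *)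
pose I i (s' : store) u := [/\ frame [:: 46; 40] s s', s' 46 0 = 2 ^ minn i (c_w mc).-1 & u <= 2 + 5 * i].
apply: hoare_seq; apply: (@hoare_for mc I) => //=; try lia.
- by rewrite F1.
- split=> //; first by apply: frame_upd => //; exact: (frame_widen (L1 := [:: 46])).
  by rewrite /upd /= s1_46 min0n.
- move=> i s2 t2 u2 ib s2i s2b [F2 s246 u2E].
  apply: hoare_set => //=; first by do ! split=> //; lia.
  split=> //; split=> //.
  + by do 2 apply: frame_upd => //.
  + rewrite /upd /= /upd0 /= s246 addnn -mul2n -expnS.
    have [H|H] := ltnP i (c_w mc).-1.
      have -> : minn i.+1 (c_w mc).-1 = i.+1 by lia.
      rewrite modn_small; last by rewrite ltn_exp2l //; lia.
      by rewrite -lt0n expn_gt0.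
    have -> : minn i.+1 (c_w mc).-1 = (c_w mc).-1 by lia.
    by rewrite prednK // modnn.
  + by lia.
move=> s2 u2 s2i s2b [F2 s246 u2E].
have {}s246 : s2 46 0 = 2 ^ (c_w mc).-1.
  by rewrite s246; congr (2 ^ _); rewrite kb; lia.
have s20 a i : 1 < a -> a \notin [:: 46; 40] -> s2 a i = 0 by move=> a1 aL; rewrite F2 // s0.
apply: hoare_seq; apply: hoare_set => //=.
  by rewrite inp0 inpM HB; do ! split=> //; lia.
rewrite s246 inp0 inpM; set s3 := upd s2 45 _.
have s3_45 : s3 45 0 = 2 ^ (c_w mc).-1 %/ (4 * M + 1) by [].
have F3 : frame [:: 45] s2 s3 by apply: frame_upd.
clearbody s3.
apply: hoare_seq; apply: hoare_set => //=.
  by rewrite HB; do ! split=> //; lia.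
rewrite inp0; set s4 := upd s3 47 _.
have F4 : frame [:: 45; 47] s2 s4.
  by apply: frame_upd => //; apply: frame_widen F3.
have s4_47 : s4 47 0 = n by [].
have s4_45 : s4 45 0 = 2 ^ (c_w mc).-1 %/ (4 * M + 1) by [].
clearbody s4.
have dv v : v < n -> c_inp mc (v + 2) - c_inp mc (v + 1) = deg v.
  by move=> vn; rewrite (csr_offSS G vn) (csr_offS G (ltnW vn)).
apply: hoare_seq; apply: hoare_conseq.
  apply: (@hoare_compaction mc (fun i => 0 < deg i) id 47 _ HP 7 8 s4 _ n) => //.
  - by rewrite F4.
  - by lia.
  - move=> s' i F' vn; rewrite /= dv // nat_of_bool_neq0; split; first by rewrite HB; do ! split=> //; lia.
    by split=> //; case: (0 < deg i).
have -> : selected (fun i => 0 < deg i) id n = busy by rewrite /selected map_id.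
move=> s5 u5 [F5 s5_8 s5_7 u5E].
have F5' : frame [:: 45; 47; 1; 2; 3; 6; 7; 8] s2 s5 by apply: frame_transb F4 F5.
have s5_45 : s5 45 0 = 2 ^ (c_w mc).-1 %/ (4 * M + 1) by rewrite F5.
apply: hoare_seq; apply: hoare_set => //=; first by split=> //; lia.
rewrite s5_8; set s6 := upd s5 32 _.
have F6 : frame [:: 32; 45; 47; 1; 2; 3; 6; 7; 8] s2 s6.
  by apply: frame_upd => //; apply: frame_widen F5'.
have s6_32 : s6 32 0 = size busy by [].
have s6_8 : s6 8 0 = size busy by [].
have s6_7 j : j < size busy -> s6 7 j = nth 0 busy j by exact: s5_7.
have s6_45 : s6 45 0 = 2 ^ (c_w mc).-1 %/ (4 * M + 1) by [].
clearbody s6.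
have busyP v : (v \in busy) = (v < n) && (0 < deg v) by rewrite mem_filter mem_iota /= add0n andbC.
have bn : size busy <= n by rewrite size_filter (leq_trans (count_size _ _)) // size_iota.
have ub : uniq busy by rewrite filter_uniq ?iota_uniq.
apply: hoare_seq; apply: hoare_map => //=; rewrite ?s6_8.
- by split=> //; lia.
- by lia.
- by move=> i il; split; [lia | move=> _; split=> //; lia].
move=> fl Hfl.
have flE i : i < size busy -> fl i = nth 0 busy i by move=> il; rewrite Hfl il s6_7.
have flP i : i < size busy -> fl i < n /\ 0 < deg (fl i).
  by move=> il; rewrite flE //; apply/andP; rewrite -busyP mem_nth.
clear Hfl; set s7 := upd s6 31 fl.
have F7 : frame [:: 31; 32; 45; 47; 1; 2; 3; 6; 7; 8] s2 s7.
  by apply: frame_upd => //; apply: frame_widen F6.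
have s7_31 : s7 31 = fl by [].
have s7_32 : s7 32 0 = size busy by [].
have s7_8 : s7 8 0 = size busy by [].
have s7_7 j : j < size busy -> s7 7 j = nth 0 busy j by exact: s6_7.
have s7_45 : s7 45 0 = 2 ^ (c_w mc).-1 %/ (4 * M + 1) by [].
clearbody s7.
have ME : psum (fun i => deg (fl i)) (size busy) = M.
  have -> : psum (fun i => deg (fl i)) (size busy) = psum (fun i => deg (nth 0 busy i)) (size busy).
    by apply: psum_ext => i il; rewrite flE.
  rewrite (psum_list _ ub busyP) -(psum_deg G (leqnn n)); apply: psum_ext => v vn.
  by case: (posnP (deg v)).
apply: hoare_seq; apply: hoare_conseq.
  by apply: (hoare_flatten G _ _ s7_32 s7_31 flP ME (leqnn M)); rewrite F7.
move=> s8 u8 [F8 s8_13 s8A u8E].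
have F8' : frame ([:: 31; 32; 45; 47; 1; 2; 3; 6; 7; 8] ++ iota 9 5) s2 s8 by apply: frame_transb F7 F8.
have arcP p : p < M -> exists u r, [/\ u < n, r < deg u, s8 12 p = u & s8 11 p = off u + r].
  rewrite -{1}ME => /psum_locate[i [r [il rd ->]]].
  have [fn _] := flP i il; have [-> ->] := s8A i r il rd.
  by exists (fl i), r.
have arc_src p : p < M -> s8 11 p < M /\ s8 12 p = src (s8 11 p).
  move=> /arcP[u [r [un rd -> ->]]]; have := offS G un; have := off_le G un => H1 H2.
  by split; [lia | rewrite (@src_eq u) //; lia].
have arc_sur a : a < M -> exists2 p, p < M & s8 11 p = a.
  move=> aM; have sn := src_lt aM; have /andP[s1' s2'] := src_off aM.
  have od := offS G sn.
  have sl : src a \in busy by rewrite busyP sn /odeg; lia.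
  have il : index (src a) busy < size busy by rewrite index_mem.
  have fi : fl (index (src a) busy) = src a by rewrite flE // nth_index.
  exists (psum (fun i => deg (fl i)) (index (src a) busy) + (a - off (src a))).
    by rewrite -{1}ME; apply: psum_bound => //; rewrite fi; lia.
  have [_ ->] := s8A _ (a - off (src a)) il ltac:(rewrite fi; lia).
  by rewrite fi; lia.
apply: hoare_seq; apply: hoare_par => //=; rewrite ?s8_13.
- by split=> //; lia.
- by lia.
- move=> p pM; split; first by lia.
  by move=> _; have [] := arc_src p pM; split; do ? split=> //; lia.
move=> sr Hsr.
have srE a : a < M -> sr a = src a.
  move=> aM; case: (Hsr a) => [[_ H]|[p [pM _]]].
    by have [p pM pa] := arc_sur a aM; case: (H p pM isT).
  by have [_] := arc_src p pM; rewrite /= => E <- ->.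
clear Hsr; set s9 := upd s8 14 sr.
have s9_13 : s9 13 0 = M by [].
have s9_14 : s9 14 = sr by [].
have F9 : frame (14 :: [:: 31; 32; 45; 47; 1; 2; 3; 6; 7; 8] ++ iota 9 5) s2 s9.
  by apply: frame_upd => //; apply: frame_widen F8'.
have s9_45 : s9 45 0 = 2 ^ (c_w mc).-1 %/ (4 * M + 1) by rewrite -s7_45 -(F8 45 isT).
have s9_8 : s9 8 0 = size busy by rewrite -s7_8 -(F8 8 isT).
have s9_7 j : j < size busy -> s9 7 j = nth 0 busy j by move=> jl; rewrite -s7_7 // -(F8 7 isT).
clearbody s9.
apply: hoare_seq; apply: hoare_map => //=; rewrite ?s9_13.
- by split=> //; lia.
- by lia.
- by move=> i il; split; [lia |].
move=> U HU.
have UE j : j < M -> U j = j by move=> jM; rewrite HU jM.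
clear HU; set s10 := upd s9 15 U.
have s10_13 : s10 13 0 = M by [].
have s10_14 : s10 14 = sr by [].
have s10_15 : s10 15 = U by [].
have F10 : frame (15 :: 14 :: [:: 31; 32; 45; 47; 1; 2; 3; 6; 7; 8] ++ iota 9 5) s2 s10.
  by apply: frame_upd => //; apply: frame_widen F9.
have s10_45 : s10 45 0 = 2 ^ (c_w mc).-1 %/ (4 * M + 1) by exact: s9_45.
have s10_8 : s10 8 0 = size busy by exact: s9_8.
have s10_7 j : j < size busy -> s10 7 j = nth 0 busy j by exact: s9_7.
clearbody s10.
apply: hoare_set => //=; first by split=> //; lia.
rewrite s10_13; set s11 := upd s10 16 _.
have F11 : frame (16 :: 15 :: 14 :: [:: 31; 32; 45; 47; 1; 2; 3; 6; 7; 8] ++ iota 9 5) s2 s11.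
  by apply: frame_upd => //; apply: frame_widen F10.
have s11z a i : 1 < a -> a \notin [:: 46; 40] ->
  a \notin (16 :: 15 :: 14 :: [:: 31; 32; 45; 47; 1; 2; 3; 6; 7; 8] ++ iota 9 5) -> s11 a i = 0.
  by move=> a1 a2 a3; rewrite F11 // s20.
split.
- split.
  + by rewrite F11.
  + exact: s10_45.
  + by move=> a aM; rewrite -srE // -s10_14.
  + by move=> j; left; apply: s11z.
  split.
  + split; first by rewrite size_iota.
    by move=> j; rewrite size_iota => jM; rewrite nth_iota // -[RHS]UE // -s10_15.
  + exact: iota_uniq.
  + by move=> a; rewrite mem_iota add0n s11z // eqxx andbT.
  + by move=> a _; left; apply: s11z.
  + by move=> a _; rewrite !s11z.
- by move=> i; split; apply: s11z.
- split=> //.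
  + by move=> v; rewrite busyP => /andP.
  + by move=> v; rewrite inE busyP ltn_ord => /andP[].
- by move: u2E u5E u8E bn; clear; lia.
Qed.

End Prepare.

(** Hoare triples only provide some execution; determinism extends their conclusions to every
    execution, over which [final] ranges. *)
Lemma exec_det w arb rnd c s s1 s2 :
  exec w arb rnd c s s1 -> exec w arb rnd c s s2 -> s1 = s2.
Proof.
move=> X; elim: X s2 => {c s s1}.
- by move=> s s2 Y; inversion Y.
- by move=> p g a v s s2 Y; inversion Y.
- move=> c1 c2 sa sb sc _ I1 _ I2 s2 Y; inversion Y as [| |? ? ? sb' ? Y1 Y2| | |]; subst.
  by rewrite -(I1 _ Y1) in Y2; apply: I2.
- by move=> g c1 c2 s s' _ I1 s2 Y; inversion Y; subst; apply: I1.
- move=> g c s V s2 Y; inversion Y as [| | | | |? ? ? ? ? V']; subst => //.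
  by rewrite V in V'.
- move=> g c sa sb sc V _ I1 _ I2 s2 Y.
  inversion Y as [| | | |? ? ? V'|? ? ? sb' ? V' Y1 Y2]; subst; first by rewrite V' in V.
  by rewrite -(I1 _ Y1) in Y2; apply: I2.
Qed.

(** * The complete program *)

Definition hash_loop : cmd := While (compile ($16)) (compile_cmd hash_round).

Definition main_cmd (q kappa : nat) : cmd :=
  Seq size_cmd (Seq (compile_cmd (prepare_cmd kappa))
    (Seq hash_loop (compile_cmd (peel_cmd q)))).

(** A raw instruction, because it overwrites the input: layers go to the addresses 0 to n - 1, where
    the theorem looks for them. *)
Definition output_cmd : cmd :=
  Pardo (Read (Const 0)) (Const 1) Pid (Read (address 22 Pid)).

Definition program (q kappa : nat) : cmd := Seq (main_cmd q kappa) output_cmd.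

Definition loop_time (kappa b : nat) := size_time b + hdepth b (prepare_cmd kappa).

Definition round_time (b : nat) := ops (compile ($16)) + hdepth b hash_round.

(* The time at which round [r] of the hashing draws its multiplier. *)
Definition seed_time (kappa b r : nat) :=
  loop_time kappa b + r * round_time b + ops (compile ($16)) + 1.

Definition output_time :=
  ops (Read (Const 0)) + (ops (Const 1) + ops Pid + ops (Read (address 22 Pid))).+1.

Definition final_time (q kappa b R : nat) :=
  loop_time kappa b + R * round_time b + ops (compile ($16)) + hdepth b (peel_cmd q) +
  output_time.

Definition work_const (q kappa : nat) := 5 * kappa + 3000 + 10 * q.+1 * round_cost.

Section Program.
Variables (mc : config) (n : nat) (off dst src tw : nat -> nat) (e : rel 'I_n) (q kappa : nat).
Hypothesis G : csr mc n off dst.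
Local Notation b := (c_b mc).
Local Notation w := (c_w mc).
Local Notation M := (off n).
Local Notation W := (2 ^ w).
Local Notation deg := (odeg off).
Local Notation Dv := (2 ^ w.-1 %/ (4 * M + 1)).
Local Notation rnd := (c_rnd mc).
Local Notation exec := (exec w (c_arb mc) rnd).
Hypotheses (src_lt : forall a, a < M -> src a < n)
  (src_off : forall a, a < M -> off (src a) <= a < off (src a).+1)
  (simple : forall a a', a < M -> a' < M -> src a = src a' -> dst a = dst a' -> a = a')
  (noloop : forall a, a < M -> src a != dst a)
  (tw_lt : forall a, a < M -> tw a < M)
  (src_tw : forall a, a < M -> src (tw a) = dst a)
  (dst_tw : forall a, a < M -> dst (tw a) = src a).
Hypotheses (n_lt : n < 2 ^ b) (n_ge : 2 ^ b.-1 <= n)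
  (e_sym : symmetric e) (q_gt0 : 0 < q)
  (arcsE : forall u v : 'I_n, arcs off dst u v = e u v).
Hypotheses (kb : kappa * b = w) (kW : 4 * kappa < W) (wW : w + 1 < W)
  (qW : 2 * q < W) (qbW : 2 * q * b + 1 < W) (bW : 4 * 2 ^ (2 * b) < W)
  (MW : 4 * M + 1 <= 2 ^ w.-1).
Hypothesis inp_out : forall x, base mc <= x -> c_inp mc x = 0.

Lemma bucket_gt0 : 0 < Dv. Proof. by rewrite divn_gt0 ?addn1 // -addn1. Qed.

(** About 8 M buckets are intended; rounding down [Dv] at most doubles their number, which stays
    below the array length. *)
Lemma bucket_len : W <= Dv * c_len mc.
Proof.
have w0 : 0 < w by have := c_len_ge mc; have := c_lenW mc; case: w => // /=; nia.
have H := ltn_ceil (2 ^ w.-1) (ltac:(lia) : 0 < 4 * M + 1).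
have D0 := bucket_gt0; rewrite -(prednK w0) expnS.
have cl := csr_len G; move: H D0; set D := Dv; move: (2 ^ _) => X H D0.
have : D * (1000 * (n + M + 1)) <= D * c_len mc by rewrite leq_mul2l cl orbT.
apply: leq_trans.
apply: (@leq_trans (D * (4 * (4 * M + 1)))); last by rewrite leq_mul2l; apply/orP; right; lia.
have H3 : D.+1 * (4 * M + 1) <= 2 * D * (4 * M + 1) by rewrite leq_mul2r; apply/orP; right; lia.
by clear -H H3; lia.
Qed.

Lemma twins_tw : twins n off dst tw.
Proof.
split=> [u r un rd|a a' aM aM' E].
  have od := offS G un; have ol := off_le G un.
  have aM : off u + r < M by lia.
  have sa : src (off u + r) = u.
    by apply: (src_eq G) => //; lia.
  by rewrite dst_tw // sa -src_tw //; have /andP[] := src_off (tw_lt aM).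
by rewrite -(twK simple tw_lt src_tw dst_tw aM) E (twK simple tw_lt src_tw dst_tw aM').
Qed.

Definition seed r := rnd (seed_time kappa b r) 0.

Local Notation coll := (collides mc n off dst src Dv).

(** Defined from the words at the prescribed times, whether or not these rounds are executed. It
    bounds the number of unresolved arcs, and its law is accessible. *)
Definition nsurv R := count (fun a => all (fun r => coll (seed r) a) (iota 0 R)) (iota 0 M).

(* The term [b] of an unfinished round is paid for by the [2 * b] first rounds,
   and afterwards by the unresolved arcs. *)
Definition round_work i := 301 * (nsurv i + if i < 2 * b then b else b * nsurv i).

Definition loop_inv (s : store) (l : seq nat) :=
  [/\ hash_inv mc n off src tw Dv s l, forall i, s 21 i = 0 /\ s 22 i = 0 &
      listed n off s (busy n off)].

Lemma hash_step s t l : 0 < M -> loop_inv s l ->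
  hoare mc hash_round s t (fun s' u =>
    exists2 l', loop_inv s' l' &
      [/\ {subset l' <= l}, forall a, a \in l' -> coll (rnd (t + 1) 0) a &
          u <= 300 * (size l + b)]).
Proof.
move=> M0 [Hs Hz Hl]; apply: hoare_conseq.
  exact: (hoare_hash_round G src_lt simple noloop tw_lt src_tw dst_tw bucket_gt0 bucket_len t M0 Hs).
move=> s' u [F [l' Hs' Hl']]; exists l' => //; split=> //.
  by move=> i; rewrite !F.
have F7 := F 7 isT; have F8 := F 8 isT; have F21 := F 21 isT.
by case: Hl => L1 L2 L3 L4 L5; split; rewrite ?F7 ?F8 ?F21.
Qed.

Lemma guard16 s l : loop_inv s l ->
  [/\ ops (compile ($16)) <= op_bound, safe mc s 0 ($16) & den mc s 0 ($16) = size l].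
Proof.
case=> [[_ _ _ _ [[E _] _ _ _ _]] _ _]; split=> //=.
by have := c_len_ge mc; have := c_lenW mc; split=> //; [rewrite expn_gt0 | lia].
Qed.

Lemma inv_M s l : loop_inv s l -> l != [::] -> 0 < M.
Proof.
case=> [[_ _ _ _ [_ _ lE _ _]] _ _]; case: l lE => // a l lE _.
by have := lE a; rewrite inE eqxx /= => /esym/andP[]; case: M.
Qed.

Lemma runs_hash_loop R j r s l :
  nsurv R = 0 -> r + j = R -> loop_inv s l ->
  (forall a, a \in l -> all (fun r => coll (seed r) a) (iota 0 r)) ->
  runs mc hash_loop s (loop_time kappa b + r * round_time b) (fun s' u t' =>
    [/\ loop_inv s' [::],
        t' <= loop_time kappa b + R * round_time b + ops (compile ($16)) &
        u <= 1 + \sum_(r <= i < R) round_work i]).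
Proof.
move=> R0; elim: j r s l => [|j IH] r s l rR Hl sub;
  have [gop gs gd] := guard16 Hl; have [Hs _ _] := (Hl);
  have [_ _ _ _ [_ ul lE _ _]] := (Hs);
  have sl : size l <= nsurv r.
- by rewrite /nsurv -size_filter; apply: uniq_leq_size => // a al;
    rewrite mem_filter sub //= mem_iota; move: al; rewrite lE => /andP[].
- have l0 : l = [::] by apply: size0nil; move: sl; have -> : r = R by [lia]; rewrite R0; lia.
  rewrite l0 in Hl gd; apply: runs_while_end => //; split=> //.
    by have -> : r = R by lia.
- by rewrite /nsurv -size_filter; apply: uniq_leq_size => // a al;
    rewrite mem_filter sub //= mem_iota; move: al; rewrite lE => /andP[].
- case: (eqVneq l [::]) => l0.
    rewrite l0 in Hl gd; apply: runs_while_end => //; split=> //.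
    by rewrite leq_add2r leq_add2l leq_mul2r; apply/orP; right; lia.
  have M0 := inv_M Hl l0.
  have sl0 : 0 < size l by case: (l) l0.
  apply: runs_while_loop => //; first by rewrite gd -lt0n.
  apply: runs_hoare; apply: hoare_conseq.
    exact: (hash_step _ M0 Hl).
  move=> s1 u1 [l1 Hl1 [sub1 col1 Hu1]].
  have -> : loop_time kappa b + r * round_time b + ops (compile ($16)) + hdepth b hash_round =
    loop_time kappa b + r.+1 * round_time b by rewrite /round_time mulSn; lia.
  apply: runs_conseq.
    apply: (IH r.+1 s1 l1) => //; first by lia.
    move=> a al; rewrite -[r.+1]addn1 iotaD all_cat add0n /= andbT sub ?sub1 //=.
    exact: col1.
  move=> s2 u2 t2 [Hl2 Ht2 Hu2]; split=> //.
  rewrite [\sum_(r <= i < R) _]big_ltn; last by lia.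
  have : u1 + 1 <= round_work r.
    apply: (@leq_trans (300 * (size l + b) + size l)); first by lia.
    rewrite /round_work; case: ifP => _; first by lia.
    have : b <= b * nsurv r by rewrite leq_pmulr //; lia.
    by lia.
  by lia.
Qed.

Let u_size := 10 * b + 10.
Let u_prep := 2000 * (n + M + b) + 5 * (kappa * b) + 40.
Let u_peel := 10 * q.+1 * round_cost * (n + M + b ^ 3).

Lemma peel_inv s t : loop_inv s [::] ->
  hoare mc (peel_cmd q) s t (fun s' u =>
    (forall v : 'I_n, layer_ok e q v (s' 22 v)) /\ u <= u_peel).
Proof.
case=> [[sb _ _ _ [_ _ lE s19 _]] Hz Hl].
apply: (hoare_peel G e_sym q_gt0 qW qbW n_lt arcsE twins_tw t sb Hl bW).
- by move=> v _; have [] := Hz v.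
- by move=> v _; have [] := Hz v.
- move=> a aM; case: (s19 a aM) => // E.
  by have := lE a; rewrite aM E eqxx.
Qed.

Definition init_store : store := fun _ _ => 0.

Lemma represents_init : represents mc (c_inp mc) init_store.
Proof. by split=> // [a i _|x]; [apply: inp_out; rewrite -addnA leq_addr | exact: c_inpW]. Qed.

Lemma runs_size_init :
  runs mc size_cmd init_store 0 (fun s1 u1 t1 =>
    [/\ t1 = size_time b, u1 <= u_size &
     hoare mc (prepare_cmd kappa) s1 t1 (fun s2 u2 =>
       loop_inv s2 (iota 0 M) /\ u2 <= u_prep)]).
Proof.
apply: runs_conseq.
  by apply: (runs_size G n_lt n_ge).
move=> s1 u1 t1 [s1b F1 t1E u1E]; split=> //.
apply: hoare_conseq.
  have s1z a i : 1 < a -> s1 a i = 0 by move=> a1; rewrite F1 // !inE; case: a a1 => [|[|]].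
  exact: (hoare_prepare G n_lt n_ge src_lt src_off t1 tw s1b s1z kb kW wW).
by move=> s2 u2 [? ? ? ?].
Qed.

Lemma runs_main R : nsurv R = 0 ->
  runs mc (main_cmd q kappa) init_store 0 (fun s' u t' =>
    [/\ forall v : 'I_n, layer_ok e q v (s' 22 v),
        t' <= loop_time kappa b + R * round_time b + ops (compile ($16)) + hdepth b (peel_cmd q) &
        u <= u_size + (u_prep + (1 + \sum_(0 <= i < R) round_work i + u_peel))]).
Proof.
move=> R0; apply: runs_seq; apply: runs_conseq; first exact: runs_size_init.
move=> s1 u1 t1 [t1E Hu1 H1]; apply: runs_seq; apply: runs_hoare.
apply: hoare_conseq; first exact: H1.
move=> s2 u2 [Hl Hu2]; apply: runs_seq.
have -> : t1 + hdepth b (prepare_cmd kappa) = loop_time kappa b + 0 * round_time b.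
  by rewrite t1E mul0n addn0.
apply: runs_conseq.
  by apply: (runs_hash_loop (j := R) R0 _ Hl).
move=> s3 u3 t3 [Hl3 Ht3 Hu3]; apply: runs_hoare; apply: hoare_conseq; first exact: (peel_inv t3 Hl3).
move=> s4 u4 [Hlay Hu4]; split=> //; first by rewrite leq_add2r.
by rewrite leq_add // leq_add // leq_add.
Qed.

Lemma exec_output Mem t wk sp s :
  represents mc Mem s -> sp <= c_ext mc ->
  exists st, [/\ exec output_cmd (State Mem t wk sp) st, st_depth st = t + output_time,
    st_work st <= wk + op_bound * n.+1, st_space st <= c_ext mc &
    forall v : 'I_n, st_mem st v = s 22 v].
Proof.
move=> HM Hsp; have HB := csr_base G; have [lM lW lb] := csr_bounds G.
have [HM1 HM2 HM3] := HM; have eW := c_extW mc; have ege := c_ext_ge mc.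
have lge := c_len_ge mc.
have W0 := W_gt0 mc.
have M0n : Mem 0 = n by rewrite HM1 ?(csr_n G) // HB; lia.
pose st := pardo w (c_arb mc) rnd (State Mem t wk sp) (Read (Const 0)) (Const 1) Pid (Read (address 22 Pid)).
have cN : ctl_value w rnd (State Mem t wk sp) (Read (Const 0)) = n.
  by rewrite /ctl_value /= mod0n.
have V i r : i < n -> value w Mem i r (Read (address 22 Pid)) = s 22 i /\
    extent w Mem i r (Read (address 22 Pid)) <= c_ext mc.
  move=> iN; have il : i < c_len mc by lia.
  have [VA [XA LA]] := @value_address mc Mem s i r 22 Pid i HM isT (erefl _) il (leq0n _).
  have -> : value w Mem i r (Read (address 22 Pid)) = Mem (value w Mem i r (address 22 Pid)) by [].
  have -> : extent w Mem i r (Read (address 22 Pid)) =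
    maxn (extent w Mem i r (address 22 Pid)) (value w Mem i r (address 22 Pid)).+1 by [].
  by rewrite VA HM2 // geq_max XA LA.
have next : n <= c_ext mc by move: ege; rewrite -/(base mc) HB /NA; lia.
exists st; split.
- exact: exec_pardo.
- by rewrite /st /pardo /output_time /= addnA.
- rewrite /st /pardo cN; cbv beta iota zeta delta [st_work ctl_charge st_mem st_depth].
  rewrite -addnA leq_add2l (mulnS op_bound); apply: leq_add => //.
  by rewrite mulnC leq_mul2r; apply/orP; right.
- rewrite /st /pardo cN; cbv beta iota zeta delta [st_space ctl_charge st_depth st_mem].
  rewrite 2!geq_max Hsp geq_max next !andTb /pardo_extent.
  apply/andP; split; first by rewrite /= mod0n geq_max; lia.
  apply/bigmax_leqP => -[i iN] _; cbn [nat_of_ord].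
  rewrite geq_max leq0n andTb; case: ifP => // _.
  have [_ Xv] := V i (rnd (t + ops (Read (Const 0))) i) iN.
  by rewrite 2!geq_max leq0n andTb Xv andbT; exact: leq_trans next.
- move=> v; rewrite /st /pardo cN; cbv beta iota zeta delta [st_mem ctl_charge st_depth].
  case: (pardo_memP w (c_arb mc) rnd (t + ops (Read (Const 0))) Mem n (Const 1) Pid (Read (address 22 Pid)) v).
    case=> _ /(_ v (ltn_ord v)) H; exfalso; apply: H => //.
    by rewrite /= modn_small //; lia.
  case=> i [iN _ iv ->]; rewrite -iv; have [-> _] := V i (rnd (t + ops (Read (Const 0))) i) iN.
  by [].
Qed.

Lemma program_halts R : nsurv R = 0 ->
  exists2 st, exec (program q kappa) (State (c_inp mc) 0 0 0) st &
    st_depth st <= final_time q kappa b R /\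
    st_work st <= op_bound * (work_const q kappa * (n + M + b ^ 3) + \sum_(0 <= i < R) round_work i).
Proof.
move=> R0; have b0 := c_b_gt0 mc.
have [M1 [s1 [k1 [u1 [sp1 [t1 [X1 R1 S1 K1 [_ Ht1 Hu1]]]]]]]] :=
  runs_main R0 0 represents_init (leq0n _).
have [st [X2 D2 W2 _ _]] := exec_output t1 (0 + k1) R1 S1.
exists st; first exact: (exec_seq X1 X2).
rewrite D2 leq_add2r; split=> //.
apply: leq_trans W2 _; rewrite add0n; apply: leq_trans (_ : op_bound * (u1 + n.+1) <= _).
  by rewrite mulnDr leq_add2r.
rewrite leq_mul2l; apply/orP; right; move: Hu1; rewrite /work_const /u_size /u_prep /u_peel.
have b3 : b <= b ^ 3 by rewrite -{1}(expn1 b) leq_pexp2l.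
have b31 : 0 < b ^ 3 by rewrite expn_gt0 b0.
set S := \sum_(_ <= _ < _) _; set P := 10 * q.+1 * round_cost; move: (b ^ 3) b3 b31 => B b3 b31.
have : kappa * b <= kappa * (n + M + B) by rewrite leq_mul2l; apply/orP; right; lia.
clearbody S P; rewrite (_ : (5 * kappa + 3000 + P) * (n + M + B) =
  5 * (kappa * (n + M + B)) + 3000 * (n + M + B) + P * (n + M + B)); last by rewrite 2!(mulnDl _ _ (n + M + B)) mulnA.
move: (kappa * _) (kappa * _) (P * _) => x y z; clear -b3 b31 b0; lia.
Qed.

(** Correctness concerns every halting run, also for coins with [nsurv] never 0; so the induction is
    on the execution and not on the number of rounds. *)
Lemma hash_loop_final st st' : exec hash_loop st st' ->
  (exists s l, [/\ represents mc (st_mem st) s, st_space st <= c_ext mc & loop_inv s l]) ->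
  exists2 s, represents mc (st_mem st') s /\ st_space st' <= c_ext mc & loop_inv s [::].
Proof.
have [c Ec] : exists c, c = hash_loop by eexists.
rewrite -Ec => X; elim: X Ec => {c st st'} //.
- move=> g c [Mem t wk sp] V [Eg Ec] [s [l [R S L]]]; subst g c.
  have [gop gs gd] := guard16 L.
  have [V' [sp' S' E']] := ctl_charge_le t wk R gs S.
  exists s; first by rewrite E'.
  by have := L; rewrite (size0nil (s := l)) // -gd -V' V.
- move=> g c [Mem t wk sp] s2 s3 V X1 _ _ I2 [Eg Ec] [s [l [R S L]]]; subst g c.
  have [gop gs gd] := guard16 L.
  have [V' [sp' S' E']] := ctl_charge_le t wk R gs S.
  have l0 : l != [::] by apply/eqP => E; move: V; rewrite V' gd E.
  apply: I2 => //.
  have [M1 [s1 [k1 [u1 [sp1 [Y1 R1 S1 K1 [l1 L1 _]]]]]]] :=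
    hash_step (t + ops (compile ($16))) (inv_M L l0) L (wk + ops (compile ($16))) R S'.
  rewrite E' in X1; rewrite (exec_det X1 Y1).
  by exists s1, l1.
Qed.

Lemma program_correct st : exec (program q kappa) (State (c_inp mc) 0 0 0) st ->
  (forall v : 'I_n, layer_ok e q v (st_mem st v)) /\ st_space st <= c_ext mc.
Proof.
move=> X; inversion X as [| |c1 c2 sa sb sc X1 Xo| | |]; subst => {X}.
inversion X1 as [| |c1 c2 sa s1 sc Y1 X2| | |]; subst => {X1}.
inversion X2 as [| |c1 c2 sa s2 sc Y2 X3| | |]; subst => {X2}.
inversion X3 as [| |c1 c2 sa s3 sc Y3 Y4| | |]; subst => {X3}.
have [M1 [r1 [k1 [u1 [sp1 [t1 [Z1 R1 S1 K1 [_ _ H1]]]]]]]] :=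
  runs_size_init 0 represents_init (leq0n _).
rewrite (exec_det Y1 Z1) in Y2.
have [M2 [r2 [k2 [u2 [sp2 [Z2 R2 S2 K2 [L2 _]]]]]]] := H1 M1 (0 + k1) sp1 R1 S1.
rewrite (exec_det Y2 Z2) in Y3.
have [r3 [R3 S3] L3] := hash_loop_final Y3 (ex_intro _ r2 (ex_intro _ (iota 0 M) (And3 R2 S2 L2))).
case: s3 Y3 Y4 R3 S3 => M3 t3 w3 sp3 Y3 Y4 R3 S3.
have [M4 [r4 [k4 [u4 [sp4 [Z4 R4 S4 K4 [L4 _]]]]]]] := peel_inv t3 L3 w3 R3 S3.
rewrite (exec_det Y4 Z4) in Xo.
have [st' [Z5 _ _ S5 H5]] := exec_output (t3 + hdepth b (peel_cmd q)) (w3 + k4) R4 S4.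
by rewrite (exec_det Xo Z5); split=> // v; rewrite H5.
Qed.

End Program.

(** * Collision probability of multiplicative hashing *)

Section Windows.
Variables (W D d : nat).
Hypotheses (W_gt0 : 0 < W) (d_gt0 : 0 < d).

(* z is determined by the quotient of [z * d] by W and the quotient of the
   window coordinate [rho z < D] by d. *)
Lemma count_window (P : pred nat) (rho : nat -> nat) :
  (forall z, P z -> rho z < D) ->
  (forall z z', P z -> P z' -> z * d %/ W = z' * d %/ W ->
     rho z %/ d = rho z' %/ d -> z = z') ->
  count P (iota 0 W) <= D + d.
Proof.
move=> rhoD inj; pose c := (D %/ d).+1; pose f z := z * d %/ W * c + rho z %/ d.
have rc z : P z -> rho z %/ d < c by move=> /rhoD/ltnW/(leq_div2r d); rewrite ltnS.
apply: (@leq_trans (d * c)); last first.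
  by rewrite /c mulnS addnC leq_add2r mulnC leq_trunc_div.
rewrite -size_filter -(size_map f) -(size_iota 0 (d * c)); apply: uniq_leq_size.
  rewrite map_inj_in_uniq ?filter_uniq ?iota_uniq // => z z'.
  rewrite !mem_filter => /andP[Pz _] /andP[Pz' _] E.
  have := congr1 (divn^~ c) E; have := congr1 (modn^~ c) E.
  rewrite /f !modnMDl !divnMDl // (modn_small (rc z Pz)) (modn_small (rc z' Pz'))
    (divn_small (rc z Pz)) (divn_small (rc z' Pz')) !addn0 => E1 E2.
  exact: inj.
move=> x /mapP[z]; rewrite mem_filter mem_iota => /andP[Pz zW] ->; rewrite mem_iota add0n /= /f.
have : z * d %/ W < d by rewrite ltn_divLR // mulnC ltn_pmul2l //; lia.
have := rc z Pz; move: (_ %/ W) (_ %/ d) => x1 x2 H1 H2.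
have : x1.+1 * c <= d * c by rewrite leq_mul2r H2 orbT.
by rewrite mulSn; lia.
Qed.

(** As z grows, [z * d] turns d times around the residues modulo [W] in steps of length d, and each
    turn meets the window at most D / d + 1 times. *)
Lemma count_low : count (fun z => z * d %% W < D) (iota 0 W) <= D + d.
Proof.
apply: (@count_window _ (fun z => z * d %% W)) => // z z' _ _ E1 E2.
have H1 := divn_eq (z * d) W; have H2 := divn_eq (z' * d) W.
have H3 := divn_eq (z * d %% W) d; have H4 := divn_eq (z' * d %% W) d.
have L3 := ltn_pmod (z * d %% W) d_gt0; have L4 := ltn_pmod (z' * d %% W) d_gt0.
rewrite E1 in H1; rewrite E2 in H3.
case: (ltngtP z z') => // H; exfalso.
  have : z.+1 * d <= z' * d by rewrite leq_mul2r H orbT.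
  by rewrite mulSn; lia.
have : z'.+1 * d <= z * d by rewrite leq_mul2r H orbT.
by rewrite mulSn; lia.
Qed.

Lemma count_high : count (fun z => W < z * d %% W + D) (iota 0 W) <= D + d.
Proof.
apply: (@count_window _ (fun z => W - 1 - z * d %% W)) => [z|z z' _ _ E1 E2].
  by have := ltn_pmod (z * d) W_gt0; lia.
have H1 := divn_eq (z * d) W; have H2 := divn_eq (z' * d) W.
have M1 := ltn_pmod (z * d) W_gt0; have M2 := ltn_pmod (z' * d) W_gt0.
have H3 := divn_eq (W - 1 - z * d %% W) d; have H4 := divn_eq (W - 1 - z' * d %% W) d.
have L3 := ltn_pmod (W - 1 - z * d %% W) d_gt0; have L4 := ltn_pmod (W - 1 - z' * d %% W) d_gt0.
rewrite E1 in H1; rewrite E2 in H3.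
case: (ltngtP z z') => // H; exfalso.
  have : z.+1 * d <= z' * d by rewrite leq_mul2r H orbT.
  by rewrite mulSn; lia.
have : z'.+1 * d <= z * d by rewrite leq_mul2r H orbT.
by rewrite mulSn; lia.
Qed.

End Windows.

Lemma div_eq_dist D x y : 0 < D -> x %/ D = y %/ D -> x < y + D.
Proof.
move=> D0 E; rewrite [x](divn_eq x D) [y](divn_eq y D) E -addnA ltn_add2l.
by have := ltn_pmod x D0; lia.
Qed.

(** Equal quotients put the two products at distance less than [D], so their difference [z * d] is
    close to 0 on the circle modulo [W], on one side or the other. *)
Lemma window_of_collision W D k d z : 0 < W -> 0 < D ->
  (z * (k + d) %% W) %/ D = (z * k %% W) %/ D ->
  (z * d %% W < D) || (W < z * d %% W + D).
Proof.
move=> W0 D0 E.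
have := div_eq_dist D0 E; have := div_eq_dist D0 (esym E).
rewrite mulnDr -modnDm.
have := ltn_pmod (z * k) W0; have := ltn_pmod (z * d) W0.
move: (z * k %% W) (z * d %% W) => y u uW yW.
case: (ltnP (y + u) W) => H; first by rewrite modn_small //; lia.
have -> : (y + u) %% W = y + u - W.
  by rewrite -[in LHS](subnK H) modnDr modn_small //; lia.
by lia.
Qed.

(** Two windows with at most D + d multipliers each, and the difference d of the keys is below [K],
    hence below [D]. This is why buckets have width at least n^2, the bound of the keys. *)
Lemma count_collisions W D K k k' : 0 < W -> 0 < D -> K <= D -> k < K -> k' < K -> k != k' ->
  count (fun z => (z * k %% W) %/ D == (z * k' %% W) %/ D) (iota 0 W) <= 4 * D.
Proof.
move=> W0 D0; wlog kk : k k' / k' < k => [H KD kK kK' ne|KD kK kK' _].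
  case: (ltngtP k k') (ne) => // lt _; last exact: H.
  rewrite (eq_count (a2 := fun z => (z * k' %% W) %/ D == (z * k %% W) %/ D)).
    by apply: H => //; rewrite eq_sym.
  by move=> z; rewrite eq_sym.
pose d := k - k'; have d0 : 0 < d by rewrite subn_gt0.
have kE : k = k' + d by rewrite subnKC // ltnW.
apply: (@leq_trans (count (predU (fun z => z * d %% W < D) (fun z => W < z * d %% W + D)) (iota 0 W))).
  by apply: sub_count => z /eqP; rewrite kE; apply: window_of_collision.
apply: leq_trans (_ : (D + d) + (D + d) <= _); last by rewrite /d; lia.
apply: leq_trans (leq_add (count_low D W0 d0) (count_high D W0 d0)).
by rewrite -count_predUI leq_addr.
Qed.

Lemma count_has (T U : Type) (P : T -> U -> bool) (s : seq T) (r : seq U) :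
  count (fun z => has (P z) r) s <= \sum_(a <- r) count (P^~ a) s.
Proof.
elim: r => [|a r IH]; first by rewrite big_nil (eq_count (a2 := pred0)) ?count_pred0.
rewrite big_cons; apply: leq_trans (leq_add (leqnn _) IH).
by rewrite -count_predUI leq_addr.
Qed.

(** Each of the M arcs rules out at most [4 * Dv] multipliers; this makes at most half of them,
    which explains the bucket width 2 ^ w / 8 M. *)
Lemma count_collides mc n off dst src Dv a (M := off n) :
  (forall a, a < M -> key n dst src a < n * n) ->
  0 < Dv -> n * n <= Dv -> a < M -> 8 * (M * Dv) <= 2 ^ c_w mc ->
  2 * count (collides mc n off dst src Dv ^~ a) (iota 0 (2 ^ c_w mc)) <= 2 ^ c_w mc.
Proof.
move=> kn D0 nD aM MD; apply: leq_trans MD; rewrite (_ : 8 * (M * Dv) = 2 * (M * (4 * Dv))); last by lia.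
rewrite leq_mul2l /=; apply: leq_trans (count_has _ _ _) _.
apply: (@leq_trans (\sum_(a' <- iota 0 M) 4 * Dv)); last first.
  by rewrite big_const_seq count_predT size_iota iter_addn_0 mulnC.
rewrite big_seq [leqRHS]big_seq; apply: leq_sum => a'; rewrite mem_iota add0n => /andP[_ aM'].
case: eqP => [_|/eqP ne] /=; first by rewrite (eq_count (a2 := pred0)) ?count_pred0.
exact: (count_collisions (W_gt0 mc) D0 nD (kn _ aM') (kn _ aM) ne).
Qed.

(** * Halting runs read finitely many coins *)

Section Locality.
Variables (w : nat) (arb : arbiter).

Lemma exec_mono rnd c s s' : exec w arb rnd c s s' ->
  st_depth s <= st_depth s' /\ st_space s <= st_space s'.
Proof.
elim=> {c s s'} //=.
- by move=> p g a v s; split; [rewrite -addnA leq_addr | rewrite !leq_max leqnn].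
- by move=> c1 c2 s1 s2 s3 _ [? ?] _ [? ?]; split; lia.
- by move=> b c1 c2 s s' _ [H1 H2]; split; lia.
- by move=> b c s _; split; lia.
- by move=> b c s1 s2 s3 _ _ [? ?] _ [? ?]; split; lia.
Qed.

Lemma pardo_mem_local rnd rnd' t M p g a v :
  (forall i, i < p -> rnd t i = rnd' t i) ->
  pardo_mem w arb rnd t M p g a v = pardo_mem w arb rnd' t M p g a v.
Proof.
move=> H; apply/funext => x; rewrite /pardo_mem.
have -> : [seq i <- iota 0 p | (value w M i (rnd t i) g != 0) && (value w M i (rnd t i) a == x)] =
          [seq i <- iota 0 p | (value w M i (rnd' t i) g != 0) && (value w M i (rnd' t i) a == x)].
  by apply: eq_in_filter => i; rewrite mem_iota add0n => /andP[_ ip]; rewrite H.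
case E : [seq _ <- _ | _] => [//|y s]; rewrite -E; rewrite H //.
have : nth 0 [seq i <- iota 0 p | (value w M i (rnd' t i) g != 0) && (value w M i (rnd' t i) a == x)]
  (arb t M x [seq i <- iota 0 p | (value w M i (rnd' t i) g != 0) && (value w M i (rnd' t i) a == x)]
   %% size [seq i <- iota 0 p | (value w M i (rnd' t i) g != 0) && (value w M i (rnd' t i) a == x)])
  \in [seq i <- iota 0 p | (value w M i (rnd' t i) g != 0) && (value w M i (rnd' t i) a == x)].
  by apply: mem_nth; rewrite ltn_mod E.
by rewrite mem_filter mem_iota add0n => /andP[_ /andP[_ ?]].
Qed.

Lemma pardo_extent_local rnd rnd' t M p g a v :
  (forall i, i < p -> rnd t i = rnd' t i) ->
  pardo_extent w rnd t M p g a v = pardo_extent w rnd' t M p g a v.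
Proof. by move=> H; rewrite /pardo_extent; apply: eq_bigr => i _; rewrite H. Qed.

(** Times are bounded by the final depth, and processor indices by the space, because processors
    count as space. Measurability of the event that a run is fast rests on this. *)
Lemma exec_local rnd rnd' T S c s s' :
  (forall t i, t <= T -> i <= S -> rnd t i = rnd' t i) ->
  exec w arb rnd c s s' -> st_depth s' <= T -> st_space s' <= S ->
  exec w arb rnd' c s s'.
Proof.
move=> HR; have ctl b s0 : st_depth s0 <= T ->
  ctl_value w rnd s0 b = ctl_value w rnd' s0 b /\ ctl_charge w rnd s0 b = ctl_charge w rnd' s0 b.
  by move=> H; rewrite /ctl_value /ctl_charge HR.
elim=> {c s s'}.
- by move=> s _ _; apply: exec_skip.
- move=> p g a v s; rewrite /pardo; cbv zeta.
  set s0 := ctl_charge w rnd s p; set N := ctl_value w rnd s p.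
  move=> HT; rewrite [st_space _]/= => HS.
  have {}HT : st_depth s0 <= T by move: HT; rewrite [st_depth _]/=; apply: leq_trans; rewrite leq_addr.
  have HN : N <= S by apply: leq_trans HS; rewrite !leq_max leqnn !orbT.
  have HT0 : st_depth s <= T by apply: leq_trans HT; rewrite /s0 /= leq_addr.
  have [E1 E2] := ctl p s HT0.
  have R i : i < N -> rnd (st_depth s0) i = rnd' (st_depth s0) i.
    by move=> iN; apply: HR => //; apply: leq_trans HN; apply: ltnW.
  have -> : State (pardo_mem w arb rnd (st_depth s0) (st_mem s) N g a v)
    (st_depth s0 + (ops g + ops a + ops v).+1) (st_work s0 + N * (ops g + ops a + ops v).+1)
    (maxn (st_space s0) (maxn N (pardo_extent w rnd (st_depth s0) (st_mem s) N g a v))) =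
    pardo w arb rnd' s p g a v; last exact: exec_pardo.
  by rewrite /pardo -E1 -E2 -/N -/s0 (pardo_mem_local _ _ _ _ R) (pardo_extent_local _ _ _ _ R).
- move=> c1 c2 s1 s2 s3 _ I1 X2 I2 HT HS; have [? ?] := exec_mono X2.
  by apply: exec_seq (I1 _ _) (I2 HT HS); lia.
- move=> b c1 c2 s s' X I1 HT HS; have [H1 H2] := exec_mono X.
  have [E1 E2] : ctl_value w rnd s b = ctl_value w rnd' s b /\ ctl_charge w rnd s b = ctl_charge w rnd' s b.
    by apply: ctl; move: H1; rewrite /ctl_charge /=; lia.
  by apply: exec_if; rewrite -E1 -E2; apply: I1.
- move=> b c s V HT HS.
  have [E1 E2] : ctl_value w rnd s b = ctl_value w rnd' s b /\ ctl_charge w rnd s b = ctl_charge w rnd' s b.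
    by apply: ctl; move: HT; rewrite /ctl_charge /=; lia.
  by rewrite E2; apply: exec_while_end; rewrite -E1.
- move=> b c s1 s2 s3 V X1 I1 X2 I2 HT HS; have [? ?] := exec_mono X2; have [H1 H2] := exec_mono X1.
  have [E1 E2] : ctl_value w rnd s1 b = ctl_value w rnd' s1 b /\ ctl_charge w rnd s1 b = ctl_charge w rnd' s1 b.
    by apply: ctl; move: H1; rewrite /ctl_charge /=; lia.
  apply: (@exec_while_loop _ _ _ _ _ _ s2); first by rewrite -E1.
    by rewrite -E2; apply: I1; lia.
  exact: I2.
Qed.

End Locality.

(** * Arcs as positions in the flattened adjacency lists *)

Section AdjacencyArrays.
Variables (n : nat) (ss : seq (seq nat)).
Local Notation A := (nth [::] ss).
Hypotheses (ss_size : size ss = n) (ss_uniq : forall u, u < n -> uniq (A u))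
  (ss_lt : forall u v, u < n -> v \in A u -> v < n)
  (ss_sym : forall u v, u < n -> v \in A u -> u \in A v)
  (ss_irr : forall u, u < n -> u \notin A u).

Definition arc_off k := sumn (take k (shape ss)).
Definition arc_dst a := nth 0 (flatten ss) a.
Definition arc_src a := reshape_index (shape ss) a.
Definition arc_twin a :=
  flatten_index (shape ss) (arc_dst a) (index (arc_src a) (A (arc_dst a))).

Local Notation off := arc_off.
Local Notation dst := arc_dst.
Local Notation src := arc_src.
Local Notation tw := arc_twin.
Local Notation M := (off n).

Lemma nth_shape u : nth 0 (shape ss) u = size (A u).
Proof.
case: (ltnP u (size ss)) => H; first by rewrite (nth_map [::]).
by rewrite !nth_default // size_map.
Qed.

Lemma size_shape : size (shape ss) = n. Proof. by rewrite size_map. Qed.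

Lemma arc_count : M = size (flatten ss).
Proof. by rewrite size_flatten /off -size_shape take_size. Qed.

Lemma arc_offS u : u < n -> off u.+1 = off u + size (A u).
Proof.
move=> un; rewrite /off (take_nth 0) ?size_shape // -cats1 sumn_cat /= addn0.
by rewrite nth_shape.
Qed.

Lemma arc_off_mono u v : u <= v -> v <= n -> off u <= off v.
Proof.
move=> uv vn; elim: v uv vn => [|v IH] uv vn; first by have -> : u = 0 by lia.
case: (ltngtP u v.+1) uv => // [H|->] _ //.
by rewrite arc_offS // (leq_trans (IH _ _)) ?leq_addr //; lia.
Qed.

Lemma flatten_index_lt u r : u < n -> r < size (A u) -> flatten_index (shape ss) u r < M.
Proof.
move=> un rA; apply: (@leq_trans (off u.+1)); last exact: arc_off_mono.
by rewrite arc_offS // /flatten_index ltn_add2l.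
Qed.

Lemma arc_src_index u r : r < size (A u) -> src (flatten_index (shape ss) u r) = u.
Proof. by move=> rA; rewrite /src flatten_indexKl // nth_shape. Qed.

Lemma arc_dst_index u r : r < size (A u) -> dst (flatten_index (shape ss) u r) = nth 0 (A u) r.
Proof. by move=> rA; rewrite /dst nth_flatten flatten_indexKl ?flatten_indexKr ?nth_shape. Qed.

Lemma arcP a : a < M -> exists u r,
  [/\ u < n, r < size (A u) & a = flatten_index (shape ss) u r].
Proof.
rewrite /off -size_shape take_size => aM.
exists (reshape_index (shape ss) a), (reshape_offset (shape ss) a).
split; first exact: reshape_indexP.
  by rewrite -nth_shape reshape_offsetP.
by rewrite reshape_indexK.
Qed.

Lemma arc_src_lt a : a < M -> src a < n.
Proof. by move=> /arcP[u [r [un rA ->]]]; rewrite arc_src_index. Qed.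

Lemma arc_src_off a : a < M -> off (src a) <= a < off (src a).+1.
Proof.
move=> /arcP[u [r [un rA ->]]]; rewrite arc_src_index // arc_offS // /flatten_index.
by rewrite leq_addr ltn_add2l.
Qed.

Lemma arc_dst_mem a : a < M -> dst a \in A (src a).
Proof. by move=> /arcP[u [r [un rA ->]]]; rewrite arc_src_index // arc_dst_index // mem_nth. Qed.

Lemma arc_dst_lt a : a < M -> dst a < n.
Proof. by move=> aM; apply: ss_lt (arc_src_lt aM) (arc_dst_mem aM). Qed.

Lemma arc_simple a a' : a < M -> a' < M -> src a = src a' -> dst a = dst a' -> a = a'.
Proof.
move=> /arcP[u [r [un rA ->]]] /arcP[u' [r' [un' rA' ->]]].
rewrite !arc_src_index // => E; rewrite -E in rA' *; rewrite !arc_dst_index // => /eqP.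
by rewrite nth_uniq ?ss_uniq // => /eqP->.
Qed.

Lemma arc_noloop a : a < M -> src a != dst a.
Proof.
move=> aM; apply/eqP => E; have := arc_dst_mem aM; rewrite -E => H.
by have := ss_irr (arc_src_lt aM); rewrite H.
Qed.

Lemma arc_twin_index a : a < M -> index (src a) (A (dst a)) < size (A (dst a)).
Proof. by move=> aM; rewrite index_mem ss_sym ?arc_dst_mem ?arc_src_lt. Qed.

Lemma arc_twin_lt a : a < M -> tw a < M.
Proof. by move=> aM; apply: flatten_index_lt (arc_dst_lt aM) (arc_twin_index aM). Qed.

Lemma arc_src_twin a : a < M -> src (tw a) = dst a.
Proof. by move=> aM; rewrite /tw arc_src_index ?arc_twin_index. Qed.

Lemma arc_dst_twin a : a < M -> dst (tw a) = src a.
Proof.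
move=> aM; rewrite /tw arc_dst_index ?arc_twin_index //.
by rewrite nth_index // -index_mem arc_twin_index.
Qed.

Lemma arcs_mem u v : u < n -> arcs off dst u v = (v \in A u).
Proof.
move=> un; rewrite /arcs /odeg arc_offS // addKn -count_uniq_mem ?ss_uniq //.
rewrite -sum1_count (big_nth 0) big_mkord big_mkcond /psum; apply: eq_bigr => -[r rA] _ /=.
by rewrite -/(flatten_index (shape ss) u r) arc_dst_index //; case: eqP.
Qed.

End AdjacencyArrays.

(** * The input words of a graph and the choice of the word size *)

Section GraphArrays.
Variables (n : nat) (e : rel 'I_n) (adj : 'I_n -> seq 'I_n).
Hypotheses (e_sym : symmetric e) (e_irr : irreflexive e) (He : adjacency_lists e adj).

Definition rows : seq (seq nat) := [seq [seq val v | v <- adj u] | u <- enum 'I_n].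

Lemma rows_size : size rows = n.
Proof. by rewrite size_map size_enum_ord. Qed.

Lemma rows_nth (u : 'I_n) : nth [::] rows u = [seq val v | v <- adj u].
Proof. by rewrite (nth_map u) ?size_enum_ord // nth_ord_enum. Qed.

Lemma rows_mem (u v : 'I_n) : ((v : nat) \in nth [::] rows u) = e u v.
Proof. by rewrite rows_nth mem_map ?He.2 //; exact: val_inj. Qed.

Lemma rows_uniq u : u < n -> uniq (nth [::] rows u).
Proof.
move=> un; rewrite (rows_nth (Ordinal un)) map_inj_uniq; [exact: He.1 | exact: val_inj].
Qed.

Lemma rows_lt u v : u < n -> v \in nth [::] rows u -> v < n.
Proof. by move=> un; rewrite (rows_nth (Ordinal un)) => /mapP[w _ ->]; exact: ltn_ord. Qed.

Lemma rows_sym u v : u < n -> v \in nth [::] rows u -> u \in nth [::] rows v.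
Proof.
move=> un vu; have vn := rows_lt un vu.
by move: vu; rewrite (rows_mem (Ordinal un) (Ordinal vn)) (rows_mem (Ordinal vn) (Ordinal un)) e_sym.
Qed.

Lemma rows_irr u : u < n -> u \notin nth [::] rows u.
Proof. by move=> un; rewrite (rows_mem (Ordinal un) (Ordinal un)) e_irr. Qed.

Lemma take_enum_ord k : k <= n -> take k (enum 'I_n) = [seq u : 'I_n <- enum 'I_n | u < k].
Proof.
move=> kn; apply: (inj_map val_inj); rewrite map_take val_enum_ord take_iota.
rewrite -(filter_map val (fun i => i < 0 + k)) val_enum_ord filter_iota_ltn //.
by have -> : minn k n = k by lia.
Qed.

Lemma offset_words k : k <= n -> \sum_(u < n | u < k) size (adj u) = arc_off rows k.
Proof.
move=> kn; rewrite /arc_off /shape /rows -map_comp -map_take take_enum_ord // sumnE big_map.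
by rewrite big_filter big_enum_cond; apply: eq_bigr => u _; rewrite /= size_map.
Qed.

Lemma words_arrays : graph_words adj = n :: [seq arc_off rows k | k <- iota 0 n.+1] ++ flatten rows.
Proof.
rewrite /graph_words; congr (_ :: _ ++ _); apply/eq_in_map => k; rewrite mem_iota add0n => /andP[_ kn].
exact: offset_words.
Qed.

Local Notation M := (arc_off rows n).
Local Notation inp := (nth 0 (graph_words adj)).

Lemma words_n : inp 0 = n. Proof. by rewrite words_arrays. Qed.

Lemma words_off v : v <= n -> inp v.+1 = arc_off rows v.
Proof.
move=> vn; rewrite words_arrays -[LHS]/(nth 0 (map (arc_off rows) (iota 0 n.+1) ++ flatten rows) v) nth_cat.
by rewrite size_map size_iota ltnS vn (nth_map 0) ?size_iota // nth_iota.
Qed.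

Lemma words_dst a : inp (n + 2 + a) = arc_dst rows a.
Proof.
have -> : n + 2 + a = (n.+1 + a).+1 by lia.
rewrite words_arrays -[LHS]/(nth 0 (map (arc_off rows) (iota 0 n.+1) ++ flatten rows) (n.+1 + a)).
by rewrite nth_cat size_map size_iota ltnNge leq_addr addKn.
Qed.

Lemma words_out x : n + M + 2 <= x -> inp x = 0.
Proof.
move=> H; have -> : x = n + 2 + (x - (n + 2)) by lia.
by rewrite words_dst /arc_dst nth_default // -(arc_count rows_size); lia.
Qed.

Lemma words_lt x : inp x < n + M + 1.
Proof.
case: x => [|x]; first by rewrite words_n; lia.
case: (leqP x n) => xn.
  by rewrite words_off //; have := arc_off_mono rows_size xn (leqnn n); lia.
have -> : x.+1 = n + 2 + (x.+1 - (n + 2)) by lia.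
rewrite words_dst; case: (ltnP (x.+1 - (n + 2)) M) => H.
  by have := arc_dst_lt rows_size rows_lt H; lia.
by rewrite /arc_dst nth_default ?addn1 // -(arc_count rows_size).
Qed.

Lemma size_adj u : size (adj u) = #|[set v | e u v]|.
Proof.
rewrite cardE -(size_map val) -[RHS](size_map val).
apply/perm_size/uniq_perm.
- by rewrite map_inj_uniq; [exact: He.1 | exact: val_inj].
- by rewrite map_inj_uniq ?enum_uniq //; exact: val_inj.
- by apply: eq_mem_map => v; rewrite mem_enum inE He.2.
Qed.

Lemma arcs_sum : M = \sum_(u < n) size (adj u).
Proof. by rewrite -offset_words //; apply: eq_bigl => u; rewrite ltn_ord. Qed.

Lemma arcs_sq : M <= n * n.
Proof.
rewrite arcs_sum; apply: (@leq_trans (\sum_(u < n) n)); last by rewrite sum_nat_const card_ord.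
by apply: leq_sum => u _; rewrite size_adj -[leqRHS](card_ord n) max_card.
Qed.

Lemma arcs_edges : M <= 2 * nb_edges e.
Proof.
rewrite arcs_sum.
have -> : \sum_(u < n) size (adj u) = #|[set uv : 'I_n * 'I_n | e uv.1 uv.2]|.
  rewrite -sum1dep_card -(pair_big_dep xpredT (fun u v => e u v) (fun _ _ => 1)) /=.
  by apply: eq_bigr => u _; rewrite size_adj -sum1dep_card.
pose U := [set uv : 'I_n * 'I_n | e uv.1 uv.2 & uv.1 < uv.2].
pose sw (uv : 'I_n * 'I_n) := (uv.2, uv.1).
apply: (@leq_trans #|U :|: sw @: U|).
  apply: subset_leq_card; apply/fintype.subsetP => -[u v]; rewrite !inE /= => euv.
  rewrite euv /=; case: (ltngtP u v) => //= [vu|uv].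
    by apply/imsetP; exists (v, u); rewrite ?inE //= e_sym euv.
  by move: euv; rewrite (val_inj uv) e_irr.
apply: leq_trans (leq_card_setU _ _) _; rewrite mul2n -addnn leq_add2l.
exact: leq_imset_card.
Qed.

Variable q : nat.
Hypotheses (n_gt0 : 0 < n) (q_gt0 : 0 < q).
Local Notation b := (trunc_log 2 n).+1.
Local Notation kappa := (q + 100).
Local Notation w := (word_size kappa n).
Local Notation len := (1000 * (n + M + 1)).
Local Notation Dv := (2 ^ w.-1 %/ (4 * M + 1)).

Lemma n_lt_pow : n < 2 ^ b. Proof. by have /andP[] := trunc_log_bounds (isT : 1 < 2) n_gt0. Qed.

Lemma n_ge_pow : 2 ^ b.-1 <= n. Proof. by have /andP[] := trunc_log_bounds (isT : 1 < 2) n_gt0. Qed.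

Lemma b_le_n : b <= n.
Proof. by apply: leq_trans n_ge_pow; rewrite ltn_expl. Qed.

Local Notation X := (2 ^ b).

(** All quantities are compared with powers of X, starting from n < X and n + M < X^2.
    [kappa = q + 100] exceeds every exponent that occurs, and it involves q because numbers like
    [2 * q * b] must fit in a word. *)
Lemma word_pow : 2 ^ w = X ^ kappa. Proof. by rewrite /word_size mulnC expnM. Qed.

Lemma X_ge2 : 2 <= X. Proof. by rewrite -{1}(expn1 2) leq_exp2l. Qed.

(** Trades a constant factor of at most [2 ^ j] for j further powers of X. *)
Lemma pow_shift j k : 2 ^ j * X ^ k <= X ^ (j + k).
Proof.
rewrite expnD leq_mul2r; apply/orP; right; case: j => // j.
by rewrite leq_exp2r // X_ge2.
Qed.

Lemma pow_lt k : k < kappa -> X ^ k < 2 ^ w.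
Proof. by move=> H; rewrite word_pow ltn_exp2l ?X_ge2. Qed.

Lemma nM_le : n + M + 1 <= X ^ 2.
Proof.
have : n.+1 * n.+1 <= X * X by apply: leq_mul; exact: n_lt_pow.
by have := arcs_sq; rewrite -mulnn; nia.
Qed.

Lemma len_le : len <= X ^ 12.
Proof.
apply: leq_trans (pow_shift 10 2); apply: leq_mul; last exact: nM_le.
by apply: (@leq_trans (2 ^ 10)).
Qed.

Lemma ext_lt : n + M + 2 + len * 48 < 2 ^ w.
Proof.
apply: leq_ltn_trans (pow_lt (_ : 18 < kappa)); last by lia.
apply: leq_trans (pow_shift 6 12); have := len_le; move: (X ^ 12) => Y.
by rewrite -[2 ^ 6]/64; lia.
Qed.

Lemma len_sq_lt : 4 * (len * len) < 2 ^ w.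
Proof.
apply: leq_ltn_trans (pow_lt (_ : 26 < kappa)); last by lia.
apply: leq_trans (pow_shift 2 24); rewrite -[2 ^ 2]/4 leq_mul2l /= -[24]/(12 + 12) expnD.
by apply: leq_mul; exact: len_le.
Qed.

Lemma len_ge_1000 : 1000 <= len. Proof. by rewrite -{1}[1000]muln1 leq_mul2l; lia. Qed.

Lemma b_len : 10 * b <= len. Proof. by have := b_le_n; lia. Qed.

Lemma len_pow : len <= 2 ^ (20 * b).
Proof.
apply: leq_trans len_le _; rewrite [20 * b]mulnC expnM leq_exp2l ?X_ge2 //.
Qed.

Lemma pow_lt_W k j : j + k < kappa -> 2 ^ j * 2 ^ (k * b) < 2 ^ w.
Proof.
move=> H; apply: leq_ltn_trans (pow_lt H); apply: leq_trans (pow_shift j k).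
by rewrite [k * b]mulnC expnM.
Qed.

Lemma kappa_lt : 4 * kappa < 2 ^ kappa.
Proof.
have -> : kappa = q + 95 + 5 by lia.
by rewrite expnD -[2 ^ 5]/32; have := ltn_expl (q + 95) (isT : 1 < 2); lia.
Qed.

Lemma w_ge : kappa <= w. Proof. by rewrite /word_size leq_pmulr. Qed.

Lemma kappa_W : 4 * kappa < 2 ^ w.
Proof. by apply: leq_trans kappa_lt _; rewrite leq_exp2l // w_ge. Qed.

Lemma w_W : w + 1 < 2 ^ w.
Proof.
have := w_ge; move: (w) => v vk; have -> : v = v - 1 + 1 by lia.
by rewrite expnD expn1; have := ltn_expl (v - 1) (isT : 1 < 2); lia.
Qed.

Lemma q_W : 2 * q < 2 ^ w.
Proof. by apply: leq_ltn_trans kappa_W; lia. Qed.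

Lemma qb_W : 2 * q * b + 1 < 2 ^ w.
Proof.
apply: leq_ltn_trans (pow_lt (_ : 2 + q.+1 < kappa)); last by lia.
apply: leq_trans (pow_shift 2 q.+1); rewrite -[2 ^ 2]/4 expnS.
have H1 : q <= X ^ q.
  by apply: leq_trans (ltnW (ltn_expl q (isT : 1 < 2))) _; rewrite leq_exp2r // X_ge2.
have H2 : b <= X by apply: ltnW; apply: ltn_expl.
have H3 : q * b <= X ^ q * X by apply: leq_mul.
have H4 : 0 < X ^ q * X by rewrite muln_gt0 expn_gt0 expn_gt0.
by rewrite -mulnA [X * _]mulnC; move: (_ * X) (q * b) H3 H4 => y z; lia.
Qed.

Lemma M4_le : 4 * M + 1 <= X ^ 4.
Proof.
apply: leq_trans (pow_shift 2 2); have := nM_le; move: (X ^ 2) => Y.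
by rewrite -[2 ^ 2]/4; lia.
Qed.

Lemma half_ge : X ^ 6 <= 2 ^ w.-1.
Proof.
rewrite -expnM leq_exp2l //; have : 101 * b <= w by rewrite /word_size leq_mul2r; apply/orP; right; lia.
by lia.
Qed.

Lemma M_half : 4 * M + 1 <= 2 ^ w.-1.
Proof.
apply: leq_trans M4_le (leq_trans _ half_ge); by rewrite leq_exp2l ?X_ge2.
Qed.

Lemma nn_bucket : n * n <= Dv.
Proof.
rewrite leq_divRL; last by lia.
apply: leq_trans half_ge; rewrite (expnD X 2 4); apply: leq_mul; last exact: M4_le.
by rewrite -mulnn; apply: leq_mul; apply: ltnW; exact: n_lt_pow.
Qed.

Lemma M_bucket : 8 * (M * Dv) <= 2 ^ w.
Proof.
have w0 : 0 < w by have := w_ge; lia.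
rewrite -[in leqRHS](prednK w0) expnS.
have H : Dv * (4 * M + 1) <= 2 ^ w.-1 by exact: leq_trunc_div.
set D := Dv in H *; set Y := 2 ^ w.-1 in H *; clearbody D; clearbody Y.
by clear -H; lia.
Qed.

Lemma machine :
  exists bad : nat -> pred nat,
    (forall a, a < M -> 2 * count (bad a) (iota 0 (2 ^ w)) <= 2 ^ w) /\
    forall arb rnd, (forall t i, rnd t i < 2 ^ w) ->
    let sv r := count (fun a =>
      all (fun r' => bad a (rnd (seed_time kappa b r') 0)) (iota 0 r)) (iota 0 M) in
    (forall st, exec w arb rnd (program q kappa) (State inp 0 0 0) st ->
       (forall v : 'I_n, layer_ok e q v (st_mem st v)) /\
       st_space st <= n + M + 2 + len * 48) /\
    (forall r, sv r = 0 ->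
       exists2 st, exec w arb rnd (program q kappa) (State inp 0 0 0) st &
         st_depth st <= final_time q kappa b r /\
         st_work st <= op_bound * (work_const q kappa * (n + M + b ^ 3) +
           \sum_(0 <= i < r) 301 * (sv i + if i < 2 * b then b else b * sv i))).
Proof.
have inpW x : inp x < 2 ^ w by apply: leq_ltn_trans (ltnW (words_lt x)) _; have := ext_lt; lia.
have baseE : inp 0 + inp (inp 0).+1 + 2 = n + M + 2 by rewrite words_n words_off.
have ext_ge : inp 0 + inp (inp 0).+1 + 2 + len * NA <= n + M + 2 + len * 48 by rewrite baseE.
pose mc arb rnd (rndW : forall t i, rnd t i < 2 ^ w) : config :=
  @Config w arb rnd inp len (n + M + 2 + len * 48) b inpW rndW ext_ge ext_lt len_ge_1000
    len_sq_lt isT b_len len_pow (@pow_lt_W 20 2 ltac:(lia)).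
have G arb rnd rndW : csr (@mc arb rnd rndW) n (arc_off rows) (arc_dst rows).
  split.
  - exact: words_n.
  - exact: words_off.
  - by move=> a _; exact: words_dst.
  - by rewrite /arc_off take0.
  - exact: arc_off_mono rows_size.
  - exact: arc_dst_lt rows_size rows_lt.
  - exact: leqnn.
(* [bad] has to be chosen before the coins and the arbiter. [collides] takes only the word size from
   the configuration, so a machine with null words can define it. *)
pose mc0 := @mc (fun _ _ _ _ => 0) (fun _ _ => 0) (fun _ _ => ltac:(by rewrite expn_gt0)).
have G0 : csr mc0 n (arc_off rows) (arc_dst rows) by exact: G.
have srcl := arc_src_lt rows_size; have srco := arc_src_off rows_size.
have simp := arc_simple rows_size rows_uniq; have nol := arc_noloop rows_size rows_irr.
have twl := arc_twin_lt rows_size rows_lt rows_sym.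
have srct := arc_src_twin rows_size rows_sym; have dstt := arc_dst_twin rows_size rows_sym.
exists (fun a z => collides mc0 n (arc_off rows) (arc_dst rows) (arc_src rows) Dv z a); split.
  move=> a aM; apply: (@count_collides mc0) => //.
  - by move=> a' aM'; exact: (key_lt G0 srcl aM').
  - by apply: leq_trans nn_bucket; rewrite muln_gt0 n_gt0.
  - exact: nn_bucket.
  - exact: M_bucket.
move=> arb rnd rndW sv.
have arcsE (u v : 'I_n) : arcs (arc_off rows) (arc_dst rows) u v = e u v.
  by rewrite (arcs_mem rows_size rows_uniq) // rows_mem.
have bW : 4 * 2 ^ (2 * b) < 2 ^ w by apply: (@pow_lt_W 2 2); lia.
have out x : base (mc arb rnd rndW) <= x -> inp x = 0 by rewrite /base /= baseE; exact: words_out.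
split.
  exact: (@program_correct (mc arb rnd rndW) n _ _ _ _ e q kappa (G _ _ _) srcl srco simp nol twl
    srct dstt n_lt_pow n_ge_pow e_sym q_gt0 arcsE (erefl _) kappa_W w_W q_W qb_W bW M_half out).
exact: (@program_halts (mc arb rnd rndW) n _ _ _ _ e q kappa (G _ _ _) srcl srco simp nol twl
    srct dstt n_lt_pow n_ge_pow e_sym q_gt0 arcsE (erefl _) kappa_W w_W q_W qb_W bW M_half out).
Qed.

End GraphArrays.

(** For k = b - 1 it bounds b^3 by 16 n, so the polylogarithmic part of the work disappears in
    O(n). *)
Lemma cube_le_exp k : k.+1 ^ 3 <= 16 * 2 ^ k.
Proof.
elim: k => // k IH; case: (ltnP k 3) => k3; first by case: k k3 {IH} => [|[|[|]]].
rewrite (expnS 2 k) mulnCA; apply: leq_trans (leq_mul (leqnn 2) IH).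
by rewrite !expnS expn0; nia.
Qed.

(** Preparation and peeling have loop nesting at most 3, while [c * b] hash rounds of depth O(b) add
    only O(b^2). *)
Lemma final_time_bound q kappa c :
  exists D, forall b, 0 < b -> final_time q kappa b (c * b) <= D * b ^ 3.
Proof.
have [C1 H1] := hdepth_bound (prepare_cmd kappa).
have [C2 H2] := hdepth_bound hash_round.
have [C3 H3] := hdepth_bound (peel_cmd q).
have [C4 H4] := hdepth_bound size_step.
have [C5 H5] := hdepth_bound (HSet 1 (HC 1)).
pose g1 := ops (compile size_guard); pose g2 := ops (compile ($16)).
exists (C5 + (g1 + C4) + g1 + C1 + c * (g2 + C2) + g2 + C3 + output_time) => b b0.
rewrite /final_time /loop_time /size_time /round_time -/g1 -/g2.
have pb k : k <= 3 -> b ^ k <= b ^ 3 by move=> k3; rewrite leq_pexp2l.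
have B1 : 0 < b ^ 3 by rewrite expn_gt0 b0.
have N1 : nest (prepare_cmd kappa) <= 3 by [].
have N2 : nest hash_round = 1 by [].
have N3 : nest (peel_cmd q) <= 3 by [].
have H1b : hdepth b (prepare_cmd kappa) <= C1 * b ^ 3.
  by apply: leq_trans (H1 b b0) _; rewrite leq_mul2l pb ?orbT.
have H3b : hdepth b (peel_cmd q) <= C3 * b ^ 3.
  by apply: leq_trans (H3 b b0) _; rewrite leq_mul2l pb ?orbT.
have H5b : hdepth b (HSet 1 (HC 1)) <= C5 * b ^ 3.
  by apply: leq_trans (H5 b b0) _; rewrite leq_mul2l pb ?orbT.
have step g C h : h <= C * b -> b * (g + h) <= (g + C) * b ^ 3.
  move=> hC; apply: (@leq_trans (b * ((g + C) * b))).
    rewrite leq_mul2l mulnDl; apply/orP; right; apply: leq_add; last exact: hC.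
    exact: leq_pmulr.
  rewrite mulnCA leq_mul2l; apply/orP; right.
  by rewrite mulnn pb.
have H4b := step g1 C4 _ (leq_trans (H4 b b0) (_ : C4 * b ^ 0 <= C4 * b)).
have {}H4b : b * (g1 + hdepth b size_step) <= (g1 + C4) * b ^ 3.
  by apply: H4b; rewrite leq_mul2l expn0 b0 orbT.
have H2b : b * (g2 + hdepth b hash_round) <= (g2 + C2) * b ^ 3.
  by apply: step; apply: leq_trans (H2 b b0) _; rewrite N2 expn1.
have H2c : c * b * (g2 + hdepth b hash_round) <= c * (g2 + C2) * b ^ 3.
  by rewrite -!mulnA leq_mul2l H2b orbT.
have k1 x : x <= x * b ^ 3 by rewrite leq_pmulr.
rewrite !mulnDl; move: H1b H3b H5b H4b H2c (k1 g1) (k1 g2) (k1 output_time).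
rewrite !mulnDl; clear; lia.
Qed.

(** The terms b of the first [2 * b] rounds add up to at most 2 b^2. A combination of the [sv i]
    with fixed coefficients remains, the form that [expected_cost] treats. *)
Lemma work_split O b (sv : nat -> nat) A r :
  O * (A + \sum_(0 <= i < r) 301 * (sv i + if i < 2 * b then b else b * sv i)) <=
  O * (A + 301 * (2 * b * b)) +
  \sum_(i < r) O * (301 * (1 + if i < 2 * b then 0 else b)) * sv i.
Proof.
have -> : \sum_(i < r) O * (301 * (1 + if i < 2 * b then 0 else b)) * sv i =
  O * \sum_(0 <= i < r) 301 * (sv i + if i < 2 * b then 0 else b * sv i).
  rewrite big_mkord big_distrr; apply: eq_bigr => i _; rewrite -!mulnA; congr (_ * (_ * _)).
  by rewrite mulnDl mul1n; case: ifP.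
rewrite -mulnDr leq_mul2l -addnA leq_add2l; apply/orP; right.
have H : \sum_(0 <= i < r) (if i < 2 * b then b else 0) <= minn r (2 * b) * b.
  elim: r => [|r IH]; first by rewrite big_nil.
  rewrite big_nat_recr //=; case: ltnP => rb.
    have -> : minn r.+1 (2 * b) = (minn r (2 * b)).+1 by lia.
    by rewrite mulSn addnC leq_add2l.
  by apply: leq_trans (_ : minn r (2 * b) * b <= _); rewrite ?addn0 // leq_mul2r; lia.
have H2 : minn r (2 * b) * b <= 2 * b * b by rewrite leq_mul2r geq_minr orbT.
rewrite -!big_distrr /= -mulnDr leq_mul2l /=.
apply: (@leq_trans (\sum_(0 <= i < r) (if i < 2 * b then b else 0) +
   \sum_(0 <= i < r) (sv i + (if i < 2 * b then 0 else b * sv i)))); last first.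
  by rewrite leq_add2r (leq_trans H H2).
by rewrite -big_split /=; apply: leq_sum => i _; case: ifP => _; lia.
Qed.

Lemma bit_of_sum w (c : nat -> bool) k : k < w ->
  odd ((\sum_(j < w) c j * 2 ^ j) %/ 2 ^ k) = c k.
Proof.
elim: w k c => // w IH k c kw; rewrite big_ord_recl /= expn0 muln1.
have -> : \sum_(i < w) c (bump 0 i) * 2 ^ bump 0 i = 2 * \sum_(i < w) c i.+1 * 2 ^ i.
  by rewrite big_distrr /=; apply: eq_bigr => i _; rewrite /bump /= add1n expnS mulnCA.
case: k kw => [|k] kw; first by rewrite divn1 oddD oddb oddM addbF.
rewrite expnS divnMA -(IH k (fun j => c j.+1)) //; congr (odd (_ %/ _)).
by rewrite addnC mulnC divnMDl //; case: (c 0); rewrite addn0.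
Qed.

Local Open Scope classical_set_scope.
Local Open Scope ring_scope.

Lemma random_word_lt (Omega : Type) (coin : nat * nat * nat -> Omega -> bool) w x t i :
  (random_word coin w x t i < 2 ^ w)%N.
Proof.
rewrite /random_word; elim: w => [|w IH]; first by rewrite big_ord0.
rewrite big_ord_recr /= expnS; move: IH; move: (\sum_(_ < _) _)%N (2 ^ w)%N => u v.
by case: (coin _ x) => /=; rewrite ?mul1n ?mul0n; lia.
Qed.

(** * Fair coins: measurability and independence of random words *)

Section Coins.
Variables (R : realType) (d : measure_display) (Omega : measurableType d)
  (P : probability Omega R) (coin : nat * nat * nat -> Omega -> bool).
Hypothesis fc : fair_coins P coin.
Local Notation idx := (nat * nat * nat)%type.

Lemma coin_measurable i c : measurable [set x | coin i x = c].
Proof.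
case: c; first exact: fc.1.
rewrite (_ : [set x | _] = ~` [set x | coin i x]); first exact: measurableC (fc.1 i).
by apply/seteqP; split=> x /=; case: (coin i x).
Qed.

(** [E] is split by the outcome of the first coin; each part is the trace of a set that depends on
    the remaining coins only. *)
Lemma finite_dependence_measurable (s : seq idx) (E : set Omega) :
  (forall x y, (forall i, i \in s -> coin i x = coin i y) -> E x -> E y) ->
  measurable E.
Proof.
elim: s E => [|i s IH] E H.
  have [[x Ex]|nE] := pselect (exists x, E x).
    by rewrite (_ : E = setT) //; apply/seteqP; split=> // y _; apply: H Ex.
  by rewrite (_ : E = set0) //; apply/seteqP; split=> // x Ex; apply: nE; exists x.
pose F c := [set x | exists y, [/\ coin i y = c, forall j, j \in s -> coin j y = coin j x & E y]].
have mF c : measurable (F c).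
  apply: IH => x y xy [z [z1 z2 z3]]; exists z; split=> // j js; rewrite z2 //; exact: xy.
rewrite (_ : E = (F true `&` [set x | coin i x = true]) `|` (F false `&` [set x | coin i x = false])).
  by apply: measurableU; apply: measurableI => //; exact: coin_measurable.
apply/seteqP; split=> x.
  by move=> Ex; case E' : (coin i x); [left|right]; split=> //; exists x.
by case=> -[[y [y1 y2 y3]] /= cx]; apply: H y3 => j; rewrite inE => /orP[/eqP->|/y2 //];
  rewrite y1 cx.
Qed.

Lemma union_bound (T : Type) (l : seq T) (E : T -> set Omega) (F : set Omega) (p : R) :
  (forall z, measurable (E z)) -> measurable F ->
  F `<=` [set x | exists2 i, (i < size l)%N & forall z0, E (nth z0 l i) x] ->
  (forall z, (P (E z) <= p%:E)%E) ->
  (P F <= ((size l)%:R * p)%:E)%E.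
Proof.
move=> mE; elim: l F => [|z l IH] F mF sub HP.
  rewrite mul0r (_ : F = set0) ?measure0 //.
  by apply/seteqP; split=> // x /sub[].
have mFE : measurable (F `\` E z) by apply: measurableD.
have H := IH (F `\` E z) mFE.
apply: le_trans (_ : (P (E z `|` (F `\` E z)) <= _)%E).
  apply: le_measure; rewrite ?inE //; first exact: measurableU.
  by move=> x Fx; have [?|?] := pselect (E z x); [left|right].
apply: le_trans (measureU2 _ _ _) _ => //.
rewrite -natr1 mulrDl mul1r addrC EFinD; apply: leeD; last exact: HP.
apply: H => //.
move=> x [Fx nEx]; have [[|i] /= il Hi] := sub x Fx; first by case: nEx; exact: Hi z.
by exists i.
Qed.

Definition word_coins w t : seq idx := [seq (t, 0%N, j) | j <- iota 0 w].

Lemma words_measurable w (ts : nat -> nat) (B : pred nat) k :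
  measurable [set x | forall r, (r < k)%N -> B (random_word coin w x (ts r) 0%N)].
Proof.
apply: (@finite_dependence_measurable (flatten [seq word_coins w (ts r) | r <- iota 0 k])) => x y xy Hx r rk.
have := Hx r rk; rewrite /random_word; congr (is_true (B _)); apply: eq_bigr => j _.
rewrite xy //; apply/flatten_mapP; exists r; rewrite ?mem_iota //.
by apply: (map_f (fun j => (ts r, 0%N, j))); rewrite mem_iota add0n /=.
Qed.

(** Only the probabilities of cylinders are given. Each value of a word is a cylinder of probability
    2 ^ -w, and at most half of the values are bad, so each word contributes a factor 1/2. *)
Lemma random_words_bound w (ts : nat -> nat) (B : pred nat) k :
  injective ts -> (2 * count B (iota 0 (2 ^ w)) <= 2 ^ w)%N ->
  (P [set x | forall r, (r < k)%N -> B (random_word coin w x (ts r) 0%N)] <= (2^-1 ^+ k)%:E)%E.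
Proof.
move=> ti HB.
pose F k := [set x | forall r, (r < k)%N -> B (random_word coin w x (ts r) 0%N)].
pose cyl (s : seq idx) (c : idx -> bool) := [set x | forall i, i \in s -> coin i x = c i].
have mcyl s c : measurable (cyl s c).
  apply: (@finite_dependence_measurable s) => x y xy Hx i si; rewrite -xy //; exact: Hx.
have mF k' : measurable (F k') by exact: words_measurable.
(* The intersection with a cylinder over other coins makes the induction possible: the value of the
   last word moves into the cylinder. *)
suff H k' : forall s c, uniq s -> (forall r j, (r < k')%N -> (ts r, 0%N, j) \notin s) ->
   (P (F k' `&` cyl s c) <= (2^-1 ^+ k' * 2^-1 ^+ size s)%:E)%E.
  have := H k [::] xpred0 isT (fun _ _ _ => isT); rewrite mulr1.
  by rewrite (_ : cyl [::] xpred0 = setT) ?setIT //; apply/seteqP.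
elim: k' => [|k' IH] s c us Hs.
  rewrite mul1r; have <- := fc.2 s c us; apply: le_measure; rewrite ?inE //.
  - exact: measurableI.
  - exact: mcyl.
pose l := [seq z <- iota 0 (2 ^ w) | B z].
pose ws := word_coins w (ts k').
pose c' (z : nat) (i : idx) := if i \in s then c i else odd (z %/ 2 ^ i.2)%N.
pose E z := F k' `&` cyl (s ++ ws) (c' z).
have PE z : (P (E z) <= (2^-1 ^+ k' * 2^-1 ^+ (size s + w))%:E)%E.
  have <- : size (s ++ ws) = (size s + w)%N by rewrite size_cat size_map size_iota.
  apply: IH.
    rewrite cat_uniq us map_inj_uniq ?iota_uniq ?andbT; last by move=> i j [].
    by apply/hasPn => _ /mapP[j _ ->]; apply: Hs.
  move=> r j rk; rewrite mem_cat negb_or Hs /=; last exact: ltnW.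
  apply/mapP => -[j' _ [/ti E' _]]; by rewrite E' ltnn in rk.
apply: (@le_trans _ _ ((size l)%:R * (2^-1 ^+ k' * 2^-1 ^+ (size s + w)))%:E).
  apply: (@union_bound _ l E) => //.
  - by move=> z; apply: measurableI.
  - exact: measurableI.
  - move=> x [Fx cx] /=.
    set z := random_word coin w x (ts k') 0%N.
    have zw : (z < 2 ^ w)%N by exact: random_word_lt.
    have zl : z \in l by rewrite mem_filter mem_iota add0n leq0n zw !andbT; exact: (Fx k' (ltnSn k')).
    exists (index z l) => [|z0]; first by rewrite index_mem.
    rewrite nth_index //; split; first by move=> r rk; exact: (Fx r (leqW rk)).
    move=> i; rewrite /c' mem_cat; case: (boolP (i \in s)) => [si _|_ /=]; first exact: cx.
    case/mapP=> j; rewrite mem_iota /= add0n => jw ->.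
    by rewrite /z /random_word (@bit_of_sum w (fun j => coin (ts k', 0%N, j) x)).
rewrite lee_fin exprS exprD.
have H : 2 * (size l)%:R <= (2 : R) ^+ w.
  by rewrite -natrX -natrM ler_nat size_filter.
have H2 : (2^-1 : R) ^+ w * 2 ^+ w = 1 by rewrite -exprMn mulVf // expr1n.
have H3 : 0 <= (2^-1 : R) ^+ w by rewrite exprn_ge0.
have H4 : (2 * (size l)%:R) * 2^-1 ^+ w <= (1 : R).
  by apply: le_trans (ler_wpM2r H3 H) _; rewrite mulrC H2.
have H5 : 0 <= (2^-1 : R) ^+ k' * 2^-1 ^+ size s by rewrite mulr_ge0 ?exprn_ge0.
move: H4 H5; move: (2^-1 ^+ k') (2^-1 ^+ size s) (2^-1 ^+ w) ((size l)%:R) => a c0 u S H4 H5.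
rewrite (_ : S * (a * (c0 * u)) = (a * c0) * (S * u)); last by ring.
rewrite (_ : 2^-1 * a * c0 = (a * c0) * 2^-1); last by ring.
by apply: ler_wpM2l => //; lra.
Qed.

End Coins.

(* Unlike [ge0_le_integral], this does not require measurability. *)
Lemma le_integral_nonneg (R : realType) d (T : measurableType d) (mu : {measure set T -> \bar R})
    (f g : T -> \bar R) : (forall x, 0 <= f x)%E -> (forall x, f x <= g x)%E ->
  (\int[mu]_x f x <= \int[mu]_x g x)%E.
Proof.
move=> f0 fg; have g0 x : (0 <= g x)%E by apply: le_trans (fg x).
rewrite !ge0_integralTE //; apply: ereal_sup_le => _ /= [h hf <-].
by exists h => // x; apply: le_trans (fg x).
Qed.

(** * Expected work *)

Section ExpectedCost.
Variables (R : realType) (d : measure_display) (Omega : measurableType d)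
  (P : probability Omega R).

(** [f], possibly infinite, is dominated pointwise by a series of indicators, which is integrated
    term by term. The round k at which the count vanishes may vary with x, hence the full series. *)
Lemma expected_cost (f : Omega -> \bar R) (A K M : nat) (c : nat -> nat)
    (sv : nat -> nat -> Omega -> bool) :
  (forall x, 0 <= f x)%E -> (forall a n, measurable [set x | sv a n x]) ->
  (forall n, 0 < c n)%N ->
  (forall a n, (a < M)%N -> (P [set x | sv a n x] <= (2^-1 ^+ n)%:E)%E) ->
  (forall k, \sum_(n < k) (c n * M)%:R * (2^-1 : R) ^+ n <= K%:R) ->
  (forall x k, count (fun a => sv a k x) (iota 0 M) = 0%N ->
     (f x <= ((A + \sum_(n < k) c n * count (fun a => sv a n x) (iota 0 M))%N%:R)%:E)%E) ->
  (\int[P]_x f x <= ((A + K)%:R)%:E)%E.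
Proof.
move=> f0 msv c0 Psv HK Hf.
pose u n a x : \bar R := ((c n)%:R%:E * (\1_[set x | sv a n x] x)%:E)%E.
pose h n x := (\sum_(a <- iota 0 M) u n a x)%E.
have hE n x : h n x = ((c n * count (fun a => sv a n x) (iota 0 M))%:R)%:E.
  rewrite /h; elim: (iota 0 M) => [|a l IH]; first by rewrite big_nil muln0.
  rewrite big_cons IH /u /= -EFinM -EFinD; congr (_%:E).
  by rewrite indicE mem_setE mulnDr natrD (natrM _ (c n) (sv a n x)).
have mh1 n a : measurable_fun setT (u n a).
  by apply: measurable_funeM; apply/measurable_EFinP; exact: measurable_indic.
have mh n : measurable_fun setT (h n) by apply: emeasurable_sum.
have h0 n x : (0 <= h n x)%E by rewrite hE lee_fin ler0n.
have fg x : (f x <= A%:R%:E + \sum_(n <oo) h n x)%E.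
  have part k : (\sum_(n < k) c n * count (fun a => sv a n x) (iota 0 M))%N%:R%:E = (\sum_(0 <= n < k) h n x)%E :> \bar R.
    rewrite big_mkord; elim: k => [|k IH]; first by rewrite !big_ord0.
    by rewrite !big_ord_recr /= natrD EFinD IH hE.
  have [[k Ek]|nk] := pselect (exists k, count (fun a => sv a k x) (iota 0 M) = 0%N).
    apply: le_trans (Hf x k Ek) _; rewrite natrD EFinD leeD2l // part.
    by apply: nneseries_lim_ge.
  (* If no count vanishes, every term is at least 1 and the bound is infinite. *)
  suff -> : (\sum_(n <oo) h n x = +oo)%E by rewrite addey // leey.
  apply/eqyP => r r0; have [k rk] : exists k : nat, r <= k%:R.
    by exists (Num.bound r); apply: ltW; apply: archi_boundP; exact: ltW.
  apply: le_trans (nneseries_lim_ge k _) => //; rewrite -part lee_fin.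
  apply: le_trans rk _; rewrite ler_nat -[leqLHS](card_ord k) -sum1_card; apply: leq_sum => n _.
  rewrite muln_gt0 c0 lt0n; apply/negP => /eqP E; by apply: nk; exists n.
apply: le_trans (le_integral_nonneg _ f0 fg) _.
have ge0A : (0 <= A%:R%:E :> \bar R)%E by rewrite lee_fin ler0n.
have mser : measurable_fun setT (fun x => \sum_(n <oo) h n x)%E.
  by apply: ge0_emeasurable_sum => // n x _ _; exact: h0.
rewrite ge0_integralD //; last by move=> x _; apply: nneseries_ge0.
rewrite integral_cst // [X in (_ * X)%E]probability_setT mule1 natrD EFinD leeD2l //.
rewrite integral_nneseries //.
apply: lime_le; first by apply: is_cvg_nneseries => n _ _; exact: integral_ge0.
apply: nearW => k; rewrite big_mkord.
apply: (@le_trans _ _ (\sum_(n < k) ((c n * M)%:R * (2^-1 : R) ^+ n)%:E)%E); last first.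
  by rewrite sumEFin lee_fin.
apply: lee_sum => n _; rewrite ge0_integral_sum //; last first.
  by move=> a x _; rewrite mule_ge0 // lee_fin ?ler0n // indicE ler0n.
apply: (@le_trans _ _ (\sum_(a <- iota 0 M) ((c n)%:R * (2^-1 : R) ^+ n)%:E)%E).
  rewrite big_seq [leRHS]big_seq; apply: lee_sum => a; rewrite mem_iota add0n => /andP[_ aM].
  rewrite ge0_integralZl; first last.
  - by rewrite lee_fin ler0n.
  - by move=> y _; rewrite lee_fin indicE ler0n.
  - by apply/measurable_EFinP; exact: measurable_indic.
  - by [].
  rewrite integral_indic // setIT EFinM lee_pmul2l ?Psv // lte_fin ltr0n c0 //.
rewrite sumEFin lee_fin big_const_seq count_predT size_iota iter_addr_0.
by rewrite natrM -mulrA [M%:R * _]mulrC mulrA mulr_natr.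
Qed.

End ExpectedCost.

Lemma half_tail (R : realType) m k :
  \sum_(n < k) (if (n < m)%N then 0 else (2^-1 : R) ^+ n) <= 2 * 2^-1 ^+ m.
Proof.
(* The added term is the rest of the geometric series, which makes the induction go through. *)
suff H : \sum_(n < k) (if (n < m)%N then 0 else (2^-1 : R) ^+ n) + 2 * 2^-1 ^+ maxn m k <= 2 * 2^-1 ^+ m.
  by apply: le_trans H; rewrite lerDl mulr_ge0 // exprn_ge0.
elim: k => [|k IH]; first by rewrite big_ord0 add0r maxn0.
rewrite big_ord_recr /=; case: ltnP => km.
  have -> : maxn m k.+1 = m by lia.
  by move: IH; have -> : maxn m k = m by [lia]; rewrite addr0.
have E : maxn m k.+1 = k.+1 by lia.
rewrite E exprS; move: IH; have -> : maxn m k = k by lia.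
have -> : 2 * (2^-1 * 2^-1 ^+ k) = (2^-1 : R) ^+ k by rewrite mulrA divff // mul1r.
by move: (\sum_(_ < _) _) (2^-1 ^+ k) => u v; lra.
Qed.

Lemma approx_of_layers (R : realType) (eps : R) n (e : rel 'I_n) q (layer : nat -> nat) :
  (0 < q)%N -> q%:R^-1 <= eps -> (forall v : 'I_n, layer_ok e q v (layer v)) ->
  approx_core_decomposition e (2 + eps) (fun v => layer (val v)).
Proof.
move=> q0 qe H v; have [H1 H2] := H v.
have q0' : 0 < q%:R :> R by rewrite ltr0n.
have e0 : 0 < eps by apply: lt_le_trans qe; rewrite invr_gt0.
have {}H1 : q%:R * (coreness e v)%:R <= (2 * q%:R + 1) * (layer v)%:R :> R.
  by move: H1; rewrite -(ler_nat R) !natrM natrD natrM.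
have {}H2 : (layer v)%:R <= 2 * (coreness e v)%:R :> R by move: H2; rewrite -(ler_nat R) natrM.
have l0 : 0 <= (layer v)%:R :> R by [].
have c0 : 0 <= (coreness e v)%:R :> R by [].
apply/andP; split; last by apply: le_trans H2 _; rewrite ler_wpM2r // lerDl ltW.
rewrite ler_pdivrMr; last by lra.
rewrite -(ler_pM2l q0'); apply: le_trans H1 _.
rewrite mulrCA mulrC; apply: ler_wpM2l => //.
rewrite mulrDr [q%:R * 2]mulrC lerD2l -(@ler_pM2l _ q%:R^-1) ?invr_gt0 // mulr1.
by rewrite mulrA mulVf ?mul1r // gt_eqF.
Qed.

(** * Bounds in expectation and with high probability *)

Section Analysis.
Variables (R : realType) (q : nat) (q_gt0 : (0 < q)%N).
Variables (d : measure_display) (Omega : measurableType d)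
  (P : probability Omega R) (coin : nat * nat * nat -> Omega -> bool)
  (arb : arbiter) (n : nat) (e : rel 'I_n) (adj : 'I_n -> seq 'I_n).
Hypotheses (fc : fair_coins P coin) (n_gt0 : (0 < n)%N)
  (e_sym : symmetric e) (e_irr : irreflexive e) (He : adjacency_lists e adj).
Local Notation kappa := (q + 100)%N.
Local Notation w := (word_size kappa n).
Local Notation b := (trunc_log 2 n).+1.
Local Notation M := (arc_off (rows adj) n).
Local Notation fin := (final kappa (program q kappa) arb coin adj).
Local Notation rw := (random_word coin w).

(* [sv a k x]: arc [a] is in danger of being unresolved after [k] rounds. *)
Lemma final_summary : exists sv : nat -> nat -> Omega -> bool,
  [/\ forall a k, measurable [set x | sv a k x],
      forall a k, (a < M)%N -> (P [set x | sv a k x] <= (2^-1 ^+ k)%:E)%E,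
      forall x s, fin x s -> (forall v : 'I_n, layer_ok e q v (st_mem s v)) /\
        (st_space s <= n + M + 2 + 1000 * (n + M + 1) * 48)%N &
      forall x r, count (fun a => sv a r x) (iota 0 M) = 0%N ->
        exists2 s, fin x s & (st_depth s <= final_time q kappa b r)%N /\
         (st_work s <= op_bound * (work_const q kappa * (n + M + b ^ 3) + 301 * (2 * b * b)) +
            \sum_(i < r) op_bound * (301 * (1 + if i < 2 * b then 0 else b)) *
              count (fun a => sv a i x) (iota 0 M))%N].
Proof.
have [bad [Hbad mach]] := machine e_sym e_irr He n_gt0 q_gt0.
have {}mach x := mach arb (rw x) (fun t i => random_word_lt coin w x t i).
pose sv a k x := all (fun r' => bad a (rw x (seed_time kappa b r') 0%N)) (iota 0 k).
have svE a k : [set x | sv a k x] = [set x | forall r, (r < k)%N -> bad a (rw x (seed_time kappa b r) 0%N)].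
  apply/seteqP; split=> x /=.
    by move=> /allP H r rk; apply: H; rewrite mem_iota add0n.
  by move=> H; apply/allP => r; rewrite mem_iota add0n => /andP[_]; apply: H.
(* Different rounds draw at different times, hence from disjoint sets of coins. *)
have ti : injective (seed_time kappa b).
  move=> r r' /eqP; rewrite /seed_time !eqn_add2r eqn_add2l eqn_pmul2r; first by move/eqP.
  by rewrite /round_time addn_gt0.
exists sv; split.
- by move=> a k; rewrite svE; apply: words_measurable fc _ _ _ _.
- by move=> a k aM; rewrite svE; apply: random_words_bound fc _ _ _ _ ti (Hbad a aM).
- by move=> x s; have [H _] := mach x; exact: H.
- move=> x r r0; have [_ H] := mach x; have [s Xs [Ds Ws]] := H r r0.
  by exists s => //; split=> //; apply: leq_trans Ws _; exact: work_split.
Qed.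

Lemma M_le_pow : (M <= 2 ^ (2 * b))%N.
Proof.
apply: leq_trans (arcs_sq He) _; rewrite mul2n -addnn expnD.
by apply: leq_mul; apply: ltnW; exact: n_lt_pow.
Qed.

Lemma expected_total_work :
  (\int[P]_x total_work R (fin x) <=
   (((op_bound * (20 * work_const q kappa + 301 * 40)) * (n + nb_edges e))%:R)%:E)%E.
Proof.
have [sv [msv Psv _ halts]] := final_summary.
have b3 : (b ^ 3 <= 16 * n)%N.
  by apply: leq_trans (cube_le_exp _) _; rewrite leq_mul2l /=; exact: (n_ge_pow n_gt0).
have bn : (b <= n)%N by exact: b_le_n.
have ME := arcs_edges e_sym e_irr He.
apply: (@le_trans _ _ ((op_bound * (work_const q kappa * (n + M + b ^ 3) + 301 * (2 * b * b)) +
    op_bound * (301 * (2 * M + 2 * b)))%N%:R)%:E).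
  apply: (@expected_cost _ _ _ _ _ _ _ M (fun i => op_bound * (301 * (1 + if (i < 2 * b)%N then 0 else b)))%N sv) => //.
  - move=> x; apply: le_ereal_inf_tmp => _ [s _ <-]; by rewrite lee_fin ler0n.
  - move=> k.
    (* The factor b that is charged from round [2 * b] on is treated apart: by then at most M / 2 ^
       (2 b) <= 1 unresolved arc is expected, so it adds only O(b) in all. *)
    have -> : \sum_(i < k) (op_bound * (301 * (1 + (if (i < 2 * b)%N then 0 else b))) * M)%N%:R * (2^-1 : R) ^+ i =
      (op_bound * 301)%:R * (M%:R * (\sum_(i < k) (if (i < 0)%N then 0 else 2^-1 ^+ i)) +
        b%:R * (M%:R * \sum_(i < k) (if (i < 2 * b)%N then 0 else (2^-1 : R) ^+ i))).
      rewrite !mulr_sumr -big_split /= mulr_sumr; apply: eq_bigr => i _.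
      rewrite mulnA !natrM natrD; case: ifP => _ /=; last by ring.
      by rewrite !mulr0 addr0; ring.
    rewrite mulnA [leRHS]natrM; apply: ler_wpM2l; first exact: ler0n.
    rewrite natrD !natrM; apply: lerD.
      by rewrite mulrC ler_wpM2r // (le_trans (half_tail R 0 k)) // expr0 mulr1.
    rewrite [leRHS]mulrC; apply: ler_wpM2l => //.
    apply: le_trans (ler_wpM2l _ (half_tail R (2 * b) k)) _ => //.
    rewrite mulrCA -[leRHS]mulr1; apply: ler_wpM2l => //.
    have E : (2 : R) ^+ (2 * b) * 2^-1 ^+ (2 * b) = 1 by rewrite -exprMn divff // expr1n.
    rewrite -[leRHS]E.
    apply: ler_wpM2r; first by rewrite exprn_ge0.
    by rewrite -natrX ler_nat M_le_pow.
  - move=> x k k0; have [s Fs [_ Ws]] := halts x k k0.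
    apply: (@le_trans _ _ ((st_work s)%:R)%:E); last by rewrite lee_fin ler_nat.
    by apply: ereal_inf_lbound; exists s.
rewrite lee_fin ler_nat -(mulnDr op_bound) -(mulnA op_bound) leq_mul2l; apply/orP; right.
have b2 : (b * b <= b ^ 3)%N by rewrite !expnS expn0 muln1 leq_mul2l leq_pmulr ?orbT.
have : (work_const q kappa * (n + M + b ^ 3) <= work_const q kappa * (20 * (n + nb_edges e)))%N.
  by rewrite leq_mul2l; apply/orP; right; lia.
rewrite mulnA [(work_const _ _ * 20)%N]mulnC mulnDl; move: (work_const _ _) => wc.
rewrite -(mulnA 2); move: (b * b)%N (b ^ 3)%N b2 b3 => x y b2 b3.
by move: (_ * (_ + y))%N (20 * wc * _)%N => u v; lia.
Qed.

End Analysis.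

Section HighProbability.
Variables (R : realType) (q : nat) (q_gt0 : (0 < q)%N).
Variables (d : measure_display) (Omega : measurableType d)
  (P : probability Omega R) (coin : nat * nat * nat -> Omega -> bool)
  (arb : arbiter) (n : nat) (e : rel 'I_n) (adj : 'I_n -> seq 'I_n).
Hypotheses (fc : fair_coins P coin) (n_gt1 : (1 < n)%N)
  (e_sym : symmetric e) (e_irr : irreflexive e) (He : adjacency_lists e adj).
Local Notation kappa := (q + 100)%N.
Local Notation w := (word_size kappa n).
Local Notation b := (trunc_log 2 n).+1.
Local Notation M := (arc_off (rows adj) n).
Local Notation fin := (final kappa (program q kappa) arb coin adj).

Let n_gt0 : (0 < n)%N. Proof. exact: ltnW. Qed.

Lemma fast_measurable (B : R) :
  measurable [set x | exists2 s, fin x s & (st_depth s)%:R <= B].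
Proof.
have [sv [_ _ space _]] := final_summary q_gt0 arb fc n_gt0 e_sym e_irr He.
pose S := (n + M + 2 + 1000 * (n + M + 1) * 48)%N.
pose T := Num.bound B.
(* The list consists of the coins of all words that a run of depth at most [T] and space at most [S]
   can read. *)
apply: (@finite_dependence_measurable _ _ _ _ _ fc
  [seq (ti, j) | ti <- [seq (t, i) | t <- iota 0 T.+1, i <- iota 0 S.+1], j <- iota 0 w]).
move=> x y xy [s Xs sB]; exists s => //.
have [_ sS] := space x s Xs.
have B0 : 0 <= B by apply: le_trans sB.
apply: (@exec_local _ _ _ _ T S _ _ _ _ Xs) => //.
  move=> t i tT iS; apply: eq_bigr => j _; congr (nat_of_bool _ * _)%N; apply: xy.
  apply: (allpairs_f (fun ti j => (ti, j))); last by rewrite mem_iota add0n /=.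
  by apply: (allpairs_f (fun t i => (t, i))); rewrite mem_iota add0n ltnS.
by rewrite -(ler_nat R); apply: le_trans sB (ltW (archi_boundP B0)).
Qed.

(** For n > 1 the bit length is at least 2, so b <= 2 (b - 1) <= 2 log_2 n; for n = 1 the logarithm
    would vanish. *)
Lemma bit_length_ln : (b%:R : R) <= 2 / ln 2 * ln n%:R.
Proof.
have l2 : 0 < ln (2 : R) by rewrite ln_gt0 ?ltr1n.
have b2 : (2 <= b)%N.
  by have := n_lt_pow n_gt0; case: (trunc_log 2 n) => [|//]; rewrite expn1; lia.
have H : ln (2 : R) *+ b.-1 <= ln n%:R.
  rewrite -lnXn // ler_ln ?posrE ?exprn_gt0 ?ltr0n // -natrX ler_nat.
  exact: n_ge_pow.
rewrite mulrAC ler_pdivlMr //; apply: (@le_trans _ _ (2 * (ln (2 : R) *+ b.-1))).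
  rewrite -[ln 2 *+ _]mulr_natr [leRHS](_ : _ = (2 * b.-1)%N%:R * ln 2); last by rewrite natrM; ring.
  by apply: ler_wpM2r; [exact: ltW | rewrite ler_nat; lia].
by rewrite ler_wpM2l.
Qed.

Lemma fast_probability (c D0 D : nat) :
  (forall b0, (0 < b0)%N -> (final_time q kappa b0 ((c + 2) * b0) <= D0 * b0 ^ 3)%N) ->
  D0%:R * (2 / ln (2 : R)) ^+ 3 <= D%:R ->
  ((1 - ((n%:R : R) ^+ c)^-1)%:E <=
   P [set x | exists2 s, fin x s & ((st_depth s)%:R <= D%:R * ln (n%:R : R) ^+ 3)%R])%E.
Proof.
move=> HD0 HD.
have [sv [msv Psv _ halts]] := final_summary q_gt0 arb fc n_gt0 e_sym e_irr He.
set E := [set x | _]; have mE : measurable E by exact: fast_measurable.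
(* Each of the M <= n^2 arcs survives r rounds with probability at most 2 ^ -r; the summand 2
   compensates n^2 and leaves 1 / n ^ c. *)
pose r := ((c + 2) * b)%N.
have fast x : ~ E x -> exists2 a, (a < M)%N & sv a r x.
  move=> nE; apply: contrapT => H; apply: nE.
  have [|s Fs [Ds _]] := halts x r.
    apply/eqP; rewrite -leqn0 leqNgt -has_count; apply/negP => /hasP[a].
    by rewrite mem_iota add0n => /andP[_ aM] sa; apply: H; exists a.
  exists s => //; apply: le_trans (_ : (D0 * b ^ 3)%N%:R <= _).
    by rewrite ler_nat; apply: leq_trans Ds _; exact: HD0.
  have ln0 : 0 <= ln (n%:R : R) by rewrite ln_ge0 // ler1n.
  apply: (@le_trans _ _ (D0%:R * (2 / ln 2) ^+ 3 * ln n%:R ^+ 3)).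
    rewrite natrM natrX -mulrA -exprMn; apply: ler_wpM2l => //.
    by apply: lerXn2r; rewrite ?nnegrE ?(le_trans _ bit_length_ln) // bit_length_ln.
  by apply: ler_wpM2r => //; rewrite exprn_ge0.
have Hbad : (P (~` E) <= (M%:R * 2^-1 ^+ r)%:E)%E.
  rewrite -{1}(size_iota 0 M).
  apply: (@union_bound _ _ _ _ _ (iota 0 M) (fun a => [set x | (a < M)%N /\ sv a r x])).
  - move=> a; case: (ltnP a M) => aM.
      by rewrite (_ : [set x | _] = [set x | sv a r x]) //; apply/seteqP; split=> x //= [].
    by rewrite (_ : [set x | _] = set0) //; apply/seteqP; split=> x //= [].
  - exact: measurableC.
  - move=> x /fast[a aM sa]; exists a; rewrite ?size_iota // => z0.
    by rewrite nth_iota // add0n.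
  - move=> a; case: (ltnP a M) => aM.
      rewrite (_ : [set x | _] = [set x | sv a r x]); first exact: Psv.
      by apply/seteqP; split=> x //= [].
    rewrite (_ : [set x | _] = set0) ?measure0 ?lee_fin ?exprn_ge0 //.
    by apply/seteqP; split=> x //= [].
have PE : P E = (1 - P (~` E))%E by rewrite -probability_setC ?setCK //; exact: measurableC.
have nP : 0 < n%:R :> R by rewrite ltr0n.
have small : M%:R * 2^-1 ^+ r <= ((n%:R : R) ^+ c)^-1.
  rewrite exprVn -[leLHS]/(_ / _) ler_pdivrMr ?exprn_gt0 // ler_pdivlMl ?exprn_gt0 //.
  rewrite -!natrX -natrM ler_nat /r [((c + 2) * b)%N]mulnC expnM.
  apply: leq_trans (_ : n ^ c * n ^ 2 <= _)%N.
    by rewrite leq_mul2l -mulnn (arcs_sq He) orbT.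
  by rewrite -expnD leq_exp2r ?addn_gt0 ?orbT //; apply: ltnW; exact: n_lt_pow.
rewrite PE EFinB; apply: leeB => //.
by apply: le_trans Hbad _; rewrite lee_fin.
Qed.

End HighProbability.

Theorem theorem3p8 (R : realType) (eps : R) (eps_gt0 : 0 < eps) :
  exists (prog : cmd) (kappa : nat),
    (exists C : nat,
      forall (d : measure_display) (Omega : measurableType d)
        (P : probability Omega R) (coin : nat * nat * nat -> Omega -> bool)
        (arb : arbiter) (n : nat) (e : rel 'I_n) (adj : 'I_n -> seq 'I_n),
      fair_coins P coin -> (0 < n)%N ->
      symmetric e -> irreflexive e -> adjacency_lists e adj ->
      (forall x s, final kappa prog arb coin adj x s ->
         approx_core_decomposition e (2 + eps) (fun v => st_mem s (val v)) /\
         (st_space s <= C * (n + nb_edges e))%N) /\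
      (\int[P]_x total_work R (final kappa prog arb coin adj x)
         <= ((C * (n + nb_edges e))%:R)%:E)%E) /\
    (forall c : R, 1 <= c -> exists D : nat,
      forall (d : measure_display) (Omega : measurableType d)
        (P : probability Omega R) (coin : nat * nat * nat -> Omega -> bool)
        (arb : arbiter) (n : nat) (e : rel 'I_n) (adj : 'I_n -> seq 'I_n),
      fair_coins P coin -> (1 < n)%N ->
      symmetric e -> irreflexive e -> adjacency_lists e adj ->
      ((1 - (n%:R `^ c)^-1)%:E <=
       P [set x | exists2 s, final kappa prog arb coin adj x s &
                    ((st_depth s)%:R <= D%:R * ln (n%:R : R) ^+ 3)%R])%E).
Proof.
(* Large enough that 2 + 1 / q is at most 2 + eps. *)
pose q := (Num.bound eps^-1).+1; have q_gt0 : (0 < q)%N by [].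
have qe : q%:R^-1 <= eps.
  rewrite -[leRHS]invrK lef_pV2 ?posrE ?invr_gt0 ?ltr0n //.
  have := archi_boundP (ltW (_ : 0 < eps^-1)); rewrite invr_gt0 => /(_ eps_gt0) H.
  by apply: le_trans (ltW H) _; rewrite ler_nat.
exists (program q (q + 100)), (q + 100)%N; split.
(* The first summand is for space: input and 48 arrays take at most 49 times 1000 (n + M + 1) words,
   and n + M + 1 <= 2 (n + m). The second is the constant of the expected work. *)
- exists (100 * 1000 + op_bound * (20 * work_const q (q + 100) + 301 * 40))%N.
  move=> d Omega P coin arb n e adj fc n_gt0 e_sym e_irr He; split; last first.
    apply: le_trans (expected_total_work q_gt0 arb fc n_gt0 e_sym e_irr He) _.
    by rewrite lee_fin ler_nat leq_mul2r leq_addl orbT.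
  have [sv [_ _ space _]] := final_summary q_gt0 arb fc n_gt0 e_sym e_irr He.
  move=> x s Xs; have [Hl Hs] := space x s Xs; split; first exact: (approx_of_layers q_gt0 qe Hl).
  apply: leq_trans Hs _; apply: leq_trans (_ : 100 * (1000 * (n + nb_edges e)) <= _)%N; last first.
    by rewrite [leqLHS]mulnA leq_mul2r leq_addr orbT.
  have ME := arcs_edges e_sym e_irr He; move: (nb_edges e) (arc_off _ _) ME => m M ME.
  have H1 : (n + M + 2 <= 1000 * (n + M + 1))%N.
    by apply: (@leq_trans (2 * (n + M + 1))%N); [lia | rewrite leq_mul2r orbT].
  have H2 : (1000 * (n + M + 1) <= 2 * (1000 * (n + m)))%N by rewrite mulnCA leq_mul2l /=; lia.
  move: H1 H2; move: (n + M + 2)%N (1000 * (n + M + 1))%N (1000 * (n + m))%N.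
  by clear => x y z; lia.
(* The real exponent is replaced by a larger integer, which fixes the number [(c' + 2) * b] of hash
   rounds; [D] then absorbs the passage from b to ln n. *)
- move=> c c1; pose c' := Num.bound c; have c0 : 0 <= c by apply: le_trans c1.
  have [D0 HD0] := final_time_bound q (q + 100) (c' + 2).
  pose D := Num.bound (D0%:R * (2 / ln (2 : R)) ^+ 3).
  exists D => d Omega P coin arb n e adj fc n_gt1 e_sym e_irr He.
  apply: le_trans (fast_probability q_gt0 arb fc n_gt1 e_sym e_irr He HD0 (D := D) _); last first.
    apply: ltW; apply: archi_boundP; rewrite mulr_ge0 // exprn_ge0 // divr_ge0 // ln_ge0 //.
    by rewrite ler1n.
  have n1 : 1 <= n%:R :> R by rewrite ler1n ltnW.
  have n0 : 0 < n%:R :> R by apply: lt_le_trans n1.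
  rewrite lee_fin lerD2l lerN2 lef_pV2 ?posrE ?exprn_gt0 ?powR_gt0 //.
  by rewrite -powR_mulrn ?ler0n // ler_powR // ltW // archi_boundP.
Qed.
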